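(* Let $f\colon M\to\mathbb{S}^n$ be a substantial exceptional surface that is isometric to an isotropic pseudoholomorphic curve $g\colon M \to\mathbb{S}^6$. Then $n=6$ and $f$ is congruent to $g$.
   Context: Surfaces. $M$ is a connected oriented $2$-dimensional Riemannian manifold (Riemann surface) with complex structure $J$. A minimal surface $f\colon M\to\mathbb{S}^n$ is a minimal isometric immersion into the unit sphere. It is substantial if $f(M)$ is not contained in any proper totally geodesic submanifold (subsphere) of $\mathbb{S}^n$. Two surfaces are congruent if they differ by an isometry of the ambient sphere. Pseudoholomorphic curves. $\mathbb{S}^6$ is the unit sphere in the imaginary Cayley numbers $\mathbb{R}^7=\mathrm{Im}\,\mathbb{O}$, with the nearly Kähler almost complex structure induced by Cayley multiplication ($v\mapsto p\cdot v$ on $T_p\mathbb{S}^6$). A pseudoholomorphic curve is a nonconstant smooth map $g\colon M\to\mathbb{S}^6$ from a Riemann surface whose differential is complex linear. $M$ carries the metric induced by $g$, and $g$ is regarded as an isometric immersion. A surface $f\colon M\to\mathbb{S}^n$ is isometric to $g$ if $f$ and $g$ induce the same Riemannian metric on $M$. Isotropic and exceptional surfaces. Let $\alpha^f$ be the second fundamental form and $\nabla^\perp$ the normal connection. Put $\alpha^f_2=\alpha^f$ and, for $s\ge3$, $\alpha^f_s(X_1,\dots,X_s)=(\nabla^\perp_{X_s}\cdots\nabla^\perp_{X_3}\alpha^f(X_2,X_1))^\perp$, where $(\cdot)^\perp$ is projection onto the orthogonal complement of $N_1^f\oplus\cdots\oplus N_{s-2}^f$ in the normal bundle and $N^f_k$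 is the span of the values of $\alpha^f_{k+1}$. The $r$-th curvature ellipse at $p$ is $\mathcal{E}^f_r(p)=\{\alpha^f_{r+1}(Z^\varphi,\dots,Z^\varphi): Z^\varphi=\cos\varphi Z+\sin\varphi JZ,\ \varphi\in[0,2\pi)\}\subset N_r^f(p)$, $Z$ a unit tangent vector. The surface is regular where the $N_k^f$ have locally constant dimension (an open dense set). A substantial minimal surface is $s$-isotropic if, at regular points, $\mathcal{E}^f_r$ is a circle for all $1\le r\le s$, and isotropic if this holds for all $s$. In particular an isotropic pseudoholomorphic curve $g\colon M\to\mathbb{S}^6$ is substantial in $\mathbb{S}^6$ with first and second curvature ellipses circles. With a local complex coordinate $z=x+iy$ and $\partial=\frac12(\partial_x-i\partial_y)$, the $r$-th Hopf differential is $\Phi_r=\langle\alpha^f_{r+1}(\partial,\dots,\partial),\alpha^f_{r+1}(\partial,\dots,\partial)\rangle dz^{2r+2}$ (complex bilinear extensions). A minimal surface is $r$-exceptional if $\Phi_1,\dots,\Phi_{r+1}$ are holomorphic; equivalently all curvature ellipses $\mathcal E_s^f$, $1\le s\le r$, have constant eccentricity $(\kappa_s^2-\mu_s^2)^{1/2}/\kappa_s$, where $\kappa_s\ge\mu_s\ge0$ are the lengths of the semi-axes. A minimal surface in $\mathbb{S}^n$ is exceptional if it is $r$-exceptional for $r=[(n-1)/2-1]$, $[\cdot]$ being the integer part. *)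

(* Defs.v *)
From HB Require Import structures.
From mathcomp Require Import all_boot all_order all_algebra.
From mathcomp Require Import complex.
From mathcomp Require Import all_classical all_reals all_analysis.

Set Implicit Arguments.
Unset Strict Implicit.
Unset Printing Implicit Defensive.

Import Order.TTheory GRing.Theory Num.Theory.
Import numFieldNormedType.Exports.

Local Open Scope classical_set_scope.
Local Open Scope ring_scope.

(* Coordinates on a surface take values in the plane 'rV[R]_2, identified with
   the complex plane by (x, y) = x + iy; maps into spheres are maps into the
   ambient Euclidean space of row vectors. *)

Definition dot (R : realType) (m : nat) (u v : 'rV[R]_m) : R := (u *m v^T) 0 0.

Definition sphere (R : realType) (n : nat) : set 'rV[R]_n.+1 :=
  [set u | dot u u = 1].
Arguments sphere {R} n.

(* Component of u orthogonal to the row space of A: the row space of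
   kermx A^T is the orthogonal complement of that of A. *)
Definition perp (R : realType) (k m : nat) (A : 'M[R]_(k, m)) (u : 'rV[R]_m) :
  'rV[R]_m := u *m proj_mx (kermx A^T) <<A>>%MS.

Definition rotJ (R : realType) (v : 'rV[R]_2) : 'rV[R]_2 :=
  \row_(i < 2) (if i == 0 then - v 0 1 else v 0 0).

Definition complex_differentiable (R : realType)
  (h : 'rV[R]_2 -> 'rV[R]_2) (x : 'rV[R]_2) : Prop :=
  differentiable h x /\ forall v, 'd h x (rotJ v) = rotJ ('d h x v).

(* Imposed at all points of an open set, smooth_at says that the map is
   infinitely differentiable there. *)
Fixpoint iter_derive (R : realType) (m : nat)
    (F : 'rV[R]_2 -> 'rV[R]_m.+1) (w : seq 'rV[R]_2) : 'rV[R]_2 -> 'rV[R]_m.+1 :=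
  if w is v :: w' then 'D_v (iter_derive F w') else F.

Definition smooth_at (R : realType) (m : nat)
    (F : 'rV[R]_2 -> 'rV[R]_m.+1) (x : 'rV[R]_2) : Prop :=
  forall w : seq 'rV[R]_2, differentiable (iter_derive F w) x.

(* to_coord and of_coord are only meaningful on chart_dom and chart_img. *)
Record chart (R : realType) (M : topologicalType) := Chart {
  chart_dom : set M;
  chart_img : set 'rV[R]_2;
  to_coord : M -> 'rV[R]_2;
  of_coord : 'rV[R]_2 -> M;
  chart_dom_open : open chart_dom;
  chart_img_open : open chart_img;
  to_coord_img : forall p, chart_dom p -> chart_img (to_coord p);
  of_coord_dom : forall x, chart_img x -> chart_dom (of_coord x);
  to_coordK : forall p, chart_dom p -> of_coord (to_coord p) = p;
  of_coordK : forall x, chart_img x -> to_coord (of_coord x) = x;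
  to_coord_continuous : forall p, chart_dom p -> {for p, continuous to_coord};
  of_coord_continuous : forall x, chart_img x -> {for x, continuous of_coord}
}.

Record riemannSurface (R : realType) := RiemannSurface {
  surface_pt :> topologicalType;
  atlas : set (chart R surface_pt);
  atlas_cover : forall p : surface_pt, exists2 c, atlas c & chart_dom c p;
  atlas_holomorphic : forall c d, atlas c -> atlas d ->
    forall x, chart_img c x -> chart_dom d (of_coord c x) ->
    complex_differentiable (to_coord d \o of_coord c) x;
  surface_hausdorff : hausdorff_space surface_pt;
  surface_second_countable : @second_countable surface_pt;
  surface_connected : connected [set: surface_pt]
}.

(* A property P of (the germ of) a coordinate expression F of f at a point x of
   the plane, required at all points of M and in all charts. *)
Definition in_charts (R : realType) (M : riemannSurface R) (T : Type)
    (f : M -> T) (P : ('rV[R]_2 -> T) -> 'rV[R]_2 -> Prop) : Prop :=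
  forall c, atlas c -> forall x, chart_img c x -> P (f \o of_coord c) x.

Section LocalGeometry.
Variables (R : realType) (n : nat).
Implicit Types (F : 'rV[R]_2 -> 'rV[R]_n.+1) (x u v : 'rV[R]_2).

Definition metric F x u v : R := dot ('D_u F x) ('D_v F x).

Definition vx : 'rV[R]_2 := delta_mx 0 0.
Definition vy : 'rV[R]_2 := delta_mx 0 1.

(* Projection onto the normal space of the surface in the unit sphere, i.e.
   onto the orthogonal complement of the position vector and of the tangent
   plane. *)
Definition normal_proj F x (xi : 'rV[R]_n.+1) : 'rV[R]_n.+1 :=
  perp (col_mx (F x) (col_mx ('D_vx F x) ('D_vy F x))) xi.

Definition normal_connection F v (xi : 'rV[R]_2 -> 'rV[R]_n.+1) :
  'rV[R]_2 -> 'rV[R]_n.+1 := fun x => normal_proj F x ('D_v xi x).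

Definition second_ff F u v : 'rV[R]_2 -> 'rV[R]_n.+1 :=
  fun x => normal_proj F x ('D_u ('D_v F) x).

(* For w = [:: X_s; ...; X_1], the iterated normal derivative of
   second_ff X_2 X_1 along X_3, ..., X_s, where tangent vectors are extended to
   vector fields with constant coordinates. *)
Fixpoint nabla_second_ff F (w : seq 'rV[R]_2) : 'rV[R]_2 -> 'rV[R]_n.+1 :=
  match w with
  | [:: X2; X1] => second_ff F X2 X1
  | X :: w' => normal_connection F X (nabla_second_ff F w')
  | [::] => fun=> 0
  end.

(* Span of the values of an s-linear map A on the plane: it is enough to
   evaluate A on basis vectors. *)
Definition values_span (s : nat) (A : seq 'rV[R]_2 -> 'rV[R]_n.+1) :
    'M[R]_n.+1 :=
  (\sum_(w : s.-tuple 'I_2) <<A [seq delta_mx 0 i | i <- w]>>)%MS.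

(* N_1 + ... + N_k at x, see normal_sumS below. *)
Fixpoint normal_sum F (k : nat) x : 'M[R]_n.+1 :=
  if k is j.+1 then
    (normal_sum F j x +
     values_span j.+2
       (fun w => perp (normal_sum F j x) (nabla_second_ff F w x)))%MS
  else 0.

(* The higher fundamental form alpha_s, with s = size w >= 2. Modulo
   N_1 + ... + N_(s-2), the iterated normal derivative does not depend on how
   the tangent vectors are extended to vector fields. *)
Definition higher_ff F (w : seq 'rV[R]_2) x : 'rV[R]_n.+1 :=
  perp (normal_sum F (size w).-2 x) (nabla_second_ff F w x).

Definition normal_space F (k : nat) x : 'M[R]_n.+1 :=
  values_span k.+1 (fun w => higher_ff F w x).

Lemma normal_sumS F (k : nat) x :
  normal_sum F k.+1 x = (normal_sum F k x + normal_space F k.+1 x)%MS.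
Proof.
rewrite /= /normal_space /values_span; congr (_ + _)%MS.
by apply: eq_bigr => w _; rewrite /higher_ff size_map size_tuple.
Qed.

Definition regular_at F x : Prop :=
  \forall y \near x, forall k : nat, (1 <= k)%N ->
    \rank (normal_space F k y) = \rank (normal_space F k x).

Definition curvature_ellipse F (r : nat) x (Z : 'rV[R]_2) : set 'rV[R]_n.+1 :=
  [set higher_ff F (nseq r.+1 (cos phi *: Z + sin phi *: rotJ Z)) x
     | phi in [set phi : R | 0 <= phi < 2 * pi]].

(* Radius 0 is allowed: where N_r = 0 the ellipse is reduced to a point. *)
Definition is_circle (E : set 'rV[R]_n.+1) : Prop :=
  exists (c e1 e2 : 'rV[R]_n.+1) (rho : R),
    [/\ 0 <= rho, dot e1 e1 = 1, dot e2 e2 = 1, dot e1 e2 = 0 &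
        E = [set c + rho *: (cos t *: e1 + sin t *: e2) | t in [set: R]]].

(* Complex multilinear extension of alpha_s evaluated at (d, ..., d), where
   d = (vx - i vy) / 2 is the Wirtinger vector. *)
Definition wirtinger_coef (i : 'I_2) : R[i] :=
  if i == 0 then (2^-1 : R)%:C%C else (0 -i* 2^-1)%C.

Definition higher_ff_wirtinger F (s : nat) x : 'rV[R[i]]_n.+1 :=
  \sum_(w : s.-tuple 'I_2) (\prod_(i <- w) wirtinger_coef i) *:
    map_mx (real_complex R) (higher_ff F [seq delta_mx 0 i | i <- w] x).

Definition hopf F (r : nat) x : R[i] :=
  \sum_(k < n.+1) higher_ff_wirtinger F r.+1 x 0 k ^+ 2.

Definition hopf_plane F (r : nat) x : 'rV[R]_2 :=
  \row_(i < 2) (if i == 0 then complex.Re (hopf F r x)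
                else complex.Im (hopf F r x)).

End LocalGeometry.

Section Surfaces.
Variables (R : realType) (M : riemannSurface R).

Definition smooth_to_sphere (n : nat) (f : M -> 'rV[R]_n.+1) : Prop :=
  (forall p, sphere n (f p)) /\ in_charts f (fun F x => smooth_at F x).

Definition immersive (n : nat) (f : M -> 'rV[R]_n.+1) : Prop :=
  in_charts f (fun F x => forall v, 'D_v F x = 0 -> v = 0).

(* The complex structure of M is the rotation by a right angle for the metric
   induced by f. *)
Definition compatible_metric (n : nat) (f : M -> 'rV[R]_n.+1) : Prop :=
  in_charts f (fun F x => forall v,
    metric F x (rotJ v) (rotJ v) = metric F x v v /\
    metric F x v (rotJ v) = 0).

(* Vanishing trace, in the induced metric, of the second fundamental form. *)
Definition zero_mean_curvature (n : nat) (f : M -> 'rV[R]_n.+1) : Prop :=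
  in_charts f (fun F x => forall u v,
    metric F x u u = 1 -> metric F x v v = 1 -> metric F x u v = 0 ->
    second_ff F u u x + second_ff F v v x = 0).

Definition minimal_surface (n : nat) (f : M -> 'rV[R]_n.+1) : Prop :=
  [/\ smooth_to_sphere f, immersive f, compatible_metric f &
      zero_mean_curvature f].

(* The totally geodesic subspheres are the sections of the sphere by linear
   subspaces. *)
Definition substantial (n : nat) (f : M -> 'rV[R]_n.+1) : Prop :=
  forall W : 'M[R]_n.+1, (forall p, (f p <= W)%MS) -> row_full W.

Definition s_isotropic (n s : nat) (f : M -> 'rV[R]_n.+1) : Prop :=
  substantial f /\
  in_charts f (fun F x => regular_at F x ->
    forall r Z, (1 <= r <= s)%N -> metric F x Z Z = 1 ->
      is_circle (curvature_ellipse F r x Z)).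

Definition isotropic (n : nat) (f : M -> 'rV[R]_n.+1) : Prop :=
  forall s, s_isotropic s f.

(* Hopf differentials are considered on the open set of regular points, where
   the higher fundamental forms are smooth tensors. *)
Definition hopf_holomorphic (n r : nat) (f : M -> 'rV[R]_n.+1) : Prop :=
  in_charts f (fun F x => regular_at F x ->
    complex_differentiable (hopf_plane F r) x).

Definition r_exceptional (n r : nat) (f : M -> 'rV[R]_n.+1) : Prop :=
  forall s, (1 <= s <= r.+1)%N -> hopf_holomorphic s f.

(* For n <= 2 truncated subtraction gives r = 0 instead of a negative r; then
   the only condition concerns the first Hopf differential, which is
   holomorphic on every minimal surface. *)
Definition exceptional (n : nat) (f : M -> 'rV[R]_n.+1) : Prop :=
  r_exceptional ((n - 1) %/ 2 - 1) f.

Definition isometric_surfaces (n m : nat)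
    (f : M -> 'rV[R]_n.+1) (g : M -> 'rV[R]_m.+1) : Prop :=
  forall c, atlas c -> forall x, chart_img c x -> forall u v,
    metric (f \o of_coord c) x u v = metric (g \o of_coord c) x u v.

End Surfaces.

Definition sphere_dist (R : realType) (m : nat) (u v : 'rV[R]_m) : R :=
  acos (dot u v).

Definition sphere_isometry (R : realType) (n m : nat)
    (T : 'rV[R]_n.+1 -> 'rV[R]_m.+1) : Prop :=
  set_bij (sphere n) (sphere m) T /\
  forall u v, sphere n u -> sphere n v ->
    sphere_dist (T u) (T v) = sphere_dist u v.

Definition congruent (R : realType) (M : riemannSurface R) (n m : nat)
    (f : M -> 'rV[R]_n.+1) (g : M -> 'rV[R]_m.+1) : Prop :=
  exists2 T : 'rV[R]_n.+1 -> 'rV[R]_m.+1,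
    sphere_isometry T & forall p, T (f p) = g p.

(* Cayley numbers a + u, with a real and u imaginary. The basis of Im O is
   indexed by the integers mod 7, with e_k e_(k+1) = e_(k+3) and cyclic
   permutations thereof. *)
Definition octonion (R : realType) : Type := (R * 'rV[R]_7)%type.

Definition cayley_cross (R : realType) (u v : 'rV[R]_7) : 'rV[R]_7 :=
  \row_(k < 7)
    ((u 0 (k + 1) * v 0 (k + 3) - u 0 (k + 3) * v 0 (k + 1)) +
     (u 0 (k + 2) * v 0 (k + 6) - u 0 (k + 6) * v 0 (k + 2)) +
     (u 0 (k + 4) * v 0 (k + 5) - u 0 (k + 5) * v 0 (k + 4))).

Definition cayley_mul (R : realType) (a b : octonion R) : octonion R :=
  (a.1 * b.1 - dot a.2 b.2,
   a.1 *: b.2 + b.1 *: a.2 + cayley_cross a.2 b.2).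

Definition imO (R : realType) (u : 'rV[R]_7) : octonion R := (0, u).

Definition pseudoholomorphic (R : realType) (M : riemannSurface R)
    (g : M -> 'rV[R]_7) : Prop :=
  [/\ @smooth_to_sphere R M 6 g,
      exists p q, g p <> g q &
      @in_charts R M _ g (fun G x => forall v : 'rV[R]_2,
        imO (derive (G : 'rV[R]_2 -> 'rV[R]_7) x (rotJ v)) =
        cayley_mul (imO (G x)) (imO (derive G x v)))].

(* Main.v *)
(* In a local complex coordinate the harmonic sequence of a minimal surface is
   F_0 = f, F_1 = f_z, F_(j+1) = (F_j)_z - (log h_j)_z F_j with h_j = |F_j|^2, and
   the Toda equations (log h_j)_(z zbar) = h_(j+1) / h_j - h_j / h_(j-1) determine
   h_2, h_3, h_4 from h_1, that is from the metric. The cross product of Im O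
   shows that an isotropic pseudoholomorphic curve g has 2 h_3 = h_1 h_2; the Toda
   equations then give h_4 = 0 for every minimal surface f with the same metric,
   so that the harmonic sequence of f stops after F_3 and f is isotropic. The
   frames (F_0, F_j, conj F_j) and (G_0, G_j, conj G_j), 1 <= j <= 3, satisfy the
   same linear system, so the partial isometry taking one to the other is
   constant near a point. As the coordinates of f and g solve
   u_(z zbar) = - h_1 u in every chart, unique continuation makes f T = g global,
   and substantiality makes T orthogonal. *)
From HB Require Import structures.
Require Import Defs.
From mathcomp Require Import all_boot all_order all_algebra.
From mathcomp Require Import ring lra.
From mathcomp Require Import complex.
From mathcomp Require Import all_classical all_reals all_analysis.

Set Implicit Arguments.
Unset Strict Implicit.
Unset Printing Implicit Defensive.

Import Order.TTheory GRing.Theory Num.Theory.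
Import numFieldNormedType.Exports.
Local Open Scope classical_set_scope.
Local Open Scope ring_scope.

(** * Harmonic sequences in a ring with two derivations *)

(** No step divides: the inverse of a squared norm h_j is carried as an element i_j with h_j i_j =
    1, so that the algebra takes place in a commutative ring and [ring] decides its identities. The
    price is that h_2 must be invertible. Its zeros are avoided by working on a small open set, and
    what is proved there reaches the rest of M only by unique continuation. This is proved for
    smooth solutions of u_(z zbar) = - lam u, without analyticity, by a maximum principle for (u^2 +
    |u_z|^2) exp(beta) with a steep radial weight beta. The vanishing of h_4 comes from log h_3 =
    log h_1 + log h_2 + const: adding two Toda equations gives (log h_3)_(z zbar) = h_3 / h_2 - h_1,
    and 2 h_3 = h_1 h_2 turns the right side into - h_3 / h_2, which leaves h_4 / h_3 = 0 in the
    Toda equation for h_3. Isotropy of g is only given at regular points, where the ranks of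
    infinitely many normal spaces are locally constant; that such points are dense is deduced from
    semicontinuity of rank. *)

(* Models smooth complex functions on a plane domain: dz stands for d/dz, cj
   for complex conjugation, and d/dz-bar is cj \o dz \o cj. *)
Record wirtinger (A : comPzRingType) := Wirtinger {
  dz : A -> A;
  cj : {rmorphism A -> A};
  half : A;
  dzD : forall a b, dz (a + b) = dz a + dz b;
  dzM : forall a b, dz (a * b) = dz a * b + a * dz b;
  cjK : forall a, cj (cj a) = a;
  dz_cj : forall a, dz (cj (dz (cj a))) = cj (dz (cj (dz a)));
  halfE : half + half = 1
}.

Section Bilinear.
Variable A : comPzRingType.

Definition bil m (u v : 'rV[A]_m) : A := (u *m v^T) 0 0.

Lemma bilE m (u v : 'rV[A]_m) : bil u v = \sum_k u 0 k * v 0 k.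
Proof. by rewrite /bil mxE; apply: eq_bigr => k _; rewrite mxE. Qed.

Lemma bilC m (u v : 'rV[A]_m) : bil u v = bil v u.
Proof. by rewrite !bilE; apply: eq_bigr => k _; rewrite mulrC. Qed.

Lemma bilDl m (u v w : 'rV[A]_m) : bil (u + v) w = bil u w + bil v w.
Proof. by rewrite /bil mulmxDl mxE. Qed.

Lemma bilDr m (u v w : 'rV[A]_m) : bil w (u + v) = bil w u + bil w v.
Proof. by rewrite bilC bilDl ![bil _ w]bilC. Qed.

Lemma bilZl m a (u w : 'rV[A]_m) : bil (a *: u) w = a * bil u w.
Proof. by rewrite /bil -scalemxAl mxE. Qed.

Lemma bilZr m a (u w : 'rV[A]_m) : bil w (a *: u) = a * bil w u.
Proof. by rewrite bilC bilZl bilC. Qed.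

Lemma bilNl m (u w : 'rV[A]_m) : bil (- u) w = - bil u w.
Proof. by rewrite -scaleN1r bilZl mulN1r. Qed.

Lemma bilNr m (u w : 'rV[A]_m) : bil w (- u) = - bil w u.
Proof. by rewrite bilC bilNl bilC. Qed.

Lemma bil0l m (w : 'rV[A]_m) : bil 0 w = 0.
Proof. by rewrite /bil mul0mx mxE. Qed.

Lemma bil0r m (w : 'rV[A]_m) : bil w 0 = 0.
Proof. by rewrite bilC bil0l. Qed.

Lemma mul_outer m p (u v : 'rV[A]_m) (w : 'rV[A]_p) :
  u *m (v^T *m w) = bil u v *: w.
Proof. by rewrite mulmxA [u *m _]mx11_scalar mul_scalar_mx. Qed.

Definition bilE2 := (bilDl, bilDr, bilZl, bilZr, bilNl, bilNr, bil0l, bil0r).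

End Bilinear.

Section Derivations.
Variables (A : comPzRingType) (W : wirtinger A).
Local Notation d := (dz W).
Local Notation c := (cj W).

Definition dzb a := c (d (c a)).
Local Notation db := dzb.

Lemma dz0 : d 0 = 0.
Proof. by apply: (addrI (d 0)); rewrite -dzD !addr0. Qed.

Lemma dzN a : d (- a) = - d a.
Proof. by apply/(addrI (d a)); rewrite -dzD !subrr dz0. Qed.

Lemma dz1 : d 1 = 0.
Proof.
have : d (1 * 1) = d 1 by rewrite mulr1.
by rewrite dzM mulr1 mul1r => /(canRL (addrK _)); rewrite subrr.
Qed.

Lemma dz_sum (I : Type) (r : seq I) (P : pred I) (G : I -> A) :
  d (\sum_(i <- r | P i) G i) = \sum_(i <- r | P i) d (G i).
Proof. exact: (big_morph d (dzD W) dz0). Qed.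

Lemma dzX a n : d (a ^+ n.+1) = n.+1%:R * a ^+ n * d a.
Proof.
elim: n => [|n IH]; first by rewrite expr1 expr0; ring.
by rewrite exprS dzM {}IH !exprS [n.+2%:R]mulrS; ring.
Qed.

Lemma dzbD a b : db (a + b) = db a + db b.
Proof. by rewrite /dzb rmorphD dzD rmorphD. Qed.

Lemma dzbN a : db (- a) = - db a.
Proof. by rewrite /dzb rmorphN dzN rmorphN. Qed.

Lemma dzbM a b : db (a * b) = db a * b + a * db b.
Proof. by rewrite /dzb rmorphM dzM rmorphD !rmorphM !cjK. Qed.

Lemma dzb0 : db 0 = 0. Proof. by rewrite /dzb rmorph0 dz0 rmorph0. Qed.

Lemma cj_dz a : c (d a) = db (c a). Proof. by rewrite /dzb cjK. Qed.

Lemma cj_dzb a : c (db a) = d (c a). Proof. by rewrite /dzb cjK. Qed.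

Lemma dz_dzb a : d (db a) = db (d a). Proof. exact: dz_cj. Qed.

Lemma double_eq0 (a : A) : a + a = 0 -> a = 0.
Proof.
by move=> e; rewrite -[a]mul1r -(halfE W) mulrDl -mulrDr e mulr0.
Qed.

Lemma inv_unique (a b b' : A) : a * b = 1 -> a * b' = 1 -> b = b' :> A.
Proof. by move=> e e'; rewrite -[b]mulr1 -e' mulrA [b * a]mulrC e mul1r. Qed.

Lemma cj_inv (a b : A) : a * b = 1 -> c a = a -> c b = b.
Proof.
by move=> e ca; apply: (@inv_unique a) => //; rewrite -[X in X * _]ca -rmorphM e rmorph1.
Qed.

Lemma dz_inv (a b : A) : a * b = 1 -> d b = - (b * b * d a).
Proof.
move=> e; have := dz1; rewrite -e dzM => e1.
have -> : d b = b * (d a * b + a * d b) - b * b * d a by ring: e.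
by rewrite e1 mulr0 sub0r.
Qed.

Definition vd m p (u : 'M[A]_(m, p)) := map_mx d u.
Definition vdb m p (u : 'M[A]_(m, p)) := map_mx db u.
Definition vc m p (u : 'M[A]_(m, p)) := map_mx c u.

Lemma vdD m p (u v : 'M[A]_(m, p)) : vd (u + v) = vd u + vd v.
Proof. by apply/matrixP => i j; rewrite !mxE dzD. Qed.

Lemma vdN m p (u : 'M[A]_(m, p)) : vd (- u) = - vd u.
Proof. by apply/matrixP => i j; rewrite !mxE dzN. Qed.

Lemma vdZ m p a (u : 'M[A]_(m, p)) : vd (a *: u) = d a *: u + a *: vd u.
Proof. by apply/matrixP => i j; rewrite !mxE dzM. Qed.

Lemma vdM m p q (u : 'M[A]_(m, p)) (v : 'M[A]_(p, q)) :
  vd (u *m v) = vd u *m v + u *m vd v.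
Proof.
apply/matrixP => i j; rewrite !mxE dz_sum -big_split /=.
by apply: eq_bigr => k _; rewrite !mxE dzM.
Qed.

Lemma vdT m p (u : 'M[A]_(m, p)) : vd u^T = (vd u)^T.
Proof. by apply/matrixP => i j; rewrite !mxE. Qed.

Lemma vdbE m p (u : 'M[A]_(m, p)) : vdb u = vc (vd (vc u)).
Proof. by apply/matrixP => i j; rewrite !mxE. Qed.

Lemma vcK m p (u : 'M[A]_(m, p)) : vc (vc u) = u.
Proof. by apply/matrixP => i j; rewrite !mxE cjK. Qed.

Lemma vcD m p (u v : 'M[A]_(m, p)) : vc (u + v) = vc u + vc v.
Proof. exact: map_mxD. Qed.

Lemma vcN m p (u : 'M[A]_(m, p)) : vc (- u) = - vc u.
Proof. exact: map_mxN. Qed.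

Lemma vcZ m p a (u : 'M[A]_(m, p)) : vc (a *: u) = c a *: vc u.
Proof. exact: map_mxZ. Qed.

Lemma vcM m p q (u : 'M[A]_(m, p)) (v : 'M[A]_(p, q)) :
  vc (u *m v) = vc u *m vc v.
Proof. exact: map_mxM. Qed.

Lemma vcT m p (u : 'M[A]_(m, p)) : vc u^T = (vc u)^T.
Proof. by apply/matrixP => i j; rewrite !mxE. Qed.

Lemma vc_sum m p (I : Type) (r : seq I) (P : pred I) (G : I -> 'M[A]_(m, p)) :
  vc (\sum_(i <- r | P i) G i) = \sum_(i <- r | P i) vc (G i).
Proof. exact: map_mx_sum. Qed.

Lemma vdbD m p (u v : 'M[A]_(m, p)) : vdb (u + v) = vdb u + vdb v.
Proof. by rewrite !vdbE !(vcD, vdD). Qed.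

Lemma vdbN m p (u : 'M[A]_(m, p)) : vdb (- u) = - vdb u.
Proof. by rewrite !vdbE !(vcN, vdN). Qed.

Lemma vdbZ m p a (u : 'M[A]_(m, p)) : vdb (a *: u) = db a *: u + a *: vdb u.
Proof. by rewrite !vdbE !(vcZ, vdZ, vcD, vcK) cjK. Qed.

Lemma vdb_vd m p (u : 'M[A]_(m, p)) : vdb (vd u) = vd (vdb u).
Proof. by apply/matrixP => i j; rewrite !mxE -dz_dzb. Qed.

Lemma vc_vd m p (u : 'M[A]_(m, p)) : vc (vd u) = vdb (vc u).
Proof. by rewrite vdbE vcK. Qed.

Lemma vc_vdb m p (u : 'M[A]_(m, p)) : vc (vdb u) = vd (vc u).
Proof. by rewrite vdbE vcK. Qed.

Lemma dz_bil m (u v : 'rV[A]_m) : d (bil u v) = bil (vd u) v + bil u (vd v).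
Proof.
by rewrite !bilE dz_sum -big_split; apply: eq_bigr => k _; rewrite !mxE dzM.
Qed.

Lemma cj_bil m (u v : 'rV[A]_m) : c (bil u v) = bil (vc u) (vc v).
Proof. by rewrite !bilE rmorph_sum; apply: eq_bigr => k _; rewrite rmorphM !mxE. Qed.

Lemma dzb_bil m (u v : 'rV[A]_m) : db (bil u v) = bil (vdb u) v + bil u (vdb v).
Proof. by rewrite /dzb cj_bil dz_bil rmorphD !cj_bil !vcK -!vdbE. Qed.

(* P, Q are consecutive terms of a harmonic sequence and iP is the inverse of the
   squared norm hP of P, so that d hP * iP is the d-derivative of log hP. *)
Definition harmonic_pair m (P Q : 'rV[A]_m) (hP iP hQ : A) :=
  [/\ hP * iP = 1, bil P (vc P) = hP, bil Q (vc Q) = hQ,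
      vd P = Q + (d hP * iP) *: P &
      vdb Q = - (hQ * iP) *: P /\ bil Q (vc P) = 0].

Lemma norm_real m (u : 'rV[A]_m) h : bil u (vc u) = h -> c h = h.
Proof. by move=> <-; rewrite cj_bil vcK bilC. Qed.

(** Commuting the two derivations on Q shows that the d/dz-bar derivative of S is - th Q.
    Differentiating <S, conj Q> = 0 then identifies th hQ with hS, so the Toda equation and the next
    pair come out together. *)
Lemma harmonic_step m (P Q : 'rV[A]_m) hP iP hQ iQ :
  harmonic_pair P Q hP iP hQ -> hQ * iQ = 1 ->
  let S := vd Q - (d hQ * iQ) *: Q in
  let hS := bil S (vc S) in
  harmonic_pair Q S hQ iQ hS /\ db (d hQ * iQ) = hS * iQ - hQ * iP.
Proof.
move=> [eP nP nQ dP [dbQ QP]] eQ S hS.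
have cP := norm_real nP; have cQ := norm_real nQ.
have ciP := cj_inv eP cP; have ciQ := cj_inv eQ cQ.
have dQ : vd Q = S + (d hQ * iQ) *: Q by rewrite /S subrK.
(* From the derivative of the norm hQ of Q: the derivative of conj Q is a multiple of conj P, to
   which Q is orthogonal. *)
have SQ : bil S (vc Q) = 0.
  have := dz_bil Q (vc Q); rewrite nQ -vc_vdb dbQ vcZ rmorphN rmorphM cQ ciP.
  rewrite dQ !bilE2 nQ QP => e.
  by apply: (addIr (d hQ)); rewrite add0r [RHS]e; ring: eQ.
pose th := hQ * iP + db (d hQ * iQ).
have dbS : vdb S = - th *: Q.
  rewrite /S vdbD vdbN vdbZ vdb_vd dbQ vdZ dP !dzN dzM (dz_inv eP) /th.
  apply/matrixP => i j; rewrite !mxE.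
  by ring: eQ.
have hSd : hS = bil S (vc S) by [].
clearbody hS S.
have hSE : hS = th * hQ.
  have := dzb_bil S (vc Q); rewrite SQ dzb0 dbS -vc_vd dQ vcD vcZ !bilE2 nQ SQ.
  by rewrite -hSd => e; apply/eqP; rewrite -subr_eq0 [X in _ == X]e; apply/eqP; ring.
split; last by rewrite hSE /th; ring: eQ.
split=> //; split=> //; rewrite dbS hSE; congr (- _ *: _); ring: eQ.
Qed.

Lemma dzb_pair m (P Q : 'rV[A]_m) hP iP hQ :
  harmonic_pair P Q hP iP hQ -> vd (vc Q) = - (hQ * iP) *: vc P.
Proof.
case=> eP nP nQ _ [dbQ _].
rewrite -vc_vdb dbQ vcZ rmorphN rmorphM (norm_real nQ).
by rewrite (cj_inv eP (norm_real nP)).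
Qed.

(** Isotropy together with unitary orthogonality: [F 0], the [F j] and their conjugates for 0 < j <=
    K form a frame of 2 K + 1 pairwise orthogonal vectors for the Hermitian product, with inverse
    squared norms [i j]. *)
Definition orthogonal_seq m (K : nat) (F : nat -> 'rV[A]_m) (i : nat -> A) :=
  [/\ vc (F 0%N) = F 0%N, bil (F 0%N) (F 0%N) = 1,
      forall j, (0 < j <= K)%N -> bil (F j) (F 0%N) = 0,
      forall j k, (0 < j <= K)%N -> (0 < k <= K)%N -> bil (F j) (F k) = 0 &
      forall j k, (0 < j <= K)%N -> (0 < k <= K)%N ->
        i k * bil (F j) (vc (F k)) = (j == k)%:R].

(* A terminating harmonic sequence of a minimal surface is isotropic. The
   bilinear products <F2,F2> and <F3,F3> are holomorphic and their d-derivatives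
   are proportional to them; the factor is a logarithmic derivative whose
   d/dz-bar is invertible, so both vanish. *)
Lemma terminating_isotropic m (F0 F1 F2 F3 : 'rV[A]_m) h1 i1 h2 i2 h3 i3 :
  vc F0 = F0 -> bil F1 F1 = 0 ->
  harmonic_pair F0 F1 1 1 h1 -> harmonic_pair F1 F2 h1 i1 h2 ->
  harmonic_pair F2 F3 h2 i2 h3 -> harmonic_pair F3 0 h3 i3 0 ->
  db (d h1 * i1) = h2 * i1 - h1 -> db (d h2 * i2) = h3 * i2 - h2 * i1 ->
  db (d h3 * i3) = - (h3 * i2) ->
  orthogonal_seq 3 (nth 0 [:: F0; F1; F2; F3]) (nth 0 [:: 1; i1; i2; i3]).
Proof.
move=> rF0 iF1 p0 p1 p2 p3 t1 t2 t3.
have c1 := dzb_pair p0; have c2 := dzb_pair p1; have c3 := dzb_pair p2.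
have [_ n0 n1 d0 [b1 o10]] := p0; have [e1 _ n2 d1 [b2 o21]] := p1.
have [e2 _ n3 d2 [b3 o32]] := p2; have [e3 _ _ d3 _] := p3.
rewrite rF0 in o10 n0 c1; rewrite dz1 mul0r scale0r addr0 in d0.
rewrite add0r in d3.
have q20 : bil F2 F0 = 0.
  have := dz_bil F1 F0; rewrite o10 dz0 d1 d0 !bilE2 iF1 o10.
  by rewrite mulr0 !addr0 => <-.
have q21 : bil F2 F1 = 0.
  apply: double_eq0; have := dz_bil F1 F1.
  by rewrite iF1 dz0 d1 !bilE2 iF1 mulr0 !addr0 [bil F1 F2]bilC => <-.
have q30 : bil F3 F0 = 0.
  have := dz_bil F2 F0.
  by rewrite q20 dz0 d2 d0 !bilE2 q20 q21 mulr0 !addr0 => <-.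
have q31 : bil F3 F1 = - bil F2 F2.
  have := dz_bil F2 F1; rewrite q21 dz0 d2 d1 !bilE2 q21 => e.
  by apply/eqP; rewrite -subr_eq0 [X in _ == X]e; apply/eqP; ring.
have d22 := dz_bil F2 F2; rewrite d2 !bilE2 [bil F2 F3]bilC in d22.
have d31 := dz_bil F3 F1; rewrite d3 d1 !bilE2 q31 dzN in d31.
have b22 : db (bil F2 F2) = 0.
  by rewrite dzb_bil b2 !bilE2 [bil F1 F2]bilC q21; ring.
have q22 : bil F2 F2 = 0.
  set ph := bil F2 F2 in d22 d31 b22 *.
  (* Obtained by eliminating <F3,F2> between the derivatives of <F2,F2> and of <F3,F1> = - <F2,F2>.
     The d/dz-bar derivative of the last factor telescopes to - h1 by the three Toda equations. *)
  have e : d ph + d ph + d ph = (ph + ph) * (d h1 * i1 + d h2 * i2 + d h3 * i3).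
    have -> : d ph + d ph + d ph = d ph - (- d ph + - d ph) by ring.
    by rewrite {1}d22 d31; ring.
  have := congr1 db e; rewrite dzbM !dzbD -dz_dzb b22 t1 t2 t3 dz0 => e'.
  apply: double_eq0; have -> : ph + ph = - i1 * ((ph + ph) * - h1).
    by ring: e1.
  have -> : (ph + ph) * - h1 = 0 by rewrite -[RHS]addr0 -[X in _ = X + _]addr0 e'; ring.
  by rewrite mulr0.
have q32 : bil F3 F2 = 0.
  by apply: double_eq0; move: d22; rewrite q22 dz0 !mulr0 !addr0 => <-.
have q33 : bil F3 F3 = 0.
  have b33 : db (bil F3 F3) = 0.
    by rewrite dzb_bil b3 !bilE2 [bil F2 F3]bilC q32; ring.
  have := dz_bil F3 F3; rewrite d3 !bilE2 => /(congr1 db).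
  rewrite -dz_dzb b33 dz0 dzbD dzbM b33 t3 => e.
  apply: double_eq0.
  have -> : bil F3 F3 + bil F3 F3
            = - (h2 * i3) * (- (h3 * i2) * bil F3 F3 + - (h3 * i2) * bil F3 F3).
    by ring: e2 e3.
  have -> : - (h3 * i2) * bil F3 F3 + - (h3 * i2) * bil F3 F3 = 0.
    by rewrite [RHS]e; ring.
  by rewrite mulr0.
have o20 : bil F2 (vc F0) = 0 by rewrite rF0.
have o31 : bil F3 (vc F1) = 0.
  have := dz_bil F2 (vc F1); rewrite o21 dz0 d2 c1 !bilE2 o21 q20.
  by rewrite !mulr0 !addr0 => <-.
have sym (u v : 'rV[A]_m) : bil u (vc v) = 0 -> bil v (vc u) = 0.
  by move=> e; rewrite -[v]vcK -cj_bil bilC e rmorph0.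
split=> //.
- by case=> [|[|[|[|j]]]].
- case=> [|[|[|[|j]]]] // [|[|[|[|k]]]] //= _ _; rewrite 1?bilC ?q31 ?q22 ?oppr0 //.
  by rewrite bilC q31 q22 oppr0.
case=> [|[|[|[|j]]]] // [|[|[|[|k]]]] //= _ _;
  rewrite ?n1 ?n2 ?n3 ?o21 ?o31 ?o32 ?(sym _ _ o21) ?(sym _ _ o31) ?(sym _ _ o32) ?mulr0 //.
all: by rewrite mulrC.
Qed.

(** The partial isometry in dyadic form: acting on the right, it takes the frame of F to that of G
    and kills the complement of the frame of F. For F = G it is the orthogonal projector onto the
    span of the frame. *)
Definition transfer m p (K : nat) (F : nat -> 'rV[A]_m) (G : nat -> 'rV[A]_p)
    (i : nat -> A) : 'M[A]_(m, p) :=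
  (F 0%N)^T *m G 0%N
  + \sum_(1 <= j < K.+1) i j *: ((vc (F j))^T *m G j + (F j)^T *m vc (G j)).

Lemma transferT m p K (F : nat -> 'rV[A]_m) (G : nat -> 'rV[A]_p) i :
  (transfer K F G i)^T = transfer K G F i.
Proof.
rewrite /transfer linearD /= trmx_mul trmxK; congr (_ + _).
rewrite raddf_sum; apply: eq_bigr => j _.
by apply/matrixP => a b; rewrite !mxE !big_ord1 !mxE; ring.
Qed.

Lemma cj_transfer m p K (F : nat -> 'rV[A]_m) (G : nat -> 'rV[A]_p) i :
  vc (F 0%N) = F 0%N -> vc (G 0%N) = G 0%N ->
  (forall j, (0 < j <= K)%N -> c (i j) = i j) ->
  vc (transfer K F G i) = transfer K F G i.
Proof.
move=> rF rG ri; rewrite /transfer vcD vcM vcT rF rG; congr (_ + _).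
rewrite vc_sum; apply: eq_big_nat => j hj.
by rewrite vcZ vcD !vcM !vcT !vcK ri // addrC.
Qed.

(* The derivatives of the summands telescope. *)
Lemma dz_transfer m p K (F : nat -> 'rV[A]_m) (G : nat -> 'rV[A]_p) h i :
  vc (F 0%N) = F 0%N -> vc (G 0%N) = G 0%N -> h 0%N = 1 ->
  (forall j, (j <= K)%N -> harmonic_pair (F j) (F j.+1) (h j) (i j) (h j.+1)) ->
  (forall j, (j <= K)%N -> harmonic_pair (G j) (G j.+1) (h j) (i j) (h j.+1)) ->
  vd (transfer K F G i)
  = i K *: ((vc (F K))^T *m G K.+1 + (F K.+1)^T *m vc (G K)).
Proof.
move=> rF rG h0; rewrite /transfer; elim: K => [|K IH] pF pG.
  have [] := pF 0%N isT; have [] := pG 0%N isT; rewrite h0 mul1r.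
  move=> -> _ _ dG _ _ _ _ dF _; rewrite big_geq // addr0 vdM vdT dF dG.
  by rewrite dz1 mul0r !scale0r !addr0 scale1r rF rG addrC.
rewrite big_nat_recr //= addrA vdD IH => [|j hj|j hj]; last 2 first.
- by apply: pF; rewrite leqW.
- by apply: pG; rewrite leqW.
have kF := dzb_pair (pF K (leqnSn K)); have kG := dzb_pair (pG K (leqnSn K)).
have [e _ _ dF _] := pF K.+1 (leqnn _); have [_ _ _ dG _] := pG K.+1 (leqnn _).
rewrite vdZ vdD !vdM !vdT kF kG dF dG (dz_inv e).
apply/matrixP => a b; rewrite !mxE !big_ord1 !mxE.
by ring: e.
Qed.

Lemma mul_transfer m p K (F : nat -> 'rV[A]_m) (G : nat -> 'rV[A]_p) i j :
  orthogonal_seq K F i -> (j <= K)%N -> F j *m transfer K F G i = G j.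
Proof.
move=> [rF n0 o0 o oc] jK; rewrite /transfer mulmxDr mul_outer mulmx_sumr.
under eq_bigr => k _ do
  rewrite -scalemxAr mulmxDr !mul_outer scalerDr !scalerA.
case: j jK => [|j] jK.
  rewrite n0 scale1r big_nat big1 ?addr0 // => k hk.
  have e := o0 k hk; have e' : bil (F 0%N) (vc (F k)) = 0.
    by rewrite -[F 0%N]rF -cj_bil bilC e rmorph0.
  by rewrite bilC in e; rewrite e e' mulr0 !scale0r addr0.
rewrite o0 // scale0r add0r (big_cat_nat (n := j.+1)) //=; last by rewrite leqW.
rewrite big_nat big1 => [|k /andP[k0 kj]]; last first.
  rewrite oc ?o ?k0 ?(leq_trans (ltnW kj)) //=.
  by rewrite (gtn_eqF kj) mulr0 !scale0r addr0.
rewrite add0r big_ltn // oc ?o ?eqxx //= scale1r mulr0 scale0r addr0.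
rewrite big_nat big1 ?addr0 // => k /andP[kj kK].
rewrite oc ?o //=; last 2 first.
- by rewrite (leq_trans _ kj).
- by rewrite (leq_trans _ kj).
by rewrite (ltn_eqF kj) mulr0 !scale0r addr0.
Qed.

(** The round trip is a projector, which becomes the identity once the frame of G is known to span;
    this is where orthogonality of the final matrix comes from. *)
Lemma transfer_comp m p K (F : nat -> 'rV[A]_m) (G : nat -> 'rV[A]_p) i :
  orthogonal_seq K F i -> vc (G 0%N) = G 0%N ->
  (forall j, (0 < j <= K)%N -> c (i j) = i j) ->
  transfer K G F i *m transfer K F G i = transfer K G G i.
Proof.
move=> oF rG ri; have rF : vc (F 0%N) = F 0%N by case: oF.
have e j : (j <= K)%N -> F j *m transfer K F G i = G j.
  exact: mul_transfer.
have ec j : (j <= K)%N -> vc (F j) *m transfer K F G i = vc (G j).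
  by move=> jK; rewrite -(cj_transfer rF rG ri) -vcM e.
rewrite [in X in X *m _]/transfer mulmxDl -mulmxA e // mulmx_suml.
congr (_ + _); apply: eq_big_nat => j /andP[_ jK].
by rewrite -scalemxAl mulmxDl -!mulmxA e // ec.
Qed.

End Derivations.

(** * The cross product of imaginary Cayley numbers *)

Section Cross.
Variable A : comPzRingType.
Implicit Types u v w : 'rV[A]_7.

(** The formula of [cayley_cross] over any commutative ring, so that it extends bilinearly to
    complex-valued functions. *)
Definition cross u v : 'rV[A]_7 :=
  \row_(k < 7)
    ((u 0 (k + 1) * v 0 (k + 3) - u 0 (k + 3) * v 0 (k + 1)) +
     (u 0 (k + 2) * v 0 (k + 6) - u 0 (k + 6) * v 0 (k + 2)) +
     (u 0 (k + 4) * v 0 (k + 5) - u 0 (k + 5) * v 0 (k + 4))).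

Lemma crossDl u v w : cross (u + v) w = cross u w + cross v w.
Proof. by apply/rowP => k; rewrite !mxE; ring. Qed.

Lemma crossC u v : cross u v = - cross v u.
Proof. by apply/rowP => k; rewrite !mxE; ring. Qed.

Lemma cross_self u : cross u u = 0.
Proof. by apply/rowP => k; rewrite !mxE; ring. Qed.

Lemma crossDr u v w : cross w (u + v) = cross w u + cross w v.
Proof. by apply/rowP => k; rewrite !mxE; ring. Qed.

Lemma crossZr a u w : cross w (a *: u) = a *: cross w u.
Proof. by apply/rowP => k; rewrite !mxE; ring. Qed.

(** With coordinates indexed by natural numbers, [ord7] can evaluate the sums of indices modulo 7 to
    numerals, after which [ring] recognizes equal coordinates. *)
Lemma coord7 u : exists a : nat -> A, forall k, u 0 k = a (nat_of_ord k).
Proof. by exists (fun n => u 0 (inord n)) => k; rewrite inord_val. Qed.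

Local Ltac ord7 a := repeat match goal with
  |- context [a (nat_of_ord ?k)] =>
    let n := eval vm_compute in (nat_of_ord k) in change (nat_of_ord k) with n
  end.

Lemma triple u v w : bil (cross u v) w = bil u (cross v w).
Proof.
have [a ua] := coord7 u; have [b vb] := coord7 v; have [e we] := coord7 w.
rewrite !bilE !big_ord_recl !big_ord0 !mxE !ua !vb !we.
by ord7 a; ord7 b; ord7 e; ring.
Qed.

Lemma cross_cross u v : cross u (cross u v) = bil u v *: u - bil u u *: v.
Proof.
have [a ua] := coord7 u; have [b vb] := coord7 v.
apply/rowP => k; rewrite !mxE !ua !vb.
case: k => -[|[|[|[|[|[|[|k]]]]]]] // hk; ord7 a; ord7 b;
  rewrite ?bilE !big_ord_recl !big_ord0 ?mxE ?ua ?vb; ord7 a; ord7 b; ring.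
Qed.

End Cross.

Lemma map_cross (A B : comPzRingType) (phi : {rmorphism A -> B}) (u v : 'rV[A]_7) :
  map_mx phi (cross u v) = cross (map_mx phi u) (map_mx phi v).
Proof. by apply/rowP => k; rewrite !mxE !(rmorphD, rmorphN, rmorphM). Qed.

Section CrossDerivations.
Variables (A : comPzRingType) (W : wirtinger A).
Local Notation d := (dz W).
Local Notation c := (cj W).
Local Notation db := (dzb W).
Implicit Types u v w G : 'rV[A]_7.

Lemma vc_cross u v : vc W (cross u v) = cross (vc W u) (vc W v).
Proof. exact: map_cross. Qed.

Lemma vd_cross u v : vd W (cross u v) = cross (vd W u) v + cross u (vd W v).
Proof. by apply/rowP => k; rewrite !mxE !(dzD, dzN, dzM); ring. Qed.

Lemma vdb_cross u v : vdb W (cross u v) = cross (vdb W u) v + cross u (vdb W v).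
Proof. by rewrite !vdbE vc_cross vd_cross vcD !vc_cross !vcK. Qed.

(** The linearization of [cross_cross] in its repeated factor. As Cayley multiplication is
    alternative but not associative, only this symmetrized double product has a closed formula. *)
Lemma cross_polar u v w :
  cross u (cross w v) + cross w (cross u v)
  = bil u v *: w + bil w v *: u - (bil u w + bil u w) *: v.
Proof.
have := cross_cross (u + w) v.
rewrite !(crossDl, crossDr) !cross_cross !bilE2 [bil w u]bilC => e.
have -> : cross u (cross w v) + cross w (cross u v)
  = bil u v *: u - bil u u *: v + cross u (cross w v)
    + (cross w (cross u v) + (bil w v *: w - bil w w *: v))
    - (bil u v *: u - bil u u *: v) - (bil w v *: w - bil w w *: v).
  by apply/rowP => k; rewrite !mxE; ring.
by rewrite e; apply/rowP => k; rewrite !mxE; ring.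
Qed.

Variables (I : A).
Hypotheses (I2 : I * I = -1) (cI : c I = - I) (dI : d I = 0).

(** Crossing with the unit vector w preserves the product of u and v, since u is orthogonal to w; on
    eigenvectors for the same s it also multiplies the product by s * s = -1. With s = I or - I
    these are vectors of type (1,0) or (0,1). *)
Lemma bil_type u v w s : s * s = -1 -> bil w w = 1 -> bil u w = 0 ->
  cross w u = s *: u -> cross w v = s *: v -> bil u v = 0.
Proof.
move=> s2 ww uw wu wv; apply: (double_eq0 W).
have e1 : bil (cross w u) (cross w v) = - bil u v.
  by rewrite wu wv !bilE2 mulrA s2 mulN1r.
have e2 : bil (cross w u) (cross w v) = bil u v.
  rewrite [cross w u]crossC bilNl triple cross_cross !bilE2 uw ww; ring.
by rewrite -{1}e2 e1 addNr.
Qed.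

Lemma double_eq0v u : u + u = 0 -> u = 0.
Proof.
move=> e; apply/rowP => k; rewrite [RHS]mxE; apply: (double_eq0 W).
by have := congr1 (fun v : 'rV_7 => v 0 k) e; rewrite !mxE.
Qed.

Lemma cross0r w : cross w 0 = 0.
Proof. by apply/rowP => k; rewrite !mxE; ring. Qed.

Lemma crossNr u w : cross w (- u) = - cross w u.
Proof. by rewrite -scaleN1r crossZr scaleN1r. Qed.

Lemma halfM : half W * 2 = 1.
Proof. by rewrite mulr_natr mulr2n halfE. Qed.

(** The computation for u = F3 and v = F1 x F2 by which removing the (0,1) part of F3 leaves a
    vector of type (1,0), in [curve_third]. *)
Lemma type_aux u v :
  I *: u - v + - - (half W * I) *: (- I *: v) = I *: (u + - - (half W * I) *: v).
Proof.
have hE : half W = 1 - half W by rewrite -(halfE W) addrK.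
apply/rowP => k; rewrite !mxE.
have -> : I * (u 0 k + - - (half W * I) * v 0 k)
   = I * u 0 k + half W * (I * I) * v 0 k by ring.
have -> : I * u 0 k - v 0 k + - - (half W * I) * (- I * v 0 k)
   = I * u 0 k - v 0 k - half W * (I * I) * v 0 k by ring.
by rewrite I2 {2}hE; ring.
Qed.

Section Curve.
Variable G : 'rV[A]_7.
Hypotheses (cG : vc W G = G) (GG : bil G G = 1).
Let F1 := vd W G.
Hypothesis GF1 : cross G F1 = I *: F1.

Lemma curve_normal : bil F1 G = 0.
Proof.
apply: (double_eq0 W); have := dz_bil W G G.
by rewrite GG dz1 [bil G (vd W G)]bilC => <-.
Qed.

Lemma curve_null : bil F1 F1 = 0.
Proof. exact: (bil_type I2 GG curve_normal). Qed.

(** This is minimality of the curve. The d/dz-bar derivative of G x F1 = I F1 and its conjugate are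
    two equations for the real vector G_(z zbar); they force it to be - I times conj F1 x F1, which
    [cross_polar] evaluates as a multiple of G. *)
Lemma curve_harmonic : harmonic_pair W G F1 1 1 (bil F1 (vc W F1)).
Proof.
set h1 := bil F1 (vc W F1).
have dbG : vdb W G = vc W F1 by rewrite /F1 vc_vd cG.
have GcF1 : cross G (vc W F1) = - I *: vc W F1.
  by rewrite -[in LHS]cG -vc_cross GF1 vcZ cI.
pose Y := cross (vc W F1) F1.
have cY : vc W Y = - Y by rewrite /Y vc_cross vcK crossC.
pose L := vdb W F1.
have cL : vc W L = L by rewrite /L vc_vdb vdb_vd dbG.
have eL : Y + cross G L = I *: L.
  have := congr1 (@vdb _ W 1 7) GF1; rewrite vdb_cross vdbZ dbG.
  have -> : db I = 0 by rewrite /dzb cI dzN dI oppr0 rmorph0.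
  by rewrite scale0r add0r.
have eL' : - Y + cross G L = - I *: L.
  by have := congr1 (@vc _ W 1 7) eL; rewrite vcD cY vc_cross cG cL vcZ cL cI.
have LE : L = - I *: Y.
  have : (I *: L - Y) + (I *: L - Y) = 0.
    have -> : I *: L - Y + (I *: L - Y)
       = (Y + cross G L - (- Y + cross G L)) - Y - Y.
      by rewrite eL eL'; apply/rowP => k; rewrite !mxE; ring.
    by apply/rowP => k; rewrite !mxE; ring.
  move=> /double_eq0v /eqP; rewrite subr_eq0 => /eqP <-.
  by rewrite scalerA mulNr I2 opprK scale1r.
have GY : cross G Y = 0.
  have -> : cross G Y = I *: (cross G L).
    by rewrite LE crossZr scalerA mulrN I2 opprK scale1r.
  have -> : cross G L = I *: L - Y by rewrite -eL addrC addKr.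
  by rewrite LE scalerA mulrN I2 opprK scale1r subrr scaler0.
have YE : Y = - (I * h1) *: G.
  have := cross_polar (vc W F1) F1 G; rewrite GF1 crossZr -/Y GY addr0.
  rewrite [bil G F1]bilC curve_normal [bil (vc W F1) G]bilC -[in bil G (vc W F1)]cG -cj_bil.
  rewrite [bil G F1]bilC curve_normal rmorph0 [bil (vc W F1) F1]bilC -/h1.
  move=> e; have -> : Y = - I *: (I *: Y) by rewrite scalerA mulNr I2 opprK scale1r.
  by rewrite e; apply/rowP => k; rewrite !mxE; ring.
split; rewrite ?mulr1 ?dz1 ?scale0r ?addr0 ?cG //.
split; last exact: curve_normal.
by rewrite -/L LE YE scalerA; congr (_ *: _); ring: I2.
Qed.

(** Differentiating the type equation of F1 produces the extra term F1 x F1 = 0, so F2 is again of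
    type (1,0). One order later the extra term is F1 x F2, which is why F3 is treated separately. *)
Lemma curve_second F2 h1 i1 h2 : harmonic_pair W F1 F2 h1 i1 h2 ->
  [/\ cross G F2 = I *: F2, bil F2 G = 0, bil F2 F1 = 0 & bil F2 F2 = 0].
Proof.
move=> [_ _ _ d1 _]; have q10 := curve_normal; have q11 := curve_null.
have GF2 : cross G F2 = I *: F2.
  have := congr1 (@vd _ W 1 7) GF1; rewrite vd_cross -/F1 cross_self add0r vdZ dI.
  rewrite scale0r add0r d1 crossDr crossZr GF1 scalerDr !scalerA => e.
  by apply: (addIr ((d h1 * i1 * I) *: F1)); rewrite e [I * _]mulrC.
have q20 : bil F2 G = 0.
  have := dz_bil W F1 G; rewrite q10 dz0 d1 -/F1 !bilE2 q11 q10.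
  by rewrite mulr0 !addr0 => <-.
have q21 : bil F2 F1 = 0 by apply: (bil_type I2 GG q20).
have q22 : bil F2 F2 = 0 by apply: (bil_type I2 GG q20).
by split.
Qed.

(* X = F1 x F2 is of type (0,1) and orthogonal to F1, F2 and G; F3 - X/2i is of
   type (1,0), and <F3,F3> = 0 makes it orthogonal to a basis. *)
Lemma curve_third F2 F3 h1 i1 h2 i2 h3 :
  harmonic_pair W G F1 1 1 h1 -> harmonic_pair W F1 F2 h1 i1 h2 ->
  harmonic_pair W F2 F3 h2 i2 h3 -> h2 * i2 = 1 ->
  bil F3 F3 = 0 -> h3 = half W * h1 * h2.
Proof.
move=> p0 p1 p2 e2 q33.
have c1 := dzb_pair p0; have c2 := dzb_pair p1.
have [_ _ n1 d0 [b1 _]] := p0; have [e1 _ n2 d1 [b2 o21]] := p1.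
have [_ _ n3 d2 [b3 o32]] := p2.
have q10 := curve_normal; have q11 := curve_null.
have cj_type u : cross G u = I *: u -> cross G (vc W u) = - I *: vc W u.
  by move=> e; rewrite -[in LHS]cG -vc_cross e vcZ cI.
have [GF2 q20 q21 q22] := curve_second p1.
have q30 : bil F3 G = 0.
  have := dz_bil W F2 G.
  by rewrite q20 dz0 d2 -/F1 !bilE2 q20 q21 mulr0 !addr0 => <-.
have o31 : bil F3 (vc W F1) = 0.
  have := dz_bil W F2 (vc W F1); rewrite o21 dz0 d2 c1 !bilE2 o21.
  by rewrite cG q20 !mulr0 !addr0 => <-.
pose X := cross F1 F2.
have XE : X = I *: F3 - cross G F3.
  have := congr1 (@vd _ W 1 7) GF2; rewrite vd_cross -/F1 vdZ dI.
  rewrite scale0r add0r d2 crossDr crossZr GF2 scalerDr !scalerA -/X => e.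
  apply: (addIr (cross G F3 + (d h2 * i2 * I) *: F2)).
  by rewrite e [I * _]mulrC; apply/rowP => k; rewrite !mxE; ring.
have GX : cross G X = - I *: X.
  have := cross_polar G F2 F1; rewrite -/X GF2 crossZr -/X.
  rewrite [bil G F2]bilC q20 [bil F1 F2]bilC q21 [bil G F1]bilC q10.
  rewrite !(addr0, scale0r, oppr0) => e.
  by apply: (addIr (I *: X)); rewrite e scaleNr addNr.
have mI2 : - I * - I = -1 by rewrite mulrNN.
have X0 : bil X G = 0.
  by rewrite /X triple [cross F2 G]crossC GF2 !bilE2 [bil F1 F2]bilC q21; ring.
have cB u : bil u G = 0 -> bil (vc W u) G = 0.
  by move=> e; rewrite -cG -cj_bil e rmorph0.
pose A3 : 'rV[A]_7 := (- (half W * I)) *: X.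
pose B : 'rV[A]_7 := F3 - A3.
have GB : cross G B = I *: B.
  rewrite /B /A3 -scaleNr crossDr crossZr GX.
  have -> : cross G F3 = I *: F3 - X by rewrite XE opprB addrC subrK.
  exact: type_aux.
have B0 : bil B G = 0 by rewrite /B /A3 !bilE2 q30 X0; ring.
have cX : cross G (vc W X) = I *: vc W X.
  by rewrite -[in LHS]cG -vc_cross GX vcZ rmorphN cI opprK.
have XX : bil X X = 0 by apply: (bil_type mI2 GG X0).
have BB : bil B B = 0 by apply: (bil_type I2 GG B0).
(* A3 and B are null because of their types, so <F3,F3> is twice <A3,B>. *)
have AB : bil A3 B = 0.
  apply: (double_eq0 W).
  have AA : bil A3 A3 = 0 by rewrite /A3 bilZl bilZr XX !mulr0.
  have : bil (A3 + B) (A3 + B) = 0 by rewrite /B addrC subrK.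
  by rewrite (bilDl A3 B) 2!(bilDr A3 B) AA BB [bil B A3]bilC addr0 add0r.
have XB : bil X B = 0.
  have -> : X = (2 * I) *: A3.
    rewrite /A3 scalerA -[LHS]scale1r; congr (_ *: _).
    by ring: I2 halfM.
  by rewrite bilZl AB mulr0.
have XcF1 : bil X (vc W F1) = 0.
  by apply: (bil_type mI2 GG X0) => //; apply: cj_type.
have XcF2 : bil X (vc W F2) = 0.
  by apply: (bil_type mI2 GG X0) => //; apply: cj_type.
have BcF1 : bil B (vc W F1) = 0 by rewrite /B /A3 !bilE2 o31 XcF1; ring.
have BcF2 : bil B (vc W F2) = 0 by rewrite /B /A3 !bilE2 o32 XcF2; ring.
(* By [cross_polar], conj F1 x F2 is of type (0,1) when computed from F2 and of type (1,0) when
   computed from conj F1. *)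
have Y0 : cross (vc W F1) F2 = 0.
  set Y := cross _ _.
  have eY : cross G Y = - I *: Y.
    have := cross_polar G F2 (vc W F1); rewrite GF2 crossZr -/Y.
    rewrite [bil G F2]bilC q20 [bil _ F2]bilC o21 [bil G _]bilC cB //.
    rewrite !(addr0, scale0r, oppr0) => e.
    by apply: (addIr (I *: Y)); rewrite e scaleNr addNr.
  have eY' : cross G Y = I *: Y.
    have := cross_polar G (vc W F1) F2; rewrite cj_type // crossZr.
    rewrite [cross F2 _]crossC -/Y.
    rewrite [bil F2 _]o21 [bil G (vc W F1)]bilC cB // [bil G F2]bilC q20.
    rewrite !(addr0, scale0r, oppr0) crossNr scaleNr scalerN opprK => e.
    by apply/eqP; rewrite -subr_eq0 -oppr_eq0 opprB addrC e.
  apply: double_eq0v; have : I *: Y + I *: Y = 0.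
    by rewrite -{1}eY' eY scaleNr addNr.
  move=> /(congr1 (fun v => - I *: v)); rewrite scaler0 scalerDr scalerA.
  by rewrite mulNr I2 opprK !scale1r.
have cF1X : cross (vc W F1) X = - (h1 + h1) *: F2.
  have := cross_polar (vc W F1) F2 F1; rewrite -/X Y0 cross0r.
  rewrite [bil _ F2]bilC o21 [bil F1 F2]bilC q21 [bil _ F1]bilC n1.
  by rewrite !(addr0, add0r, scale0r) scaleNr.
(* The origin of the factor 1/2: once F3 = X / 2i is known, its squared norm is a quarter of this
   one. *)
have nX : bil X (vc W X) = (h1 + h1) * h2.
  rewrite {2}/X vc_cross -triple [cross X _]crossC cF1X !bilE2 n2; ring.
have rB : B = 0.
  pose L := [:: G; F1; vc W F1; F2; vc W F2; X; vc W X].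
  (* Inverse squared norms of the vectors in [L], the last two from [nX]. As the vectors are
     orthogonal for the Hermitian product, their scaled conjugates give the inverse matrix. *)
  pose ii := [:: 1; i1; i1; i2; i2; half W * i1 * i2; half W * i1 * i2].
  pose N : 'M[A]_7 := \matrix_(j < 7) nth 0 L j.
  pose N' : 'M[A]_7 := (\matrix_(j < 7) (nth 0 ii j *: vc W (nth 0 L j)))^T.
  have NN : N *m N' = 1%:M.
    have sym u v : bil u (vc W v) = 0 -> bil v (vc W u) = 0.
      by move=> e; rewrite -[v](vcK W) -cj_bil bilC e rmorph0.
    have scj u v : bil u v = 0 -> bil (vc W u) (vc W v) = 0.
      by move=> e; rewrite -cj_bil e rmorph0.
    apply/matrixP => j k.
    have -> : (N *m N') j k = nth 0 ii k * bil (nth 0 L j) (vc W (nth 0 L k)).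
      rewrite -bilZr bilE mxE; apply: eq_bigr => a _.
      by rewrite !mxE.
    have hh := halfM.
    have q12 : bil F1 F2 = 0 by rewrite bilC.
    have F1X : bil F1 X = 0 by rewrite /X -triple cross_self bil0l.
    have F2X : bil F2 X = 0.
      by rewrite /X crossC bilNr -triple cross_self bil0l oppr0.
    have both (u v : 'rV[A]_7) r : bil u v = r -> (bil u v = r) * (bil v u = r).
      by move=> uv; split=> //; rewrite bilC.
    have tab := (GG, both _ _ _ q10, both _ _ _ (cB _ q10), both _ _ _ q20,
      both _ _ _ (cB _ q20), both _ _ _ X0, both _ _ _ (cB _ X0), q11,
      scj _ _ q11, q22, scj _ _ q22, XX, scj _ _ XX, both _ _ _ n1,
      both _ _ _ n2, both _ _ _ nX, both _ _ _ q12, both _ _ _ (scj _ _ q12),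
      both _ _ _ o21, both _ _ _ (sym _ _ o21), both _ _ _ F1X,
      both _ _ _ (scj _ _ F1X), both _ _ _ XcF1, both _ _ _ (sym _ _ XcF1),
      both _ _ _ F2X, both _ _ _ (scj _ _ F2X), both _ _ _ XcF2,
      both _ _ _ (sym _ _ XcF2)).
    rewrite [RHS]mxE -val_eqE; case: j => -[|[|[|[|[|[|[|j]]]]]]] // hj;
    case: k => -[|[|[|[|[|[|[|k]]]]]]] // hk; rewrite /= ?vcK ?cG ?tab;
    rewrite ?mulr0 ?mulr1 // ?mulr1n; ring: e1 e2 hh.
  have NN' := mulmx1C NN.
  have : N *m B^T = 0.
    apply/matrixP => j k; rewrite ord1 [RHS]mxE.
    have -> : (N *m B^T) j 0 = bil B (nth 0 L j).
      by rewrite bilC bilE mxE; apply: eq_bigr => a _; rewrite !mxE.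
    case: j => -[|[|[|[|[|[|[|j]]]]]]] // hj; rewrite //=.
    - exact: (bil_type I2 GG B0 GB GF1).
    - exact: (bil_type I2 GG B0 GB GF2).
    - by rewrite bilC.
    - exact: (bil_type I2 GG B0 GB cX).
  move=> /(congr1 (fun M => N' *m M)); rewrite mulmxA NN' mul1mx mulmx0.
  by move=> /(congr1 trmx); rewrite trmxK trmx0.
have F3E : F3 = A3 by apply/eqP; rewrite -subr_eq0 -/B rB.
rewrite -n3 F3E /A3 vcZ !bilE2 nX rmorphN rmorphM cI.
have ch : c (half W) = half W.
  by rewrite -[LHS]mul1r -(halfE W) mulrDl -mulrDr -rmorphD halfE rmorph1 mulr1.
rewrite ch.
have hh := halfM.
by ring: I2 hh.
Qed.

End Curve.
End CrossDerivations.

(** * Smooth functions on plane domains *)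

Lemma near_eq_differentiable (R : realType) (U W : normedModType R) (f g : U -> W) x :
  (\near x, f x = g x) -> differentiable f x -> differentiable g x.
Proof.
move=> fg df; have [dfc fE] := (diff_locallyP x f).1 df.
have gE : g \o shift x = cst (g x) + 'd f x +o_ 0 id.
  apply: (proj2 (eqaddoP _ _ _ _)) => eps eps0.
  have := proj1 (eqaddoP _ _ _ _) fE eps eps0.
  rewrite -(nbhs_singleton fg).
  move: fg; rewrite (near_shift 0 x) subr0 => fg.
  apply: filterS2 fg => h /= e; rewrite /shift /= in e *.
  rewrite -[X in _ -> `|X| <= _]/(g (h + x) - (f x + 'd f x h)).
  by rewrite -e.
by apply/diff_locallyP; rewrite (diff_unique dfc gE).
Qed.

Section RealSmooth.
Variable R : realType.
Local Notation E := 'rV[R]_2.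
Implicit Types (u v : E -> R) (V : set E) (x : E) (k : nat).

(** One step beyond the usual C^k: derivatives of order k are themselves required to be
    differentiable, and [Ck 0] is differentiability. The two coordinate directions suffice because
    the differential is linear. *)
Fixpoint Ck k V u : Prop :=
  (forall x, V x -> differentiable u x) /\
  (if k is j.+1 then Ck j V ('D_(vx R) u) /\ Ck j V ('D_(vy R) u) else True).

Lemma CkW k V u : Ck k.+1 V u -> Ck k V u.
Proof.
elim: k u => [|k IH] u [du [ux uy]]; first exact (conj du I).
exact (conj du (conj (IH _ ux) (IH _ uy))).
Qed.

Lemma Ck_diff k V u x : Ck k V u -> V x -> differentiable u x.
Proof. by case: k => [|k] [du _]; exact: du. Qed.

Lemma Ck_derivable k V u x w : Ck k V u -> V x -> derivable u x w.
Proof. by move=> uk Vx; apply: diff_derivable; apply: (Ck_diff uk Vx). Qed.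

Section Open.
Variable V : set E.
Hypothesis oV : open V.

Lemma open_near x (P : E -> Prop) : V x -> (forall y, V y -> P y) -> \near x, P x.
Proof. by move=> Vx h; have := open_nbhs_nbhs (conj oV Vx); apply: filterS. Qed.

Lemma derive_eq_on (W : normedModType R) (u v : E -> W) w x :
  (forall y, V y -> u y = v y) -> V x -> 'D_w u x = 'D_w v x.
Proof. by move=> uv Vx; apply: near_eq_derive; apply: open_near. Qed.

Lemma Ck_eq k u v : (forall x, V x -> u x = v x) -> Ck k V u -> Ck k V v.
Proof.
elim: k u v => [|k IH] u v uv [du hu].
  split; last exact: I.
  by move=> x Vx; apply: near_eq_differentiable (du x Vx); exact: open_near.
split; first by move=> x Vx; apply: near_eq_differentiable (du x Vx); exact: open_near.
case: hu => ux uy; split.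
  by apply: IH ux => x Vx; exact: derive_eq_on.
by apply: IH uy => x Vx; exact: derive_eq_on.
Qed.

Lemma Ck_cst k a : Ck k V (fun=> a).
Proof.
have d x : V x -> differentiable (fun=> a : R) x by move=> _; exact: differentiable_cst.
elim: k a d => [|k IH] a d; first exact (conj d I).
have h : Ck k V (fun=> 0) by apply: IH => x _; exact: differentiable_cst.
split; first exact: d.
by split; apply: Ck_eq h => x _; rewrite derive_cst.
Qed.

Lemma CkD k u v : Ck k V u -> Ck k V v -> Ck k V (fun x => u x + v x).
Proof.
have dD k' u' v' x : Ck k' V u' -> Ck k' V v' -> V x ->
    differentiable (fun x => u' x + v' x) x.
  by move=> hu hv Vx; apply: differentiableD; [exact: (Ck_diff hu)|exact: (Ck_diff hv)].
elim: k u v => [|k IH] u v hu hv.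
  by split; [move=> x; exact: (dD 0%N)|exact: I].
split; first by move=> x; exact: (dD k.+1).
have [_ [ux uy]] := hu; have [_ [wx wy]] := hv.
by split; [apply: Ck_eq (IH _ _ ux wx)|apply: Ck_eq (IH _ _ uy wy)] => x Vx;
  rewrite (deriveD (Ck_derivable hu Vx) (Ck_derivable hv Vx)).
Qed.

Lemma CkM k u v : Ck k V u -> Ck k V v -> Ck k V (fun x => u x * v x).
Proof.
have dM k' u' v' x : Ck k' V u' -> Ck k' V v' -> V x ->
    differentiable (fun x => u' x * v' x) x.
  by move=> hu hv Vx; apply: differentiableM; [exact: (Ck_diff hu)|exact: (Ck_diff hv)].
elim: k u v => [|k IH] u v hu hv.
  by split; [move=> x; exact: (dM 0%N)|exact: I].
split; first by move=> x; exact: (dM k.+1).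
have [_ [ux uy]] := hu; have [_ [wx wy]] := hv.
have uk := CkW hu; have vk := CkW hv.
by split; [apply: Ck_eq (CkD (IH _ _ uk wx) (IH _ _ vk ux))
       |apply: Ck_eq (CkD (IH _ _ uk wy) (IH _ _ vk uy))] => x Vx;
  rewrite (deriveM (Ck_derivable hu Vx) (Ck_derivable hv Vx)).
Qed.

Lemma CkN k u : Ck k V u -> Ck k V (fun x => - u x).
Proof.
by move=> hu; apply: Ck_eq (CkM (Ck_cst k (-1)) hu) => x _; rewrite mulN1r.
Qed.

Lemma CkV k u : (forall x, V x -> u x != 0) -> Ck k V u -> Ck k V (fun x => (u x)^-1).
Proof.
move=> u0 hu; have d x : V x -> differentiable (fun x => (u x)^-1) x.
  by move=> Vx; apply: differentiableV (Ck_diff hu Vx) (u0 x Vx).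
elim: k hu => [|k IH] hu; first exact (conj d I).
split; first exact: d.
have [_ [ux uy]] := hu; have uk := IH (CkW hu).
by split; [apply: Ck_eq (CkN (CkM (CkM uk uk) ux))
       |apply: Ck_eq (CkN (CkM (CkM uk uk) uy))] => x Vx;
  rewrite (deriveV (u0 x Vx) (Ck_derivable hu Vx)) scaleNr;
  rewrite /GRing.scale /= -exprVn expr2.
Qed.

Lemma derive_expR_comp u x w : differentiable u x ->
  'D_w (fun y => expR (u y)) x = expR (u x) * 'D_w u x.
Proof.
move=> du; have de : differentiable expR (u x).
  by apply/derivable1_diffP/derivable_expR.
have -> : (fun y => expR (u y)) = expR \o u by [].
rewrite deriveE; last exact: differentiable_comp.
rewrite diff_comp //= diff1E // -deriveE // derive1E.
have h := congr1 (fun f => f (u x)) (@derive_expR R).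
exact: etrans (congr1 ( *%R ('D_w u x)) h) (mulrC _ _).
Qed.

Lemma Ck_expR k u : Ck k V u -> Ck k V (fun x => expR (u x)).
Proof.
move=> hu; have d x : V x -> differentiable (fun x => expR (u x)) x.
  move=> Vx; apply: (@differentiable_comp _ _ _ _ u expR) (Ck_diff hu Vx) _.
  by apply/derivable1_diffP/derivable_expR.
elim: k hu => [|k IH] hu; first exact (conj d I).
split; first exact: d.
have [_ [ux uy]] := hu; have uk := IH (CkW hu).
by split; [apply: Ck_eq (CkM uk ux)|apply: Ck_eq (CkM uk uy)] => x Vx;
  rewrite derive_expR_comp //; exact: (Ck_diff hu).
Qed.

End Open.
End RealSmooth.

(** * Mean values, symmetry of second derivatives and maxima on the plane *)

Section PlaneCalculus.
Variable R : realType.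
Local Notation E := 'rV[R]_2.
Implicit Types (u : E -> R) (V : set E) (x y w : E) (k : nat).

Lemma planeE w : w = w 0 0 *: vx R + w 0 1 *: vy R.
Proof.
apply/rowP => k; rewrite !mxE /=; case: k => -[|[|k]] // hk; rewrite /= ?mulr1 ?mulr0 ?addr0 ?add0r;
by congr (w 0 _); apply: val_inj.
Qed.

Lemma derive_plane (W : normedModType R) (u : E -> W) x w : differentiable u x ->
  'D_w u x = w 0 0 *: 'D_(vx R) u x + w 0 1 *: 'D_(vy R) u x.
Proof. by move=> du; rewrite !deriveE // {1}[w]planeE linearD !linearZ. Qed.

Lemma line_growth (W : normedModType R) (u : E -> W) y w (t : R) :
  (fun h => h^-1 *: (((fun s : R => u (y + s *: w)) \o shift t) (h *: 1) - u (y + t *: w)))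
  = (fun h => h^-1 *: ((u \o shift (y + t *: w)) (h *: w) - u (y + t *: w))).
Proof.
apply/funext => h /=; congr (_ *: (u _ - _)).
by rewrite scalerDl /GRing.scale /= mulr1 [RHS]addrC -addrA [X in _ = _ + X]addrC.
Qed.

Lemma line_is_derive u y w (t : R) : differentiable u (y + t *: w) ->
  is_derive t 1 (fun s : R => u (y + s *: w)) ('D_w u (y + t *: w)).
Proof.
move=> du; have dw : derivable u (y + t *: w) w by apply: diff_derivable.
by split; rewrite /derivable /derive line_growth.
Qed.

Lemma line_continuous u y w (a b : R) :
  (forall t, a <= t <= b -> differentiable u (y + t *: w)) ->
  {within `[a, b], continuous (fun s : R => u (y + s *: w))}.
Proof.
move=> du; apply: derivable_within_continuous => t; rewrite in_itv /= => tab.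
by have := line_is_derive (du t tab) => -[].
Qed.

Lemma line_MVT u y w (h : R) : 0 < h ->
  (forall t, 0 <= t <= h -> differentiable u (y + t *: w)) ->
  exists2 t, 0 < t < h & u (y + h *: w) - u y = 'D_w u (y + t *: w) * h.
Proof.
move=> h0 du.
have [|t tab e] := @MVT R (fun s : R => u (y + s *: w))
  (fun t => 'D_w u (y + t *: w)) 0 h h0 _ (line_continuous du).
  move=> t; rewrite in_itv /= => /andP[t0 th]; apply: line_is_derive.
  by apply: du; rewrite !ltW.
by exists t => //; rewrite scale0r addr0 subr0 in e.
Qed.

Lemma near_norm_ball x (P : set E) : (\near x, P x) ->
  exists2 r : R, 0 < r & forall y, `|y - x| < r -> P y.
Proof.
move=> /nbhs_ballP[r r0 hP]; exists r => // y xy; apply: hP.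
by rewrite -ball_normE /ball_ /= distrC.
Qed.


Lemma derive_shift_arg u (z y w : E) :
  'D_w (fun x => u (x + z)) y = 'D_w u (y + z).
Proof.
have e : (fun h : R => h^-1 *: (((fun x => u (x + z)) \o shift y) (h *: w) - u (y + z)))
  = (fun h => h^-1 *: ((u \o shift (y + z)) (h *: w) - u (y + z))).
  by apply/funext => h /=; rewrite addrA.
by rewrite /derive e.
Qed.

Lemma differentiable_shift_arg u (z y : E) :
  differentiable u (y + z) -> differentiable (fun x => u (x + z)) y.
Proof.
by move=> du; apply: (@differentiable_comp _ _ _ _ (fun x => x + z) u).
Qed.

(** The mean value theorem twice: along a for the increment of u in the direction b, then along b
    for the derivative of u in the direction a. *)
Lemma mixed_MVT u x (a b : E) (h : R) : 0 < h ->
  (forall s t, 0 <= s <= h -> 0 <= t <= h ->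
     differentiable u (x + s *: a + t *: b) /\
     differentiable ('D_a u) (x + s *: a + t *: b)) ->
  exists s t, [/\ 0 < s < h, 0 < t < h &
    u (x + h *: a + h *: b) - u (x + h *: a) - (u (x + h *: b) - u x)
    = 'D_b ('D_a u) (x + s *: a + t *: b) * h * h].
Proof.
move=> h0 du; have hh : 0 <= h <= h by rewrite lexx ltW.
have h00 : 0 <= (0 : R) <= h by rewrite lexx ltW.
have du0 s : 0 <= s <= h -> differentiable u (x + s *: a).
  by move=> hs; have [] := du s 0 hs h00; rewrite scale0r addr0.
have duh s : 0 <= s <= h -> differentiable u (x + s *: a + h *: b).
  by move=> hs; have [] := du s h hs hh.
pose phi y := u (y + h *: b) - u y.
have dphi s : 0 <= s <= h -> differentiable phi (x + s *: a).
  move=> hs; apply: differentiableB (du0 s hs).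
  exact/differentiable_shift_arg/duh.
have [s sh e1] := line_MVT h0 dphi.
have hs : 0 <= s <= h by case/andP: sh => s0 s1; rewrite !ltW.
have [t th e2] : exists2 t, 0 < t < h & 'D_a u (x + s *: a + h *: b) - 'D_a u (x + s *: a)
   = 'D_b ('D_a u) (x + s *: a + t *: b) * h.
  exact (@line_MVT ('D_a u) (x + s *: a) b h h0 (fun t ht => proj2 (du s t hs ht))).
exists s, t; split; [exact: sh | exact: th |].
suff e3 : u (x + h *: a + h *: b) - u (x + h *: a) - (u (x + h *: b) - u x)
    = ('D_a u (x + s *: a + h *: b) - 'D_a u (x + s *: a)) * h.
  exact (etrans e3 (congr1 (fun z => z * h) e2)).
have dE : 'D_a phi (x + s *: a) = 'D_a u (x + s *: a + h *: b) - 'D_a u (x + s *: a).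
  rewrite deriveB; first by rewrite derive_shift_arg.
    by apply: diff_derivable; exact/differentiable_shift_arg/duh.
  by apply: diff_derivable; exact: du0.
rewrite -[in RHS]dE -[RHS]e1 /phi; ring.
Qed.

Lemma mulI2 (h s t : R) : 0 < h -> s * h * h = t * h * h -> s = t.
Proof. by move=> h0; do 2!move/(mulIf (lt0r_neq0 h0)). Qed.

Lemma ltW2 (s t h : R) : s < t -> t < h -> s <= t <= h.
Proof. by move=> st th; rewrite !ltW. Qed.

Lemma dist_half (p q p' q' e : R) :
  `|p - p'| < e / 2 -> `|q - q'| < e / 2 -> p' = q' -> `|p - q| <= e.
Proof.
move=> h1 h2 e1; rewrite -{}e1 in h2.
have -> : p - q = (p - p') - (q - p') by ring.
by rewrite (le_trans (ler_normB _ _)) // [leRHS]splitr lerD // ltW.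
Qed.

(** The second difference of u over a small parallelogram is symmetric in a and b. By [mixed_MVT]
    both iterated derivatives, at points near c, equal its quotient by h^2. *)
Lemma schwarz u c (a b : E) :
  (\forall x \near c, differentiable u x /\ differentiable ('D_a u) x /\ differentiable ('D_b u) x) ->
  {for c, continuous ('D_b ('D_a u))} -> {for c, continuous ('D_a ('D_b u))} ->
  'D_b ('D_a u) c = 'D_a ('D_b u) c.
Proof.
move=> du ca cb; apply/eqP; rewrite -subr_eq0 -normr_le0; apply/ler_addgt0Pl => e e0.
rewrite addr0; pose e' := e / 2; have e'0 : 0 < e' by rewrite divr_gt0.
have nP : \forall x \near c, (differentiable u x /\ differentiable ('D_a u) x /\ differentiable ('D_b u) x)
   /\ (`|'D_b ('D_a u) c - 'D_b ('D_a u) x| < e' /\ `|'D_a ('D_b u) c - 'D_a ('D_b u) x| < e').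
  move/cvgrPdist_lt: ca => /(_ e' e'0) na; move/cvgrPdist_lt: cb => /(_ e' e'0) nb.
  exact: filterI du (filterI na nb).
have [r r0 hr] := near_norm_ball nP.
pose N := `|a| + `|b| + 1; have N0 : 0 < N by rewrite ltr_wpDl // addr_ge0.
(* With this h every point of the parallelogram is within h N = r / 2 of c. *)
pose h := r / (2 * N); have h0 : 0 < h by rewrite divr_gt0 // mulr_gt0.
have small s t : 0 <= s <= h -> 0 <= t <= h -> `|c + s *: a + t *: b - c| < r.
  move=> /andP[s0 sh] /andP[t0 th].
  rewrite -[c + _ + _]addrA addrAC subrr add0r (le_lt_trans (ler_normD _ _)) //.
  rewrite !normrZ !ger0_norm //.
  have : s * `|a| + t * `|b| <= h * N.
    rewrite /N !mulrDr mulr1.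
    by apply: ler_wpDr; [exact: ltW|apply: lerD; exact: ler_wpM2r].
  move=> /le_lt_trans; apply; rewrite /h invfM mulrA mulfVK ?gt_eqF //.
  by rewrite ltr_pdivrMr // mulr_natr mulr2n ltrDl.
have [s [t [/andP[s0 sh] /andP[t0 th] e1]]] : exists s t, [/\ 0 < s < h, 0 < t < h &
    u (c + h *: a + h *: b) - u (c + h *: a) - (u (c + h *: b) - u c)
    = 'D_b ('D_a u) (c + s *: a + t *: b) * h * h].
  apply: (mixed_MVT h0) => s t hs ht; have [[d1 [d2 _]] _] := hr _ (small s t hs ht).
  exact (conj d1 d2).
have [s' [t' [/andP[s0' sh'] /andP[t0' th'] e2]]] : exists s t, [/\ 0 < s < h, 0 < t < h &
    u (c + h *: b + h *: a) - u (c + h *: b) - (u (c + h *: a) - u c)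
    = 'D_a ('D_b u) (c + s *: b + t *: a) * h * h].
  apply: (mixed_MVT h0) => s1 t1 hs ht; rewrite addrAC.
  have [[d1 [_ d2]] _] := hr _ (small t1 s1 ht hs); exact (conj d1 d2).
have ee : 'D_b ('D_a u) (c + s *: a + t *: b) = 'D_a ('D_b u) (c + t' *: a + s' *: b).
  rewrite [c + t' *: a + _]addrAC.
  have e3 : u (c + h *: a + h *: b) - u (c + h *: a) - (u (c + h *: b) - u c)
     = u (c + h *: b + h *: a) - u (c + h *: b) - (u (c + h *: a) - u c).
    by rewrite [c + h *: b + _]addrAC; ring.
  exact (mulI2 h0 (etrans (esym e1) (etrans e3 e2))).
have [_ [k1 _]] := hr _ (small s t (ltW2 s0 sh) (ltW2 t0 th)).
have [_ [_ k2]] := hr _ (small t' s' (ltW2 t0' th') (ltW2 s0' sh')).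
exact (dist_half k1 k2 ee).
Qed.

Lemma ball_constant u x (r : R) :
  (forall y, `|y - x| < r -> differentiable u y) ->
  (forall y, `|y - x| < r -> 'D_(vx R) u y = 0 /\ 'D_(vy R) u y = 0) ->
  forall y, `|y - x| < r -> u y = u x.
Proof.
move=> du d0 y yx; pose w := y - x.
have inr t : 0 <= t <= 1 -> `|x + t *: w - x| < r.
  move=> /andP[t0 t1]; rewrite addrAC subrr add0r normrZ ger0_norm //.
  by rewrite (le_lt_trans _ yx) // ler_piMl.
have [t th e] := @line_MVT u x w 1 ltr01 (fun t ht => du _ (inr t ht)).
have [ex ey] := d0 _ (inr t (ltW2 (proj1 (andP th)) (proj2 (andP th)))).
have dt := du _ (inr t (ltW2 (proj1 (andP th)) (proj2 (andP th)))).
have z : 'D_w u (x + t *: w) = 0.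
  by rewrite (derive_plane _ dt) ex ey !scaler0 addr0.
have e0 : u (x + 1 *: w) - u x = 0 by rewrite e z mul0r.
have <- : x + 1 *: w = y by rewrite scale1r addrC subrK.
by apply/eqP; rewrite -subr_eq0; apply/eqP.
Qed.

(** If the second derivative were positive, the first one, which vanishes at x, would be positive
    just after x on the line along w, and the mean value theorem would give a value above that at
    x. *)
Lemma local_max_derive u x w :
  (\forall y \near x, differentiable u y) -> differentiable ('D_w u) x ->
  (\forall y \near x, u y <= u x) ->
  'D_w u x = 0 /\ 'D_w ('D_w u) x <= 0.
Proof.
move=> du ddu mx; have [r r0 hr] := near_norm_ball (filterI du mx).
pose N := `|w| + 1; have N0 : 0 < N by rewrite ltr_wpDl.
pose h := r / N; have h0 : 0 < h by rewrite divr_gt0.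
have inr t : - h < t < h -> `|x + t *: w - x| < r.
  move=> th; rewrite addrAC subrr add0r normrZ.
  have : `|t| * `|w| <= `|t| * N by rewrite ler_wpM2l // lerDl.
  move=> /le_lt_trans; apply; rewrite -ltr_pdivlMr // -/h.
  by rewrite ltr_norml.
have dt t : - h < t < h -> differentiable u (x + t *: w) by move=> /inr /hr [].
have mt t : - h < t < h -> u (x + t *: w) <= u x by move=> /inr /hr [].
have x0 : x + 0 *: w = x by rewrite scale0r addr0.
have hh0 : - h < 0 < h by rewrite oppr_lt0 h0.
have d0 : 'D_w u x = 0.
  have d1 := line_is_derive (dt 0 hh0).
  have d2 : is_derive (0 : R) 1 (fun s : R => u (x + s *: w)) 0.
    apply: (@derive1_at_max R _ (- h) h).
    - by rewrite ltW // gtrN.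
    - by move=> t; rewrite in_itv /= => /dt /line_is_derive [].
    - by rewrite in_itv.
    - by move=> t; rewrite in_itv /= x0 => /mt.
  case: d1 => _ d1; case: d2 => _ d2; rewrite x0 in d1.
  exact: etrans (esym d1) d2.
split=> //; rewrite leNgt; apply/negP => pos.
set D := 'D_w ('D_w u) x in pos.
have cv : (fun h => h^-1 *: (('D_w u \o shift x) (h *: w) - 'D_w u x)) @ 0^' --> D.
  exact: (diff_derivable (v := w) ddu).
move/cvgrPdist_lt: cv => /(_ D pos); rewrite near_withinE => /nbhs_ballP [e /= e0 he].
pose t := Num.min h e / 2; have t0 : 0 < t by rewrite divr_gt0 // lt_min h0 e0.
have th : t < h by rewrite /t ltr_pdivrMr // mulr_natr mulr2n ltr_pwDl // ge_min lexx.
have te : t < e by rewrite /t ltr_pdivrMr // mulr_natr mulr2n ltr_pwDl // ge_min lexx orbT.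
have mh : - h < 0 by rewrite oppr_lt0.
have [s /andP[s0 st] eq] := @line_MVT u x w t t0 (fun s hs =>
  dt s (introT andP (conj (lt_le_trans mh (proj1 (andP hs)))
                          (le_lt_trans (proj2 (andP hs)) th)))).
have ds : `|D - s^-1 * ('D_w u (s *: w + x) - 'D_w u x)| < D.
  apply: (he s); last by rewrite gt_eqF.
  by rewrite -ball_normE /ball_ /= sub0r normrN gtr0_norm // (lt_trans st).
rewrite d0 subr0 [s *: w + x]addrC in ds.
have pos' : 0 < 'D_w u (x + s *: w).
  have : 0 < s^-1 * 'D_w u (x + s *: w).
    move: ds; set q := s^-1 * _ => ds; rewrite ltr_norml in ds.
    case/andP: ds => _ ds; have {ds} := (ds : D - q < D); clearbody q D.
    by rewrite ltrBlDr ltrDl.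
  by rewrite pmulr_rgt0 // invr_gt0.
have : 0 < u (x + t *: w) - u x by rewrite eq mulr_gt0.
rewrite subr_gt0 ltNge => /negP; apply; apply: mt.
by rewrite th (lt_trans mh).
Qed.

End PlaneCalculus.

(** * The ring of smooth complex functions on an open set *)

Record domain (R : realType) := Domain {
  dom :> set 'rV[R]_2;
  dom_open : open dom
}.

Section SmoothPredicate.
Variables (R : realType) (V : domain R).
Local Notation E := 'rV[R]_2.
Local Notation Re := complex.Re.
Local Notation Im := complex.Im.

(** Ring elements are functions on these points only, so that equality in the ring means equality on
    V. *)
Definition point : Type := {x : E | dom V x}.

(** The default value 0 outside V has no influence: derivatives are taken at points of V, which is
    open. *)
Definition extend (u : point -> R[i]) (x : E) : R[i] :=
  match pselect (dom V x) with left h => u (exist _ x h) | right _ => 0 end.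

Lemma extendE u (p : point) : extend u (sval p) = u p.
Proof.
case: p => x h; rewrite /extend /=; case: pselect => // h'.
by congr u; congr exist; exact: Prop_irrelevance.
Qed.

Lemma extend_in u x (h : dom V x) : extend u x = u (exist _ x h).
Proof. by rewrite -[RHS]extendE. Qed.

Definition smooth_real (u : E -> R) := forall k, Ck k (dom V) u.

Definition smooth_complex (u : E -> R[i]) :=
  smooth_real (fun x => Re (u x)) /\ smooth_real (fun x => Im (u x)).

Lemma smooth_complex_eq u v : (forall x, dom V x -> u x = v x) ->
  smooth_complex u -> smooth_complex v.
Proof.
move=> uv [hr hi].
by split=> k; [apply: (Ck_eq (@dom_open R V) _ (hr k))|apply: (Ck_eq (@dom_open R V) _ (hi k))];
  move=> x Vx; rewrite uv.
Qed.

Definition smooth_pred : {pred point -> R[i]} := fun u => `[< smooth_complex (extend u) >].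

Lemma smooth_predP u : reflect (smooth_complex (extend u)) (u \in smooth_pred).
Proof. exact: asboolP. Qed.

Let oV := @dom_open R V.

Lemma smooth_subring : subring_closed smooth_pred.
Proof.
split.
- apply/smooth_predP; apply: (@smooth_complex_eq (fun=> 1)).
    by move=> x h; rewrite (extend_in _ h).
  by split=> k; exact: Ck_cst.
- move=> u v /smooth_predP [ur ui] /smooth_predP [vr vi]; apply/smooth_predP.
  apply: (@smooth_complex_eq (fun x => extend u x - extend v x)).
    by move=> x h; rewrite !(extend_in _ h).
  split=> k.
    apply: (Ck_eq oV _ (CkD oV (ur k) (CkN oV (vr k)))) => x _.
    by case: (extend u x) (extend v x) => a b [a' b'].
  apply: (Ck_eq oV _ (CkD oV (ui k) (CkN oV (vi k)))) => x _.
  by case: (extend u x) (extend v x) => a b [a' b'].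
- move=> u v /smooth_predP [ur ui] /smooth_predP [vr vi]; apply/smooth_predP.
  apply: (@smooth_complex_eq (fun x => extend u x * extend v x)).
    by move=> x h; rewrite !(extend_in _ h).
  split=> k.
    apply: (Ck_eq oV _ (CkD oV (CkM oV (ur k) (vr k)) (CkN oV (CkM oV (ui k) (vi k))))) => x _.
    by case: (extend u x) (extend v x) => a b [a' b'].
  apply: (Ck_eq oV _ (CkD oV (CkM oV (ur k) (vi k)) (CkM oV (ui k) (vr k)))) => x _.
  by case: (extend u x) (extend v x) => a b [a' b'].
Qed.

HB.instance Definition _ :=
  GRing.isSubringClosed.Build (point -> R[i]) smooth_pred smooth_subring.

Record smooth_fun := SmoothFun {
  smooth_val :> point -> R[i];
  _ : smooth_val \in smooth_pred
}.

HB.instance Definition _ := [isSub for smooth_val].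
HB.instance Definition _ := [Choice of smooth_fun by <:].
HB.instance Definition _ := GRing.SubChoice_isSubComPzRing.Build
  (point -> R[i]) smooth_pred smooth_fun (subringClosedP _).

Lemma smooth_ext (a b : smooth_fun) : (forall p, a p = b p) -> a = b.
Proof. by move=> ab; apply: val_inj; apply/funext. Qed.

Lemma smooth_valP (a : smooth_fun) : smooth_complex (extend a).
Proof. by case: a => u hu; exact/smooth_predP. Qed.

Lemma restrict_smooth (w : E -> R[i]) :
  smooth_complex w -> (fun p : point => w (sval p)) \in smooth_pred.
Proof.
move=> hw; apply/smooth_predP; apply: (smooth_complex_eq _ hw) => x h.
by rewrite (extend_in _ h).
Qed.

Definition lift_smooth (w : E -> R[i]) (hw : smooth_complex w) : smooth_fun :=
  SmoothFun (restrict_smooth hw).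

Definition ev (p : point) (a : smooth_fun) : R[i] := a p.

Lemma evD p a b : ev p (a + b) = ev p a + ev p b. Proof. by []. Qed.

Lemma evN p a : ev p (- a) = - ev p a. Proof. by []. Qed.

Lemma ev1 p : ev p 1 = 1. Proof. by []. Qed.

Lemma ev0 p : ev p 0 = 0. Proof. by []. Qed.

Lemma evM p a b : ev p (a * b) = ev p a * ev p b. Proof. by []. Qed.

Lemma ev_is_additive p : additive (ev p).
Proof. by move=> a b. Qed.

Lemma ev_is_multiplicative p : multiplicative (ev p).
Proof. by split. Qed.

HB.instance Definition _ p := GRing.isAdditive.Build smooth_fun R[i] (ev p) (ev_is_additive p).
HB.instance Definition _ p :=
  GRing.isMultiplicative.Build smooth_fun R[i] (ev p) (ev_is_multiplicative p).

Lemma ev_lift p w (hw : smooth_complex w) : ev p (lift_smooth hw) = w (sval p).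
Proof. by []. Qed.

Lemma smooth_evP (a b : smooth_fun) : (forall p, ev p a = ev p b) -> a = b.
Proof. exact: smooth_ext. Qed.

Lemma extend_ev p (a : smooth_fun) : extend a (sval p) = ev p a.
Proof. exact: extendE. Qed.

Definition pdf (w : E) (u : E -> R[i]) (x : E) : R[i] :=
  Complex ('D_w (fun y => Re (u y)) x) ('D_w (fun y => Im (u y)) x).

Lemma smooth_derive (w : E) u : smooth_real u -> smooth_real ('D_w u).
Proof.
move=> hu k; have [_ [ux uy]] := hu k.+1.
apply: (Ck_eq oV _ (CkD oV (CkM oV (Ck_cst oV k (w 0 0)) ux)
                           (CkM oV (Ck_cst oV k (w 0 1)) uy))) => x Vx.
by rewrite [RHS](derive_plane _ (Ck_diff (hu 0%N) Vx)).
Qed.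

Lemma smooth_pdf w u : smooth_complex u -> smooth_complex (pdf w u).
Proof. by move=> [ur ui]; split; exact: smooth_derive. Qed.

Definition pd (w : E) (a : smooth_fun) : smooth_fun :=
  lift_smooth (smooth_pdf w (smooth_valP a)).

Lemma ev_pd w p a : ev p (pd w a) = pdf w (extend a) (sval p).
Proof. by []. Qed.

Lemma pdf_eq w u v x : dom V x -> (forall y, dom V y -> u y = v y) -> pdf w u x = pdf w v x.
Proof.
move=> Vx uv; congr Complex; apply: (derive_eq_on oV) => //;
  by move=> y Vy; rewrite uv.
Qed.

Lemma smooth_derivable u x w : smooth_real u -> dom V x -> derivable u x w.
Proof. by move=> hu Vx; exact: (Ck_derivable (hu 0%N) Vx). Qed.

Lemma smooth_differentiable u x : smooth_real u -> dom V x -> differentiable u x.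
Proof. by move=> hu Vx; exact: (Ck_diff (hu 0%N) Vx). Qed.

Lemma pd_lift w u (hu : smooth_complex u) p :
  ev p (pd w (lift_smooth hu)) = pdf w u (sval p).
Proof.
rewrite ev_pd; apply: pdf_eq; first exact: (svalP p).
by move=> y Vy; rewrite (extend_in _ Vy).
Qed.

Lemma pdD w a b : pd w (a + b) = pd w a + pd w b.
Proof.
apply: smooth_evP => p; have Vp := svalP p; rewrite evD !ev_pd.
have [ar ai] := smooth_valP a; have [br bi] := smooth_valP b.
rewrite (@pdf_eq _ _ (fun x => Complex (Re (extend a x) + Re (extend b x))
                                       (Im (extend a x) + Im (extend b x)))) //.
  rewrite /pdf /=.
  rewrite (deriveD (smooth_derivable ar Vp) (smooth_derivable br Vp)).
  by rewrite (deriveD (smooth_derivable ai Vp) (smooth_derivable bi Vp)).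
move=> y Vy; have -> : extend (a + b) y = extend a y + extend b y.
  by rewrite !(extend_in _ Vy).
by case: (extend a y) (extend b y) => [a1 a2] [b1 b2].
Qed.

Lemma pdM w a b : pd w (a * b) = pd w a * b + a * pd w b.
Proof.
apply: smooth_evP => p; have Vp := svalP p; rewrite evD !evM !ev_pd -!extend_ev.
have [ar ai] := smooth_valP a; have [br bi] := smooth_valP b.
rewrite (@pdf_eq _ _ (fun x => Complex
    (Re (extend a x) * Re (extend b x) - Im (extend a x) * Im (extend b x))
    (Re (extend a x) * Im (extend b x) + Im (extend a x) * Re (extend b x)))) //; last first.
  move=> y Vy; have -> : extend (a * b) y = extend a y * extend b y.
    by rewrite !(extend_in _ Vy).
  by case: (extend a y) (extend b y) => [a1 a2] [b1 b2].
rewrite /pdf /=.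
have d u v (hu : smooth_real u) (hv : smooth_real v) : derivable (fun x => u x * v x) (sval p) w.
  exact: derivableM (smooth_derivable hu Vp) (smooth_derivable hv Vp).
have dE u v (hu : smooth_real u) (hv : smooth_real v) :
    'D_w (fun x => u x * v x) (sval p) = u (sval p) * 'D_w v (sval p) + v (sval p) * 'D_w u (sval p).
  exact: deriveM (smooth_derivable hu Vp) (smooth_derivable hv Vp).
rewrite (deriveB (d _ _ ar br) (d _ _ ai bi)) (deriveD (d _ _ ar bi) (d _ _ ai br)) !dE //.
case: (extend a _) (extend b _) => [a1 a2] [b1 b2] /=.
by congr Complex; ring.
Qed.

Lemma pd_comm v w a : pd v (pd w a) = pd w (pd v a).
Proof.
have sw u x : smooth_real u -> dom V x -> 'D_v ('D_w u) x = 'D_w ('D_v u) x.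
  move=> hu Vx; apply: schwarz.
  - apply: (open_near oV Vx) => y Vy; split; first exact: smooth_differentiable.
    by split; exact: (smooth_differentiable (smooth_derive _ hu) Vy).
  - apply: differentiable_continuous; apply: smooth_differentiable Vx.
    exact/smooth_derive/smooth_derive.
  - apply: differentiable_continuous; apply: smooth_differentiable Vx.
    exact/smooth_derive/smooth_derive.
apply: smooth_evP => p; have Vp := svalP p; have [ar ai] := smooth_valP a.
rewrite !pd_lift; exact: (congr2 (@Complex R) (sw _ _ ar Vp) (sw _ _ ai Vp)).
Qed.

End SmoothPredicate.

Arguments ev : simpl never.

(** * Wirtinger derivatives of smooth functions *)

Section SmoothWirtinger.
Variables (R : realType) (V : domain R).
Local Notation E := 'rV[R]_2.
Local Notation Re := complex.Re.
Local Notation Im := complex.Im.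
Local Notation A := (smooth_fun V).
Let oV := @dom_open R V.
Implicit Types (a b : A) (p : point V).

Lemma smooth_const (z : R[i]) : smooth_complex V (fun=> z).
Proof. by split=> k; exact: Ck_cst. Qed.

Definition const (z : R[i]) : A := lift_smooth (smooth_const z).

Lemma ev_const p z : ev p (const z) = z. Proof. by []. Qed.

Lemma constD z t : const (z + t) = const z + const t.
Proof. exact: smooth_evP. Qed.

Lemma constM z t : const (z * t) = const z * const t.
Proof. exact: smooth_evP. Qed.

Lemma const1 : const 1 = 1. Proof. exact: smooth_evP. Qed.

Lemma pd_const w z : pd w (const z) = 0.
Proof.
apply: smooth_evP => p; rewrite pd_lift.
by apply: (congr2 (@Complex R)); exact: derive_cst.
Qed.

Lemma smooth_conj u : smooth_complex V u -> smooth_complex V (fun x => conjc (u x)).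
Proof.
move=> [ur ui]; split=> k.
  by apply: (Ck_eq oV _ (ur k)) => x _; case: (u x).
by apply: (Ck_eq oV _ (CkN oV (ui k))) => x _; case: (u x).
Qed.

Definition smooth_cj a : A := lift_smooth (smooth_conj (smooth_valP a)).

Lemma ev_cj p a : ev p (smooth_cj a) = conjc (ev p a).
Proof. by rewrite /smooth_cj ev_lift extend_ev. Qed.

Lemma smooth_cj_additive : additive smooth_cj.
Proof. by move=> a b; apply: smooth_evP => p; rewrite !(evD, evN, ev_cj) rmorphB. Qed.

Lemma smooth_cj_multiplicative : multiplicative smooth_cj.
Proof.
split=> [a b|]; apply: smooth_evP => p; first by rewrite !(evM, ev_cj) rmorphM.
by rewrite !(ev1, ev_cj) rmorph1.
Qed.

HB.instance Definition _ := GRing.isAdditive.Build A A smooth_cj smooth_cj_additive.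
HB.instance Definition _ := GRing.isMultiplicative.Build A A smooth_cj smooth_cj_multiplicative.

Let cjM a b : smooth_cj (a * b) = smooth_cj a * smooth_cj b.
Proof. exact: rmorphM. Qed.

Let cjB a b : smooth_cj (a - b) = smooth_cj a - smooth_cj b.
Proof. exact: rmorphB. Qed.

Lemma smooth_cjK a : smooth_cj (smooth_cj a) = a.
Proof. by apply: smooth_evP => p; rewrite !ev_cj conjcK. Qed.

Lemma pd_cj w a : pd w (smooth_cj a) = smooth_cj (pd w a).
Proof.
apply: smooth_evP => p; have Vp := svalP p; have [ar ai] := smooth_valP a.
rewrite pd_lift ev_cj ev_pd; apply: (congr2 (@Complex R)).
  by apply: (derive_eq_on oV) Vp => x _; case: (extend a x).
have <- : 'D_w (fun y => - Im (extend a y)) (sval p) = - 'D_w (fun y => Im (extend a y)) (sval p).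
  exact: (deriveN (smooth_derivable ai Vp)).
by apply: (derive_eq_on oV) Vp => x _; case: (extend a x).
Qed.

Lemma cj_const z : smooth_cj (const z) = const (conjc z).
Proof. by apply: smooth_evP => p; rewrite ev_cj. Qed.

Definition imag : A := const 'i%C.
Definition smooth_half : A := const (2^-1)%:C%C.

Lemma imagM : imag * imag = -1.
Proof. by apply: smooth_evP => p; rewrite evM !ev_const evN ev1 -sqr_i expr2. Qed.

Lemma cj_imag : smooth_cj imag = - imag.
Proof.
rewrite cj_const; apply: smooth_evP => p; rewrite evN !ev_const.
by apply: (congr2 (@Complex R)); rewrite ?oppr0.
Qed.

Lemma smooth_halfE : smooth_half + smooth_half = 1.
Proof.
apply: smooth_evP => p; rewrite evD !ev_const -rmorphD.
by rewrite (_ : 2^-1 + 2^-1 = 1 :> R) // [RHS]splitr div1r.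
Qed.

Lemma cj_half : smooth_cj smooth_half = smooth_half.
Proof. by rewrite cj_const /smooth_half conjc_real. Qed.

Definition ddz a : A := smooth_half * (pd (vx R) a - imag * pd (vy R) a).

Lemma ddzD a b : ddz (a + b) = ddz a + ddz b.
Proof. by rewrite /ddz !pdD; ring. Qed.

Lemma ddzM a b : ddz (a * b) = ddz a * b + a * ddz b.
Proof. by rewrite /ddz !pdM; ring. Qed.

Lemma pdZ w z a : pd w (const z * a) = const z * pd w a.
Proof. by rewrite pdM pd_const mul0r add0r. Qed.

Lemma pd0 w : pd w (0 : A) = 0.
Proof. by apply: (addIr (pd w 0)); rewrite -pdD addr0 add0r. Qed.

Lemma pdN w a : pd w (- a) = - pd w a.
Proof. by apply: (addIr (pd w a)); rewrite -pdD !addNr pd0. Qed.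

Lemma ddzb_cj a : smooth_cj (ddz (smooth_cj a)) = smooth_half * (pd (vx R) a + imag * pd (vy R) a).
Proof.
rewrite /ddz cjM cj_half cjB cjM cj_imag !pd_cj !smooth_cjK; ring.
Qed.

Lemma ddz_cj a : ddz (smooth_cj (ddz (smooth_cj a))) = smooth_cj (ddz (smooth_cj (ddz a))).
Proof.
have hZ w b : pd w (smooth_half * b) = smooth_half * pd w b by exact: pdZ.
have iZ w b : pd w (imag * b) = imag * pd w b by exact: pdZ.
by rewrite !ddzb_cj /ddz !hZ !pdD !pdN !iZ (pd_comm (vy R) (vx R)); ring.
Qed.

Definition smooth_wirtinger : wirtinger A :=
  Wirtinger ddzD ddzM smooth_cjK ddz_cj smooth_halfE.

Local Notation W := smooth_wirtinger.

Lemma dz_const z : dz W (const z) = 0.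
Proof. by rewrite /= /ddz !pd_const; ring. Qed.

Lemma dzbE a : dzb W a = smooth_half * (pd (vx R) a + imag * pd (vy R) a).
Proof. exact: ddzb_cj. Qed.

Lemma complex_comb (s t x1 x2 y1 y2 : R) :
  Complex (s * x1 + t * y1) (s * x2 + t * y2) = s%:C%C * Complex x1 x2 + t%:C%C * Complex y1 y2.
Proof. by apply/eqP; rewrite eq_complex /= !mul0r !subr0 !addr0 !eqxx. Qed.

Lemma pd_plane (w : E) a :
  pd w a = const (Complex (w 0 0) (w 0 1)) * dz W a + const (Complex (w 0 0) (- w 0 1)) * dzb W a.
Proof.
have e : pd w a = const (w 0 0)%:C%C * pd (vx R) a + const (w 0 1)%:C%C * pd (vy R) a.
  apply: smooth_evP => p; have Vp := svalP p; have [ar ai] := smooth_valP a.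
  rewrite evD !evM !ev_pd !ev_const /pdf.
  rewrite (derive_plane w (smooth_differentiable ar Vp)).
  rewrite (derive_plane w (smooth_differentiable ai Vp)).
  exact: complex_comb.
rewrite e dzbE /= /ddz.
have c2 x y : const (Complex x y) = const x%:C%C + imag * const y%:C%C.
  by rewrite -constM -constD; congr const; rewrite [LHS]complexE.
have -> : const (Complex (w 0 0) (- w 0 1)) = const (w 0 0)%:C%C - imag * const (w 0 1)%:C%C.
  apply: smooth_evP => p; rewrite evD evN evM !ev_const.
  by rewrite [LHS]complexE /= rmorphN mulrN.
rewrite c2.
have h2 : smooth_half * 2 = 1 by rewrite mulr_natr mulr2n smooth_halfE.
have i2 := imagM.
by ring: i2 h2.
Qed.

(** As 1/a = conj a / |a|^2, only the inverse of the real function |a|^2 has to be smooth. This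
    lemma supplies the elements i_j. *)
Lemma smooth_inv a : (forall p, ev p a != 0) -> exists b, a * b = 1.
Proof.
move=> a0; have [ar ai] := smooth_valP a.
pose n x := Re (extend a x) ^+ 2 + Im (extend a x) ^+ 2.
have nn k : Ck k (dom V) n.
  apply: (Ck_eq oV _ (CkD oV (CkM oV (ar k) (ar k)) (CkM oV (ai k) (ai k)))) => x _.
  by rewrite /n !expr2.
have n0 x : dom V x -> n x != 0.
  move=> Vx; have := a0 (exist _ x Vx); rewrite -extend_ev /= /n.
  by case: (extend a x) => s t /=; rewrite paddr_eq0 ?sqr_ge0 // !sqrf_eq0 eq_complex.
have hi : smooth_complex V (fun x => (extend a x)^-1).
  split=> k.
    apply: (Ck_eq oV _ (CkM oV (ar k) (CkV oV n0 (nn k)))) => x _.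
    by rewrite /n; case: (extend a x).
  apply: (Ck_eq oV _ (CkN oV (CkM oV (ai k) (CkV oV n0 (nn k))))) => x _.
  by rewrite /n; case: (extend a x).
exists (lift_smooth hi); apply: smooth_evP => p.
by rewrite evM ev_lift extend_ev mulfV.
Qed.

Lemma smooth_exp a : smooth_cj a = a ->
  exists b, [/\ smooth_cj b = b, forall p, ev p b = (expR (Re (ev p a)))%:C%C &
                dz W b = b * dz W a].
Proof.
move=> ra; have [ar ai] := smooth_valP a.
have a0 p : Im (ev p a) = 0.
  have := congr1 (fun c => Im (ev p c)) ra; rewrite ev_cj; case: (ev p a) => s t /= e.
  by lra.
have he : smooth_complex V (fun x => (expR (Re (extend a x)))%:C%C).
  by split=> k; [exact: (Ck_expR oV (ar k))|exact: Ck_cst].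
exists (lift_smooth he); split.
- by apply: smooth_evP => p; rewrite ev_cj ev_lift conjc_real.
- by move=> p; rewrite ev_lift extend_ev.
have e w : pd w (lift_smooth he) = lift_smooth he * pd w a.
  apply: smooth_evP => p; have Vp := svalP p; rewrite evM pd_lift ev_lift ev_pd.
  have iz : 'D_w (fun y => Im (extend a y)) (sval p) = 0.
    have e0 y : dom V y -> Im (extend a y) = (fun=> 0) y.
      by move=> Vy; rewrite (extend_in _ Vy); exact: a0 (exist _ y Vy).
    by rewrite (derive_eq_on oV _ e0 Vp) derive_cst.
  rewrite /pdf iz /=.
  rewrite (derive_expR_comp _ (smooth_differentiable ar Vp)).
  have -> : 'D_w (fun=> 0) (sval p) = 0 :> R by exact: derive_cst.
  by apply/eqP; rewrite eq_complex /= !mulr0 !mul0r subr0 addr0 !eqxx.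
by rewrite /= /ddz !e; ring.
Qed.

Lemma derive_coord (k : 'I_2) (w x : E) : 'D_w (fun y : E => y 0 k) x = w 0 k.
Proof.
have := @derive_mx _ _ _ _ (@id E) x w (@derivable_id _ _ x w); rewrite derive_id => e.
by have := congr1 (fun M : 'rV_2 => M 0 k) e; rewrite mxE.
Qed.

Lemma smooth_coord (k : 'I_2) : smooth_real V (fun x => x 0 k).
Proof.
have d x : differentiable (fun x : E => x 0 k) x by exact: differentiable_coord.
case=> [|j]; first by split; [move=> x _; exact: d | exact: I].
split; first by move=> x _; exact: d.
have c w : Ck j (dom V) ('D_w (fun x : E => x 0 k)).
  by apply: (Ck_eq oV _ (Ck_cst oV j (w 0 k))) => x _; rewrite derive_coord.
by split; exact: c.
Qed.

Definition coord : A := lift_smooth (conj (smooth_coord 0) (smooth_coord 1)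
  : smooth_complex V (fun x => Complex (x 0 0) (x 0 1))).

Lemma pd_coord w : pd w coord = const (Complex (w 0 0) (w 0 1)).
Proof.
apply: smooth_evP => p; rewrite pd_lift.
exact: (congr2 (@Complex R) (derive_coord _ _ _) (derive_coord _ _ _)).
Qed.

Lemma dz_coord : dz W coord = 1.
Proof.
rewrite /= /ddz !pd_coord !mxE /=; apply: smooth_evP => p.
rewrite evM evD evN evM !ev_const ev1; apply/eqP; rewrite eq_complex /=.
by apply/andP; split; apply/eqP; field.
Qed.

Lemma dzb_coord : dzb W coord = 0.
Proof.
rewrite dzbE !pd_coord !mxE /=; apply: smooth_evP => p.
rewrite evM evD evM !ev_const ev0; apply/eqP; rewrite eq_complex /=.
by apply/andP; split; apply/eqP; field.
Qed.

Lemma smooth_of_real u : smooth_real V u -> smooth_complex V (fun x => (u x)%:C%C).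
Proof. by move=> hu; split=> k; [exact: hu|exact: Ck_cst]. Qed.

Definition of_real u (hu : smooth_real V u) : A := lift_smooth (smooth_of_real hu).

Lemma ev_of_real u (hu : smooth_real V u) p : ev p (of_real hu) = (u (sval p))%:C%C.
Proof. by []. Qed.

Lemma cj_of_real u (hu : smooth_real V u) : smooth_cj (of_real hu) = of_real hu.
Proof. by apply: smooth_evP => p; rewrite ev_cj ev_of_real conjc_real. Qed.

Lemma ev_pd_of_real u (hu : smooth_real V u) w p :
  ev p (pd w (of_real hu)) = ('D_w u (sval p))%:C%C.
Proof.
rewrite pd_lift; apply: (congr2 (@Complex R)) => //; exact: derive_cst.
Qed.

Lemma pd_zero a w : dz W a = 0 -> dzb W a = 0 -> pd w a = 0.
Proof. by move=> a0 b0; rewrite pd_plane a0 b0 !mulr0 addr0. Qed.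

Lemma smooth_constant a p (r : R) : dz W a = 0 -> dzb W a = 0 ->
  (forall y, `|y - sval p| < r -> dom V y) ->
  forall y, `|y - sval p| < r -> extend a y = ev p a.
Proof.
move=> a0 b0 Vr y yr; have [ar ai] := smooth_valP a.
have z w x : dom V x -> pdf w (extend a) x = 0.
  by move=> Vx; have := congr1 (ev (exist _ x Vx)) (pd_zero w a0 b0).
have er := ball_constant (fun x xr => smooth_differentiable ar (Vr x xr))
  (fun x xr => conj (congr1 (@complex.Re R) (z (vx R) x (Vr x xr)))
                    (congr1 (@complex.Re R) (z (vy R) x (Vr x xr)))) yr.
have ei := ball_constant (fun x xr => smooth_differentiable ai (Vr x xr))
  (fun x xr => conj (congr1 (@complex.Im R) (z (vx R) x (Vr x xr)))
                    (congr1 (@complex.Im R) (z (vy R) x (Vr x xr)))) yr.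
rewrite -extend_ev; move: er ei; case: (extend a y) (extend a (sval p)) => s t [s' t'].
by move=> /= -> ->.
Qed.

Lemma smooth_local_max a p : smooth_cj a = a ->
  (\forall y \near sval p, Re (extend a y) <= Re (ev p a)) ->
  ev p (dz W a) = 0 /\ Re (ev p (dz W (dzb W a))) <= 0.
Proof.
move=> ra mx; have Vp := svalP p; have [ar ai] := smooth_valP a.
have mx' : \forall y \near sval p, Re (extend a y) <= Re (extend a (sval p)).
  by rewrite extend_ev.
have dr : \forall y \near sval p, differentiable (fun x => Re (extend a x)) y.
  by apply: (open_near oV Vp) => y Vy; exact: smooth_differentiable ar Vy.
have key w := local_max_derive dr (smooth_differentiable (smooth_derive w ar) Vp) mx'.
have rpd w b : smooth_cj b = b -> smooth_cj (pd w b) = pd w b.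
  by move=> rb; rewrite -pd_cj rb.
have im0 b : smooth_cj b = b -> Im (ev p b) = 0.
  move=> rb; have := congr1 (fun c => Im (ev p c)) rb.
  by rewrite ev_cj; case: (ev p b) => s t /= e; lra.
have e1 w : ev p (pd w a) = 0.
  apply/eqP; rewrite eq_complex im0 ?rpd // eqxx andbT.
  by apply/eqP; exact: (proj1 (key w)).
have e2 w : Re (ev p (pd w (pd w a))) <= 0.
  by rewrite /pd pd_lift; exact: (proj2 (key w)).
have i2 := imagM.
split; first by rewrite /= /ddz evM evD evN evM !e1; ring.
(* The operator d d-bar is a quarter of the Laplacian, and both pure second derivatives are
   nonpositive at a maximum. *)
have -> : dz W (dzb W a) = const (4^-1)%:C%C
     * (pd (vx R) (pd (vx R) a) + pd (vy R) (pd (vy R) a)).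
  have h4 : const (4^-1)%:C%C = smooth_half * smooth_half.
    by rewrite -constM -rmorphM; congr (const _%:C%C); field.
  have hZ w b : pd w (smooth_half * b) = smooth_half * pd w b by exact: pdZ.
  have iZ w b : pd w (imag * b) = imag * pd w b by exact: pdZ.
  rewrite h4 dzbE /= /ddz !hZ !pdD !iZ (pd_comm (vy R) (vx R)).
  by ring: i2.
have := lerD (e2 (vx R)) (e2 (vy R)); rewrite addr0 evM evD ev_const.
case: (ev p _) (ev p _) => s t [s' t'] /=; rewrite mul0r subr0.
by move=> h; rewrite pmulr_rle0 // invr_gt0.
Qed.

Lemma smooth_real_continuous u x : smooth_real V u -> dom V x -> {for x, continuous u}.
Proof. by move=> hu Vx; apply: differentiable_continuous; exact: smooth_differentiable. Qed.

Lemma smooth_near_neq0 a p : ev p a != 0 -> \forall y \near sval p, extend a y != 0.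
Proof.
move=> ap; have Vp := svalP p; have [ar ai] := smooth_valP a.
have near_ne (u : E -> R) : smooth_real V u -> u (sval p) != 0 -> \forall y \near sval p, u y != 0.
  move=> hu u0; have cu := smooth_real_continuous hu Vp.
  have /cvgrPdist_lt /(_ `|u (sval p)|) := cu; rewrite normr_gt0 => /(_ u0).
  apply: filterS => y; apply: contraTneq => ->.
  by rewrite subr0 ltxx.
move: ap; rewrite -extend_ev eq_complex negb_and => /orP[h|h].
  by apply: filterS (near_ne _ ar h) => y; apply: contra => /eqP ->.
by apply: filterS (near_ne _ ai h) => y; apply: contra => /eqP ->.
Qed.

(** This and the next lemmas restate earlier facts through the fields of [smooth_wirtinger], whose
    definition is sealed after this section. *)
Lemma ev_cjE p a : ev p (cj W a) = conjc (ev p a).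
Proof. exact: ev_cj. Qed.

Lemma cj_dom_const z : cj W (const z) = const (conjc z).
Proof. exact: cj_const. Qed.

Lemma cj_dom_of_real u (hu : smooth_real V u) : cj W (of_real hu) = of_real hu.
Proof. exact: cj_of_real. Qed.

Lemma cj_dom_imag : cj W imag = - imag.
Proof. exact: cj_imag. Qed.

Lemma cj_local_max a p : cj W a = a ->
  (\forall y \near sval p, Re (extend a y) <= Re (ev p a)) ->
  ev p (dz W a) = 0 /\ Re (ev p (dz W (dzb W a))) <= 0.
Proof. exact: smooth_local_max. Qed.

Lemma cj_exp a : cj W a = a ->
  exists b, [/\ cj W b = b, forall p, ev p b = (expR (Re (ev p a)))%:C%C &
                dz W b = b * dz W a].
Proof. exact: smooth_exp. Qed.

Lemma ev_real p a : cj W a = a -> ev p a = (Re (ev p a))%:C%C.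
Proof.
move=> ra; have := congr1 (fun b => Im (ev p b)) ra; rewrite ev_cjE.
by case: (ev p a) => s t /= e; congr Complex; lra.
Qed.

End SmoothWirtinger.

Global Opaque smooth_wirtinger.

(** * Unique continuation *)

Lemma sqr_bound (R : realDomainType) (x y : R) : x ^+ 2 <= y ^+ 2 -> 0 <= y -> - y <= x <= y.
Proof.
by move=> xy y0; rewrite -ler_norml -(ger0_norm y0) -ler_sqr ?nnegrE // !real_normK ?num_real.
Qed.

(* The values at a point of u, u_z = p, u_zz = q, the potential l with l_z = m,
   and a weight beta with beta_z = b and beta_(z zbar) = t: first- and
   second-order conditions at a maximum of (u^2 + |p|^2) exp beta. *)
Lemma weighted_max_bound (R : realFieldType)
    (u p1 p2 q1 q2 l m1 m2 b1 b2 t L B : R) (S := u ^+ 2 + p1 ^+ 2 + p2 ^+ 2) :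
  0 < S -> 0 <= L -> 0 <= B -> - L <= l <= L ->
  m1 ^+ 2 + m2 ^+ 2 <= L ^+ 2 -> b1 ^+ 2 + b2 ^+ 2 <= B ^+ 2 ->
  q1 * p1 + q2 * p2 = - (S * b1) - (2 - l) * u * p1 ->
  q2 * p1 - q1 * p2 = - (S * b2) - (2 - l) * u * p2 ->
  q1 ^+ 2 + q2 ^+ 2 + (2 - 2 * l) * (p1 ^+ 2 + p2 ^+ 2) + (l ^+ 2 - 2 * l) * u ^+ 2
    - 2 * u * (m1 * p1 + m2 * p2) - S * (b1 ^+ 2 + b2 ^+ 2) + S * t <= 0 ->
  t <= (2 + L) * B + (5 * L + 2).
Proof.
move=> S0 L0 B0 /andP[l1 l2] mL bB e1 e2 main.
(* Cauchy-Schwarz for the product with p, then 2 |u| |p| <= u^2 + |p|^2 = S. *)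
have cross (x1 x2 M : R) : 0 <= M -> x1 ^+ 2 + x2 ^+ 2 <= M ^+ 2 ->
    - (M * S) <= 2 * u * (x1 * p1 + x2 * p2) <= M * S.
  move=> M0 xM; apply: sqr_bound; last by rewrite mulr_ge0 // ltW.
  have h1 : (x1 * p1 + x2 * p2) ^+ 2 <= (x1 ^+ 2 + x2 ^+ 2) * (p1 ^+ 2 + p2 ^+ 2).
    rewrite -subr_ge0; have -> : (x1 ^+ 2 + x2 ^+ 2) * (p1 ^+ 2 + p2 ^+ 2)
      - (x1 * p1 + x2 * p2) ^+ 2 = (x1 * p2 - x2 * p1) ^+ 2 by ring.
    exact: sqr_ge0.
  have h2 : (x1 * p1 + x2 * p2) ^+ 2 <= M ^+ 2 * (p1 ^+ 2 + p2 ^+ 2).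
    by apply: le_trans h1 _; rewrite ler_wpM2r // addr_ge0 // sqr_ge0.
  have h3 : 4 * u ^+ 2 * (p1 ^+ 2 + p2 ^+ 2) <= S ^+ 2.
    rewrite -subr_ge0; have -> : S ^+ 2 - 4 * u ^+ 2 * (p1 ^+ 2 + p2 ^+ 2)
      = (u ^+ 2 - (p1 ^+ 2 + p2 ^+ 2)) ^+ 2 by rewrite /S; ring.
    exact: sqr_ge0.
  have -> : (2 * u * (x1 * p1 + x2 * p2)) ^+ 2 = 4 * u ^+ 2 * (x1 * p1 + x2 * p2) ^+ 2 by ring.
  apply: (@le_trans _ _ (4 * u ^+ 2 * (M ^+ 2 * (p1 ^+ 2 + p2 ^+ 2)))).
    by rewrite ler_wpM2l // mulr_ge0 // sqr_ge0.
  have -> : 4 * u ^+ 2 * (M ^+ 2 * (p1 ^+ 2 + p2 ^+ 2))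
    = M ^+ 2 * (4 * u ^+ 2 * (p1 ^+ 2 + p2 ^+ 2)) by ring.
  by rewrite exprMn ler_wpM2l // sqr_ge0.
have /andP[hb1 hb2] := cross _ _ _ B0 bB; have /andP[hm1 hm2] := cross _ _ _ L0 mL.
(* The decisive cancellation: the first-order condition gives |q|^2 |p|^2 = |S b + (2 - l) u p|^2,
   and |p|^2 <= S. So |q|^2 absorbs the term - S |b|^2 of the second-order condition, and the final
   bound is linear in B. *)
have hq : S * (b1 ^+ 2 + b2 ^+ 2) + (2 - l) * (2 * u * (b1 * p1 + b2 * p2)) <= q1 ^+ 2 + q2 ^+ 2.
  rewrite -(ler_pM2l S0).
  apply: (@le_trans _ _ ((q1 ^+ 2 + q2 ^+ 2) * (p1 ^+ 2 + p2 ^+ 2))); last first.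
    rewrite mulrC ler_wpM2r ?addr_ge0 ?sqr_ge0 //.
    by rewrite /S -addrA lerDr sqr_ge0.
  have -> : (q1 ^+ 2 + q2 ^+ 2) * (p1 ^+ 2 + p2 ^+ 2)
    = (q1 * p1 + q2 * p2) ^+ 2 + (q2 * p1 - q1 * p2) ^+ 2 by ring.
  rewrite e1 e2 -subr_ge0.
  have -> : (- (S * b1) - (2 - l) * u * p1) ^+ 2 + (- (S * b2) - (2 - l) * u * p2) ^+ 2
     - S * (S * (b1 ^+ 2 + b2 ^+ 2) + (2 - l) * (2 * u * (b1 * p1 + b2 * p2)))
     = ((2 - l) * u) ^+ 2 * (p1 ^+ 2 + p2 ^+ 2) by ring.
  by rewrite mulr_ge0 ?addr_ge0 ?sqr_ge0.
have hl : - ((2 + L) * (B * S)) <= (2 - l) * (2 * u * (b1 * p1 + b2 * p2)).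
  set X := 2 * u * _ in hb1 hb2 *.
  have h : 0 <= 2 - l + (L - 0) + l by lra.
  have BS : 0 <= B * S by rewrite mulr_ge0 // ltW.
  have [l3|l3] := lerP 0 (2 - l).
    have : (2 - l) * - (B * S) <= (2 - l) * X by rewrite ler_wpM2l.
    have : (2 - l) * (B * S) <= (2 + L) * (B * S) by rewrite ler_wpM2r //; lra.
    by rewrite mulrN; lra.
  have : (2 - l) * (B * S) <= (2 - l) * X by rewrite ler_wnM2l // ltW.
  have : - ((2 + L) * (B * S)) <= (2 - l) * (B * S).
    by rewrite -mulNr ler_wpM2r //; lra.
  by lra.
have P0 : 0 <= p1 ^+ 2 + p2 ^+ 2 <= S.
  by rewrite addr_ge0 ?sqr_ge0 //= /S -addrA lerDr sqr_ge0.
have U0 : 0 <= u ^+ 2 <= S by rewrite sqr_ge0 /S -addrA lerDl addr_ge0 // sqr_ge0.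
have hp : - ((2 + 2 * L) * S) <= (2 - 2 * l) * (p1 ^+ 2 + p2 ^+ 2).
  case/andP: P0; set P := p1 ^+ 2 + _ => P1 PS.
  have : - (2 + 2 * L) * P <= (2 - 2 * l) * P by rewrite ler_wpM2r //; lra.
  have : (2 + 2 * L) * P <= (2 + 2 * L) * S by rewrite ler_wpM2l //; lra.
  by rewrite mulNr; lra.
have hu : - (2 * L * S) <= (l ^+ 2 - 2 * l) * u ^+ 2.
  case/andP: U0; set P := u ^+ 2 => P1 PS.
  have : - (2 * L) * P <= (l ^+ 2 - 2 * l) * P.
    by rewrite ler_wpM2r //; have := sqr_ge0 l; lra.
  have : 2 * L * P <= 2 * L * S by rewrite ler_wpM2l //; lra.
  by rewrite mulNr; lra.
(* After multiplication by S, the term in b costs (2 + L) B, those in m, |p|^2 and u^2 cost L, 2 + 2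
   L and 2 L, which add up to 5 L + 2. *)
rewrite -(ler_pM2l S0).
have -> : S * ((2 + L) * B + (5 * L + 2)) = (2 + L) * (B * S) + L * S + (2 + 2 * L) * S + 2 * L * S by ring.
by clear -main hq hl hm2 hp hu; lra.
Qed.

Section MaxPoint.
Variables (R : realType) (A : comPzRingType) (W : wirtinger A).
Local Notation Re := complex.Re.
Local Notation Im := complex.Im.
Local Notation d := (dz W).
Local Notation db := (dzb W).
Local Notation c := (cj W).
Variable ev : {rmorphism A -> R[i]}.
Hypothesis evc : forall a, ev (c a) = conjc (ev a).

Lemma real_value a : c a = a -> ev a = (Re (ev a))%:C%C.
Proof.
move=> ra; have := congr1 (fun b => Im (ev b)) ra; rewrite evc.
by case: (ev a) => s t /= e; congr Complex; lra.
Qed.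

Variables (a lam be ex : A).
Hypotheses (ra : c a = a) (rl : c lam = lam) (rb : c be = be) (re : c ex = ex).
Hypotheses (ea : d (db a) = - lam * a) (de : d ex = ex * d be).
Hypothesis exp0 : 0 < Re (ev ex).
Variable S : A.
Hypothesis SE : S = a * a + d a * db a.
Hypotheses (h1 : ev (d (S * ex)) = 0) (h2 : Re (ev (d (db (S * ex)))) <= 0).

(** Divided by the exponential, the first-order condition reads S_z = - S beta_z. With the equation
    for a, everything is then expressed by the values of a, a_z, a_zz, lam, lam_z and beta, as in
    [weighted_max_bound]. *)
Lemma max_point_bound (L B : R) : 0 < Re (ev S) -> 0 <= L -> 0 <= B ->
  - L <= Re (ev lam) <= L -> Re (ev (d lam * db lam)) <= L ^+ 2 ->
  Re (ev (d be * db be)) <= B ^+ 2 ->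
  Re (ev (d (db be))) <= (2 + L) * B + (5 * L + 2).
Proof.
move=> S0 L0 B0 hl hm hb.
have cda : c (d a) = db a by rewrite cj_dz ra.
have cdb : c (db a) = d a by rewrite cj_dzb ra.
have rS : c S = S by rewrite SE rmorphD !rmorphM cda cdb ra; ring.
have eab : db (d a) = - lam * a by rewrite -dz_dzb.
have dbe : db ex = ex * db be by rewrite /dzb re de rmorphM re rb.
have dS : d S = d (d a) * db a + (2 - lam) * a * d a.
  by rewrite SE dzD !dzM ea; ring.
have dbS : db S = d a * db (db a) + (2 - lam) * a * db a.
  by rewrite SE dzbD !dzbM eab; ring.
have ddbS : d (db S) = d (d a) * db (db a) + (2 - 2 * lam) * (d a * db a)
    + (lam * lam - 2 * lam) * (a * a) - (a * (d lam * db a) + a * (db lam * d a)).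
  have e2 : d (db (db a)) = - (db lam * a + lam * db a).
    by rewrite dz_dzb ea dzbM dzbN; ring.
  have d2 : d 2 = 0 by rewrite dzD dz1 addr0.
  by rewrite dbS dzD !dzM dzD dzN d2 ea e2; ring.
have e0 : ev ex != 0.
  by rewrite (real_value re); apply/eqP => -[] e; move: exp0; rewrite e ltxx.
have h1' : ev (d S) + ev S * ev (d be) = 0.
  have h1e := h1; rewrite dzM de in h1e; apply/(mulIf e0); rewrite mul0r -[RHS]h1e.
  by rewrite rmorphD !rmorphM; ring.
(* The two mixed products S_z beta_zbar and S_zbar beta_z each become - S |beta_z|^2 by the
   first-order condition, and + S |beta_z|^2 comes from the exponential. *)
have h2' : Re (ev ex * (ev (d (db S)) - ev S * (ev (d be) * ev (db be))
     + ev S * ev (d (db be)))) <= 0.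
  move: h2; congr (Re _ <= 0); rewrite dzbM dbe dzD !dzM de !(rmorphD, rmorphM).
  have h3 : ev (db S) = - (ev S * ev (db be)).
    have hc (x y z : R[i]) : conjc (x + y * z) = conjc x + conjc y * conjc z.
      by rewrite rmorphD rmorphM.
    have := congr1 conjc h1'; rewrite hc conjc0 -!evc cj_dz rS cj_dz rb.
    by move=> /eqP; rewrite addr_eq0 => /eqP.
  have h4 : ev (d S) = - (ev S * ev (d be)).
    by move/eqP: h1'; rewrite addr_eq0 => /eqP.
  by rewrite h3 h4; ring.
have vdb b : c b = b -> ev (db b) = conjc (ev (d b)).
  by move=> rb'; rewrite -evc cj_dz rb'.
have vdbdb : ev (db (db a)) = conjc (ev (d (d a))).
  by rewrite -evc cj_dz cda.
have rddb : c (d (db be)) = d (db be) by rewrite cj_dz cj_dzb rb -dz_dzb.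
move: h1' h2' S0 hl hm hb exp0; rewrite ddbS dS SE.
rewrite !(rmorphD, rmorphN, rmorphM, rmorph1) vdbdb !vdb //.
rewrite (real_value ra) (real_value rl) (real_value re) (real_value rddb).
move: (Re (ev a)) (Re (ev lam)) (Re (ev ex)) (Re (ev (d (db be)))) => u l x t.
case: (ev (d a)) (ev (d (d a))) (ev (d lam)) (ev (d be)).
move=> p1 p2 [q1 q2] [m1 m2] [b1 b2].
have -> : (1 : R[i]) = Complex 1 0 by [].
move=> /eqP; rewrite eq_complex /= => /andP[/eqP h1r /eqP h1i] h2r Sp hl hm hb x0.
apply: (@weighted_max_bound _ u p1 p2 q1 q2 l m1 m2 b1 b2 t L B) => //.
- by move: Sp; congr (_ < _); ring.
- by move: hm; congr (_ <= _); ring.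
- by move: hb; congr (_ <= _); ring.
- by apply/eqP; rewrite -subr_eq0 -h1r; apply/eqP; ring.
- by apply/eqP; rewrite -subr_eq0 -h1i; apply/eqP; ring.
rewrite -(pmulr_rle0 _ x0); move: h2r; congr (_ <= _); ring.
Qed.

End MaxPoint.

(** The gradient is included so that the terms in |beta_z|^2 cancel in [weighted_max_bound]; with
    a^2 alone, half of them would remain and no weight of the form used below would be steep
    enough. *)
Definition energy (A : comPzRingType) (W : wirtinger A) (a : A) : A :=
  a * a + dz W a * dzb W a.

Lemma cj_energy (A : comPzRingType) (W : wirtinger A) (a : A) :
  cj W a = a -> cj W (energy W a) = energy W a.
Proof.
by move=> ra; rewrite /energy rmorphD !rmorphM cj_dz cj_dzb ra; ring.
Qed.

Lemma energy_value (R : realType) (A : comPzRingType) (W : wirtinger A)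
    (ev : {rmorphism A -> R[i]}) (a : A) :
  (forall b, ev (cj W b) = conjc (ev b)) -> cj W a = a ->
  complex.Re (ev (energy W a)) = complex.Re (ev a) ^+ 2
    + (complex.Re (ev (dz W a)) ^+ 2 + complex.Im (ev (dz W a)) ^+ 2).
Proof.
move=> evc ra; rewrite /energy (_ : dzb W a = cj W (dz W a)); last by rewrite cj_dz ra.
rewrite rmorphD !rmorphM evc (real_value evc ra) /=.
by case: (ev (dz W a)) => s t /=; ring.
Qed.

(** * Euclidean discs and annuli *)

Section Disc.
Variable R : realType.
Local Notation E := 'rV[R]_2.
Implicit Types (x y z : E) (r : R).

(** The norm of row vectors is the maximum norm, whereas the weight needs a smooth radial function;
    [dist2_norm] and [norm_dist2] compare the two. *)
Definition dist2 z y : R := (y 0 0 - z 0 0) ^+ 2 + (y 0 1 - z 0 1) ^+ 2.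

Lemma norm_coord (v : E) k : `|v 0 k| <= `|v|.
Proof.
rewrite [leRHS]/Num.norm /= mx_normrE; apply: (le_bigmax _ (fun ij => `|v ij.1 ij.2|) (0, k)).
Qed.

Lemma norm_lt (v : E) r : `|v 0 0| < r -> `|v 0 1| < r -> `|v| < r.
Proof.
move=> v0 v1; have r0 : 0 < r by apply: le_lt_trans v0.
rewrite [ltLHS]/Num.norm /= mx_normrE; apply: bigmax_lt => // -[i k] _ /=.
rewrite ord1; case: k => -[|[|k]] // hk.
  by rewrite (_ : Ordinal hk = 0) //; apply: val_inj.
by rewrite (_ : Ordinal hk = 1) //; apply: val_inj.
Qed.

Lemma dist2_norm z y r : 0 < r -> dist2 z y < r ^+ 2 -> `|y - z| < r.
Proof.
move=> r0 h.
have s0 (s t : R) : s ^+ 2 + t ^+ 2 < r ^+ 2 -> `|s| < r.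
  move=> st; rewrite -(gtr0_norm r0) -ltr_sqr ?nnegrE // !real_normK ?num_real //.
  by apply: le_lt_trans st; rewrite lerDl sqr_ge0.
apply: norm_lt; rewrite !mxE; first exact: s0 h.
by apply: (s0 _ (y 0 0 - z 0 0)); rewrite [ltLHS]addrC; exact: h.
Qed.

Lemma norm_dist2 z y r : `|y - z| < r -> dist2 z y < 2 * r ^+ 2.
Proof.
move=> h; have := le_lt_trans (norm_coord _ 0) h; have := le_lt_trans (norm_coord _ 1) h.
rewrite !mxE => h1 h0.
have s0 (s : R) : `|s| < r -> s ^+ 2 < r ^+ 2.
  by move=> sr; rewrite -(real_normK (num_real s)) ltr_sqr ?nnegrE // (le_trans _ (ltW sr)).
by rewrite mulr_natl mulr2n /dist2 ltrD // s0.
Qed.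

Lemma dist2_continuous z : continuous (dist2 z).
Proof.
have oT := @openT E; pose F := Domain oT.
have cc k (t : R) n : Ck n (dom F) (fun y : E => y 0 k - t).
  exact (CkD oT (@smooth_coord R F k n) (Ck_cst oT n (- t))).
have s : smooth_real F (dist2 z).
  move=> n; apply: (Ck_eq oT _ (CkD oT (CkM oT (cc 0 (z 0 0) n) (cc 0 (z 0 0) n))
                            (CkM oT (cc 1 (z 0 1) n) (cc 1 (z 0 1) n)))) => y _.
  by rewrite /dist2 !expr2.
by move=> y; exact: (smooth_real_continuous s).
Qed.

Lemma near_norm_lt z x r : `|x - z| < r -> \forall y \near x, `|y - z| < r.
Proof.
move=> h; apply/nbhs_ballP; exists (r - `|x - z|); first by rewrite /= subr_gt0.
move=> y; rewrite -ball_normE /ball_ /= distrC => xy.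
have -> : y - z = (y - x) + (x - z) by rewrite addrA subrK.
by apply: le_lt_trans (ler_normD _ _) _; rewrite -ltrBrDr.
Qed.

Definition annulus z (s t : R) : set E := [set y | s <= dist2 z y <= t].

Lemma annulus_compact z s t : compact (annulus z s t).
Proof.
apply: bounded_closed_compact.
  have bd y : annulus z s t y -> `|y| <= `|z| + (`|t| + 1).
    move=> /andP[_ yt]; rewrite -lerBlDl.
    have h : dist2 z y < (`|t| + 1) ^+ 2.
      apply: le_lt_trans yt _; rewrite (le_lt_trans (ler_norm t)) //.
      by rewrite sqrrD1 -addrA ltr_wpDl ?sqr_ge0 // mulr2n -addrA ltrDl ltr_wpDl.
    apply: le_trans (ltW (dist2_norm _ h)); last by rewrite ltr_wpDl.
    exact: lerB_dist.
  exists (`|z| + (`|t| + 1)); split; first exact: num_real.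
  by move=> M hM y /bd /le_trans; apply; exact: ltW.
have -> : annulus z s t = (dist2 z) @^-1` [set u | s <= u] `&` (dist2 z) @^-1` [set u | u <= t].
  by apply/seteqP; split => y /=; [move=> /andP | move=> h; apply/andP].
apply: closedI; apply: preimage_closed => //;
  by [exact: closed_ge | exact: closed_le | move=> y _; exact: dist2_continuous | exact: dist2_continuous].
Qed.

End Disc.

(* z is a coordinate function centred at the origin. *)
Lemma weight_derivatives (A : comPzRingType) (W : wirtinger A) (z N q : A) j :
  let zb := cj W z in let zeta := q - z * zb in
  let be := N * zeta ^+ j.+2 in
  dz W z = 1 -> dzb W z = 0 -> dz W N = 0 -> dzb W N = 0 -> dz W q = 0 -> dzb W q = 0 ->
  [/\ dz W be = - (N * j.+2%:R * zeta ^+ j.+1 * zb),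
      dzb W be = - (N * j.+2%:R * zeta ^+ j.+1 * z) &
      dz W (dzb W be) = N * j.+2%:R * zeta ^+ j * (j.+1%:R * (z * zb) - zeta)].
Proof.
move=> zb zeta be z1 z0 N0 Nb0 q0 qb0.
have zb0 : dz W zb = 0 by rewrite /zb -cj_dzb z0 rmorph0.
have zb1 : dzb W zb = 1 by rewrite /zb -cj_dz z1 rmorph1.
have dzeta : dz W zeta = - zb by rewrite /zeta dzD dzN dzM q0 z1 zb0; ring.
have dbzeta : dzb W zeta = - z by rewrite /zeta dzbD dzbN dzbM qb0 z0 zb1; ring.
clearbody zeta.
have dbX n : dzb W (zeta ^+ n.+1) = n.+1%:R * zeta ^+ n * dzb W zeta.
  elim: n => [|n IH]; first by rewrite expr1 expr0; ring.
  by rewrite exprS dzbM {}IH !exprS [n.+2%:R]mulrS; ring.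
have dbbe : dzb W be = - (N * j.+2%:R * zeta ^+ j.+1 * z).
  by rewrite /be dzbM dbX Nb0 dbzeta; ring.
split=> //; first by rewrite /be dzM dzX N0 dzeta; ring.
have dn n : dz W n%:R = 0.
  by elim: n => [|n IH]; rewrite ?dz0 // mulrS dzD dz1 add0r IH.
by rewrite dbbe dzN !dzM dzX dn N0 z1 dzeta exprS; ring.
Qed.

Section LocalUniqueContinuation.
Variables (R : realType) (V : domain R).
Local Notation E := 'rV[R]_2.
Local Notation Re := complex.Re.
Local Notation A := (smooth_fun V).
Local Notation W := (smooth_wirtinger V).
Local Notation d := (dz W).
Local Notation db := (dzb W).
Local Notation c := (cj W).

Lemma annulus_bound (b : A) z s t : (forall y, annulus z s t y -> dom V y) ->
  exists2 M, 0 <= M & forall y, annulus z s t y -> `|Re (extend b y)| <= M.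
Proof.
move=> KV; have [br _] := smooth_valP b.
have [[y0 y0K]|K0] := pselect (annulus z s t !=set0); last first.
  by exists 0 => // y yK; case: K0; exists y.
have cw : {within annulus z s t, continuous (fun y => `|Re (extend b y)|)}.
  apply: continuous_in_subspaceT => y; rewrite inE => yK.
  apply: (@continuous_comp _ _ _ (fun y => Re (extend b y)) (fun u : R => `|u|)).
    exact: smooth_real_continuous br (KV y yK).
  exact: norm_continuous.
have [x xK mx] := EVT_max_rV (ex_intro _ y0 y0K) (@annulus_compact R z s t) cw.
exists `|Re (extend b x)| => // y yK; apply: mx; exact/mem_set.
Qed.

Lemma deriv_of_near_zero (a : A) p : c a = a ->
  (\forall y \near sval p, extend a y = 0) -> ev p a = 0 /\ ev p (d a) = 0.
Proof.
move=> ra a0; have ap : ev p a = 0 by rewrite -extend_ev; exact: nbhs_singleton a0.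
split=> //; apply: (proj1 (cj_local_max ra _)).
by apply: filterS a0 => y ->; rewrite ap.
Qed.

Lemma bracket_ge1 (s t u v x : R) : s <= t -> u + 1 <= s -> (1 + v) * x <= u ->
  1 <= t - x - v * x.
Proof. by rewrite mulrDl mul1r; lra. Qed.

(* Otherwise (|a|^2 + |a_z|^2) exp (N (8 r^2 - |y - z|^2)^(j+2)) has a positive
   interior maximum in the annulus e^2/4 <= |y - z|^2 <= 4 r^2: N is chosen so that
   it is larger at some point than on the outer circle, and j so that the weight
   violates weighted_max_bound. *)
Lemma local_unique_continuation (a lam : A) (x0 z : E) (r e : R) :
  c a = a -> c lam = lam -> d (db a) = - lam * a ->
  0 < r -> (forall y, `|y - x0| < 4 * r -> dom V y) -> `|z - x0| < r ->
  0 < e -> (forall y, `|y - z| < e -> extend a y = 0) ->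
  \forall y \near x0, extend a y = 0.
Proof.
move=> ra rl ea r0 hV zx e0 az.
(* The disc of radius 2 r about z lies within 3 r + r = 4 r of x0. It also contains x0 in its
   interior, since the maximum norm of z - x0 is below r and so [dist2 z x0] is below 2 r^2. *)
have dV y : dist2 z y <= 4 * r ^+ 2 -> dom V y.
  move=> h; apply: hV; have h3 : `|y - z| < 3 * r.
    apply: dist2_norm; first by rewrite mulr_gt0.
    apply: le_lt_trans h _; rewrite exprMn ltr_pM2r ?exprn_gt0 // -natrX ltr_nat //.
  have -> : y - x0 = (y - z) + (z - x0) by rewrite addrA subrK.
  apply: le_lt_trans (ler_normD _ _) _; have -> : 4 * r = 3 * r + r by ring.
  exact: ltrD.
suff main y : dist2 z y < 4 * r ^+ 2 -> extend a y = 0.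
  have x0z : dist2 z x0 < 4 * r ^+ 2.
    apply: lt_trans (norm_dist2 (r := r) _) _; first by rewrite distrC.
    by rewrite ltr_pM2r ?exprn_gt0 // ltr_nat.
  have op : open (dist2 z @^-1` [set u | u < 4 * r ^+ 2]).
    apply: open_comp; last exact: open_lt.
    by move=> y' _; exact: dist2_continuous.
  by have := open_nbhs_nbhs (conj op x0z); apply: filterS.
move=> yz; apply: contrapT => ay.
(* The inner radius e / 2 is inside the disc where a vanishes, so a positive maximum cannot lie on
   the inner circle. *)
pose s := e ^+ 2 / 4; pose K := annulus z s (4 * r ^+ 2).
have KV y' : K y' -> dom V y' by move=> /andP[_ /dV].
have s0 : 0 < s by rewrite divr_gt0 // exprn_gt0.
have se : s < e ^+ 2 by rewrite ltr_pdivrMr // ltr_pMr ?exprn_gt0 // ltr1n.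
have Vy : dom V y by apply: dV; exact: ltW.
pose S : A := energy W a; have rS : c S = S := cj_energy ra.
have evS p : Re (ev p S) = Re (ev p a) ^+ 2 + (Re (ev p (d a)) ^+ 2 + complex.Im (ev p (d a)) ^+ 2).
  exact: (energy_value (ev := ev p) (ev_cjE p) ra).
have S0 p : 0 <= Re (ev p S) by rewrite evS !addr_ge0 // sqr_ge0.
have Sy : 0 < Re (extend S y).
  rewrite (extend_ev (exist _ y Vy)) evS ltr_pwDl ?addr_ge0 ?sqr_ge0 //.
  rewrite lt0r sqr_ge0 andbT sqrf_eq0; apply: contra_notN ay => /eqP h.
  by rewrite (extend_ev (exist _ y Vy)) (ev_real _ ra) h.
have Sz p : `|sval p - z| < e -> Re (ev p S) = 0.
  move=> pz; have [] := @deriv_of_near_zero a p ra.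
    by have := near_norm_lt pz; apply: filterS => u; exact: az.
  by move=> h1 h2; rewrite evS h1 h2 /=; ring.
have Sz' y' : dom V y' -> 0 < Re (extend S y') -> e ^+ 2 <= dist2 z y'.
  move=> Vy' h; rewrite leNgt; apply/negP => /(dist2_norm e0) h'.
  by move: h; rewrite (extend_ev (exist _ y' Vy')) Sz // ltxx.
have Ky : K y.
  rewrite /K /annulus /= (ltW yz) andbT; apply: le_trans (ltW se) _; exact: Sz'.
have [M1 M10 hM1] := annulus_bound lam KV.
have [M2 M20 hM2] := annulus_bound (d lam * db lam) KV.
have [MS MS0 hMS] := annulus_bound S KV.
(* M2 bounds |lam_z|^2; the summand 1 gives L <= L^2, hence also M2 <= L^2. *)
pose L : R := M1 + M2 + 1; have L0 : 0 <= L by rewrite !addr_ge0.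
(* Twice the squared outer radius, which keeps zeta = q - |y - z|^2 at least 4 r^2 on the
   annulus. *)
pose q := 8 * r ^+ 2; have r20 : 0 < r ^+ 2 by rewrite exprn_gt0.
(* The exponent enters beta_(z zbar) quadratically but beta_z only linearly, so a large j defeats a
   bound that is linear in |beta_z|. The precise value is what [bracket] needs, where |x - z|^2 >=
   e^2. *)
pose j := Num.truncn ((q * (1 + (2 * r) * (2 + L)) + 1) / e ^+ 2).
have hj : q * (1 + (2 * r) * (2 + L)) + 1 <= j.+1%:R * e ^+ 2.
  by rewrite -ler_pdivrMr ?exprn_gt0 // ltW // truncnS_gt.
pose ze y' := q - dist2 z y'.
have ze1 y' : K y' -> 4 * r ^+ 2 <= ze y' <= q.
  move=> /andP[h1 h2]; rewrite /ze /q lerBrDl; apply/andP; split.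
    by have := h2; lra.
  by rewrite gerBl (le_trans (ltW s0)).
pose c0 := ze y ^+ j.+2 - (4 * r ^+ 2) ^+ j.+2.
have c00 : 0 < c0.
  have h1 : 4 * r ^+ 2 < ze y by rewrite /ze /q; have := yz; lra.
  have h2 : 0 <= 4 * r ^+ 2 by rewrite mulr_ge0 // ltW.
  by rewrite subr_gt0 ltr_pXn2r ?nnegrE ?(le_trans h2 (ltW h1)).
(* The first summands are for the constant 5 L + 2 in the interior, the last one excludes a maximum
   on the outer circle. *)
pose N := (5 * L + 2) / (4 * r ^+ 2) ^+ j + 1 + MS / (Re (extend S y) * c0).
have N1 : (5 * L + 2) / (4 * r ^+ 2) ^+ j < N.
  by rewrite /N -addrA ltrDl ltr_pwDl // divr_ge0 // mulr_ge0 // ltW.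
have N2 : MS / (Re (extend S y) * c0) <= N.
  rewrite /N lerDr addr_ge0 // divr_ge0 //; first by rewrite addr_ge0 // mulr_ge0.
  by rewrite exprn_ge0 // mulr_ge0 // ltW.
have N0 : 0 <= N by apply: (le_trans _ N2); rewrite divr_ge0 // mulr_ge0 // ltW.
pose zc : A := coord V - const V (Complex (z 0 0) (z 0 1)).
have zcE p : ev p (zc * c zc) = (dist2 z (sval p))%:C%C.
  rewrite evM ev_cjE /zc evD evN ev_const /coord ev_lift /dist2.
  by apply/eqP; rewrite eq_complex /=; apply/andP; split; apply/eqP; ring.
pose zeta : A := const V q%:C%C - zc * c zc.
have zetaE p : ev p zeta = (ze (sval p))%:C%C.
  by rewrite /zeta evD evN ev_const zcE -rmorphB.
pose be : A := const V N%:C%C * zeta ^+ j.+2.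
have beE p : ev p be = (N * ze (sval p) ^+ j.+2)%:C%C.
  by rewrite /be evM ev_const rmorphXn /= zetaE -rmorphXn -rmorphM.
have rr p b t : ev p b = (t : R)%:C%C -> conjc (ev p b) = ev p b.
  by move=> ->; rewrite conjc_real.
have rbe : c be = be by apply: smooth_evP => p; rewrite ev_cjE (rr _ _ _ _ (beE p)).
have [ex [rex exE dex]] := cj_exp rbe.
have extM y' : dom V y' -> Re (extend (S * ex) y') = Re (extend S y') * expR (N * ze y' ^+ j.+2).
  move=> h; rewrite !(extend_ev (exist _ y' h)) evM exE beE /=.
  by case: (ev _ S) => s1 t1 /=; rewrite mulr0 subr0.
have cf : {within K, continuous (fun y => Re (extend (S * ex) y))}.
  have [sr _] := smooth_valP (S * ex).
  apply: continuous_in_subspaceT => y'; rewrite inE => /KV Vy'.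
  exact: smooth_real_continuous sr Vy'.
have [x xK mx] := EVT_max_rV (ex_intro _ y Ky) (@annulus_compact R z s (4 * r ^+ 2)) cf.
move: xK; rewrite inE => xK; have Vx := KV _ xK.
have fy : 0 < Re (extend (S * ex) y) by rewrite extM // mulr_gt0 // expR_gt0.
have fxy : Re (extend (S * ex) y) <= Re (extend (S * ex) x) by apply: mx; exact/mem_set.
have fx : 0 < Re (extend S x).
  by have := lt_le_trans fy fxy; rewrite extM // pmulr_lgt0 // expR_gt0.
(* On the outer circle, maximality would give S(y) exp(N c0) <= MS, against exp(N c0) >= 1 + N c0
   and MS <= S(y) N c0. *)
case/andP: (xK) => x1; rewrite le_eqVlt => /orP[/eqP x2|x2].
  have : Re (extend S y) * expR (N * c0) <= MS.
    move: fxy; rewrite !extM // {2}/ze x2.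
    have -> : q - 4 * r ^+ 2 = 4 * r ^+ 2 by rewrite /q; ring.
    have -> : N * ze y ^+ j.+2 = N * c0 + N * (4 * r ^+ 2) ^+ j.+2 by rewrite /c0; ring.
    rewrite expRD mulrA ler_pM2r ?expR_gt0 // => h; apply: le_trans h _.
    by apply: le_trans (ler_norm _) (hMS _ xK).
  have : Re (extend S y) * (1 + N * c0) <= Re (extend S y) * expR (N * c0).
    by rewrite ler_pM2l // expR_ge1Dx.
  move=> h1 h2; have h12 := le_trans h1 h2.
  have : MS <= Re (extend S y) * (N * c0).
    by move: N2; rewrite ler_pdivrMr ?mulr_gt0 // => h; apply: le_trans h _; rewrite mulrCA.
  move: h12 Sy; clearbody N c0; set X := Re (extend S y); clearbody X.
  by rewrite mulrDr mulr1; lra.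
pose p : point V := exist _ x Vx.
have hx : e ^+ 2 <= dist2 z x by exact: Sz'.
have mxn : \forall y' \near sval p, Re (extend (S * ex) y') <= Re (ev p (S * ex)).
  have op : open (dist2 z @^-1` [set u | s < u] `&` dist2 z @^-1` [set u | u < 4 * r ^+ 2]).
    by apply: openI; apply: open_comp; try exact: open_lt; try exact: open_gt;
      move=> u _; exact: dist2_continuous.
  have px : (dist2 z @^-1` [set u | s < u] `&` dist2 z @^-1` [set u | u < 4 * r ^+ 2]) x.
    by split=> //=; exact: lt_le_trans se hx.
  have := open_nbhs_nbhs (conj op px); apply: filterS => u [u1 u2].
  by rewrite -extend_ev; apply: mx; rewrite inE /annulus /= !ltW.
have rSe : c (S * ex) = S * ex by rewrite (rmorphM (cj W)) rS rex.
have [m1 m2] := cj_local_max rSe mxn.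
have [w1 w2 w3] : [/\ d be = - (const V N%:C%C * j.+2%:R * zeta ^+ j.+1 * c zc),
      db be = - (const V N%:C%C * j.+2%:R * zeta ^+ j.+1 * zc) &
      d (db be) = const V N%:C%C * j.+2%:R * zeta ^+ j * (j.+1%:R * (zc * c zc) - zeta)].
  have dbc t : db (const V t) = 0 by rewrite /dzb cj_dom_const dz_const rmorph0.
  apply: weight_derivatives; rewrite ?dz_const ?dbc //.
    by rewrite dzD dzN dz_const dz_coord oppr0 addr0.
  by rewrite dzbD dzbN dbc dzb_coord oppr0 addr0.
(* An upper bound for |beta_z| at x, where |x - z| < 2 r. *)
pose B := 2 * r * (N * j.+2%:R * ze x ^+ j.+1).
have zex : 4 * r ^+ 2 <= ze x <= q by exact: ze1.
have zx0 : 0 < ze x by apply: (lt_le_trans _ (proj1 (andP zex))); rewrite mulr_gt0.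
have B0 : 0 <= B by rewrite /B !mulr_ge0 ?exprn_ge0 // ltW.
have nE n : ev p n%:R = (n%:R : R)%:C%C by rewrite !rmorph_nat.
have zX n : ev p (zeta ^+ n) = (ze x ^+ n)%:C%C by rewrite rmorphXn /= zetaE -rmorphXn.
have hb : Re (ev p (d be * db be)) <= B ^+ 2.
  have -> : d be * db be = (const V N%:C%C * j.+2%:R * zeta ^+ j.+1) *
      (const V N%:C%C * j.+2%:R * zeta ^+ j.+1) * (zc * c zc).
    by rewrite w1 w2; ring.
  rewrite !(evM _ (_ * _)) zcE !evM ev_const nE zX -!rmorphM /=.
  have -> : B ^+ 2 = N * j.+2%:R * ze x ^+ j.+1 * (N * j.+2%:R * ze x ^+ j.+1) * (4 * r ^+ 2).
    by rewrite /B; ring.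
  by apply: ler_wpM2l (ltW x2); rewrite -expr2 sqr_ge0.
have ht : Re (ev p (d (db be))) = N * j.+2%:R * ze x ^+ j * (j.+1%:R * dist2 z x - ze x).
  rewrite w3 (evM p (_ * _ * _)) (evD p (_ * _) (- zeta)) evN (evM p j.+1%:R) nE zcE zetaE.
  rewrite (evM p (_ * _)) (evM p _ j.+2%:R) ev_const nE zX.
  by rewrite -!rmorphM -rmorphB -!rmorphM.
have hl : - L <= Re (ev p lam) <= L.
  rewrite -ler_norml; apply: le_trans (_ : M1 <= L); last by rewrite /L -addrA lerDl addr_ge0.
  by have := hM1 _ xK; rewrite (extend_ev p).
have hm : Re (ev p (d lam * db lam)) <= L ^+ 2.
  have h : Re (ev p (d lam * db lam)) <= M2.
    by apply: le_trans (ler_norm _) _; have := hM2 _ xK; rewrite (extend_ev p).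
  apply: le_trans h _; have h1 : M2 <= L by rewrite /L -addrA addrCA lerDl addr_ge0.
  apply: le_trans h1 _; rewrite expr2 ler_peMl // /L lerDr addr_ge0 //.
have pex : 0 < Re (ev p ex) by rewrite exE /= expR_gt0.
have pS : 0 < Re (ev p S) by rewrite -extend_ev.
have := max_point_bound (ev := ev p) (ev_cjE p) ra rl rbe rex ea dex pex (erefl : S = _)
  m1 m2 pS L0 B0 hl hm hb.
rewrite ht leNgt => /negP; apply.
have C0 : 0 < (4 * r ^+ 2) ^+ j by rewrite exprn_gt0 // mulr_gt0.
have j1 : 1 <= j.+2%:R :> R by rewrite ler1n.
have zxj : (4 * r ^+ 2) ^+ j <= ze x ^+ j.
  apply: lerXn2r; rewrite ?nnegrE; last by case/andP: zex.
    by rewrite mulr_ge0 // ltW.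
  exact: ltW.
(* This is beta_(z zbar) - (2 + L) B with the factor N (j + 2) zeta^j removed. As that factor
   exceeds 5 L + 2, [max_point_bound] is contradicted. *)
have bracket : 1 <= j.+1%:R * dist2 z x - ze x - (2 * r * (2 + L)) * ze x.
  have h1 : j.+1%:R * e ^+ 2 <= j.+1%:R * dist2 z x by rewrite ler_wpM2l.
  have h2 : (1 + 2 * r * (2 + L)) * ze x <= q * (1 + 2 * r * (2 + L)).
    rewrite [leRHS]mulrC ler_wpM2l //; first by rewrite addr_ge0 // !mulr_ge0 ?addr_ge0 // ltW.
    by case/andP: zex.
  exact: bracket_ge1 h1 hj h2.
have P0 : 0 <= N * j.+2%:R * ze x ^+ j by rewrite !mulr_ge0 // exprn_ge0 // ltW.
have : N * j.+2%:R * ze x ^+ j * 1 <=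
   N * j.+2%:R * ze x ^+ j * (j.+1%:R * dist2 z x - ze x - (2 * r * (2 + L)) * ze x).
  by rewrite ler_wpM2l.
have : 5 * L + 2 < N * j.+2%:R * ze x ^+ j.
  have h : 5 * L + 2 < N * (4 * r ^+ 2) ^+ j by rewrite -ltr_pdivrMr.
  apply: lt_le_trans h _; rewrite -mulrA ler_wpM2l //.
  by apply: le_trans zxj _; rewrite ler_peMl // exprn_ge0 // ltW.
have -> : (2 + L) * B = N * j.+2%:R * ze x ^+ j * ((2 * r * (2 + L)) * ze x).
  by rewrite /B exprSr; ring.
move: (N * j.+2%:R * ze x ^+ j) => P h1 h2.
rewrite mulr1 in h2; apply: le_lt_trans (_ : _ <= P * ((2 * r * (2 + L)) * ze x) + (5 * L + 2)) _ => //.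
rewrite -ltrBrDl -mulrBr; apply: lt_le_trans h1 _; exact: h2.
Qed.


End LocalUniqueContinuation.

(** * Continuation over the connected surface *)

Section GlobalUniqueContinuation.
Variables (R : realType) (M : riemannSurface R).

Definition chart_domain (c : chart R M) : domain R := Domain (@chart_img_open _ _ c).

(* u solves u_(z zbar) = - lam u for some real lam depending on the chart. *)
Definition eigen_in_charts (u : M -> R) := forall c, atlas c ->
  exists a lam : smooth_fun (chart_domain c),
  let W := smooth_wirtinger (chart_domain c) in
  [/\ cj W a = a, cj W lam = lam, dz W (dzb W a) = - lam * a &
      forall x, chart_img c x -> extend a x = (u (of_coord c x))%:C%C].

(** The interior O of the zero set is open, nonempty and closed. For closedness, a ball of radius 4
    r around a limit point p is taken in a chart, and a point of O nearer than r to p serves as the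
    centre z of the local lemma. *)
Lemma unique_continuation (u : M -> R) (p0 : M) : eigen_in_charts u ->
  (\forall q \near p0, u q = 0) -> forall p, u p = 0.
Proof.
move=> hu hp0; pose O : set M := [set p | \forall q \near p, u q = 0].
have Oopen : open O.
  by rewrite (_ : O = interior [set q | u q = 0]) //; exact: open_interior.
have Oclosed : closed O.
  move=> p clp; have [c ac cp] := atlas_cover p.
  have [a [lam [ra rl ea av]]] := hu c ac.
  pose x0 := to_coord c p; have Vx0 : chart_img c x0 := to_coord_img cp.
  have [r' r'0 hr'] : exists2 r : R, 0 < r & forall y, `|y - x0| < r -> chart_img c y.
    by apply: near_norm_ball; have := open_nbhs_nbhs (conj (@chart_img_open _ _ c) Vx0).
  pose r := r' / 4; have r0 : 0 < r by rewrite divr_gt0.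
  have hr y : `|y - x0| < 4 * r -> dom (chart_domain c) y.
    by rewrite /r mulrC divfK ?pnatr_eq0 //; exact: hr'.
  have ct : {for p, continuous (to_coord c)} by exact: to_coord_continuous.
  have np : \forall q \near p, chart_dom c q /\ `|to_coord c q - x0| < r.
    apply: filterI.
      by have := open_nbhs_nbhs (conj (@chart_dom_open _ _ c) cp).
    move/cvgrPdist_lt: ct => /(_ r r0); apply: filterS => q.
    by rewrite distrC.
  have [q [Oq [cq qr]]] := clp _ np.
  pose z := to_coord c q; have Vz : chart_img c z := to_coord_img cq.
  have co : {for z, continuous (of_coord c)} by exact: of_coord_continuous.
  have Oz : \forall y \near z, u (of_coord c y) = 0.
    have Oq' : nbhs (of_coord c z) [set q' | u q' = 0] by rewrite to_coordK.
    exact: (co _ Oq').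
  have [e e0 he] : exists2 e : R, 0 < e & forall y, `|y - z| < e -> extend a y = 0.
    have nz : \forall y \near z, chart_img c y.
      by have := open_nbhs_nbhs (conj (@chart_img_open _ _ c) Vz).
    apply: near_norm_ball; apply: filterS2 nz Oz => y Vy uy.
    by rewrite av // uy.
  have nx := local_unique_continuation ra rl ea r0 hr qr e0 he.
  have nx' : \forall y \near x0, u (of_coord c y) = 0.
    have nz : \forall y \near x0, chart_img c y.
      by have := open_nbhs_nbhs (conj (@chart_img_open _ _ c) Vx0).
    by apply: filterS2 nz nx => y Vy; rewrite av // => -[].
  have ncp : \forall q \near p, u (of_coord c (to_coord c q)) = 0.
    exact: (ct [set x | u (of_coord c x) = 0] nx').
  by apply: filterS2 np ncp => q' [cq' _]; rewrite to_coordK.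
have OT : O = [set: M].
  apply: (@surface_connected _ M); first by exists p0.
    by exists O => //; rewrite setTI.
  by exists O => //; rewrite setTI.
move=> p; have Op : O p by rewrite OT.
exact: (nbhs_singleton Op).
Qed.

End GlobalUniqueContinuation.

(** * Higher fundamental forms *)

Section Perp.
Variable R : realType.

Lemma dotE m (u v : 'rV[R]_m) : dot u v = \sum_k u 0 k * v 0 k.
Proof. exact: bilE. Qed.

Lemma dot_eq0 m (u : 'rV[R]_m) : dot u u = 0 -> u = 0.
Proof.
rewrite dotE => /eqP; rewrite psumr_eq0 => [/allP h|k _]; last by rewrite -expr2 sqr_ge0.
apply/rowP => k; rewrite mxE; have := h k (mem_index_enum _).
by rewrite /= -expr2 sqrf_eq0 => /eqP.
Qed.

Lemma cap_perp k m (A : 'M[R]_(k, m)) : (kermx A^T :&: <<A>>)%MS = 0.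
Proof.
apply/eqP/rowV0P => v; rewrite sub_capmx genmxE => /andP[/sub_kermxP vA /submxP[w vE]].
by apply: dot_eq0; rewrite /dot {2}vE trmx_mul mulmxA vA mul0mx mxE.
Qed.

Lemma sum_perp k m (A : 'M[R]_(k, m)) (u : 'rV[R]_m) : (u <= kermx A^T + <<A>>)%MS.
Proof.
apply: submx_full; rewrite /row_full (mxrank_disjoint_sum (cap_perp A)).
by rewrite mxrank_ker mxrank_tr genmxE subnK // rank_leq_col.
Qed.

Lemma perp_ker k m (A : 'M[R]_(k, m)) u : perp A u *m A^T = 0.
Proof. by apply/sub_kermxP; rewrite /perp proj_mx_sub. Qed.

Lemma perp_compl k m (A : 'M[R]_(k, m)) u : (u - perp A u <= A)%MS.
Proof.
have e := add_proj_mx (cap_perp A) (sum_perp A u).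
rewrite -{1}e /perp addrC addKr; apply: submx_trans (proj_mx_sub _ _ _) _.
by rewrite genmxE.
Qed.

(** The characterization through which [perp] is computed: a vector orthogonal to A that differs
    from u by an element of A. *)
Lemma perp_unique k m (A : 'M[R]_(k, m)) u v :
  v *m A^T = 0 -> (u - v <= A)%MS -> perp A u = v.
Proof.
move=> vA uv; rewrite -[u](subrK v) /perp mulmxDl.
rewrite (proj_mx_0 (cap_perp A)) ?genmxE // add0r proj_mx_id ?cap_perp //.
exact/sub_kermxP.
Qed.

Lemma perp_orthogonal3 m (a b e xi : 'rV[R]_m) (E : R) :
  E != 0 -> dot a a = 1 -> dot b b = E -> dot e e = E ->
  dot b e = 0 -> dot b a = 0 -> dot e a = 0 ->
  perp (col_mx a (col_mx b e)) xi
  = xi - (dot xi a *: a + (dot xi b / E) *: b + (dot xi e / E) *: e).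
Proof.
move=> E0 aa bb ee be ba ea.
have dC (u v : 'rV[R]_m) : dot u v = dot v u by exact: bilC.
have dD (u v w : 'rV[R]_m) : dot (u + v) w = dot u w + dot v w by exact: bilDl.
have dZ t (u w : 'rV[R]_m) : dot (t *: u) w = t * dot u w by exact: bilZl.
have dN (u w : 'rV[R]_m) : dot (- u) w = - dot u w by exact: bilNl.
have z (u w : 'rV[R]_m) : dot u w = 0 -> u *m w^T = 0.
  by move=> h; apply/matrixP => i j; rewrite !ord1 [RHS]mxE; exact: h.
apply: perp_unique; last first.
  rewrite opprB addrC subrK.
  have sa : (a <= col_mx a (col_mx b e))%MS by rewrite -addsmxE addsmxSl.
  have sbe : (col_mx b e <= col_mx a (col_mx b e))%MS by rewrite -(addsmxE _ (col_mx b e)) addsmxSr.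
  have sb : (b <= col_mx b e)%MS by rewrite -addsmxE addsmxSl.
  have se : (e <= col_mx b e)%MS by rewrite -addsmxE addsmxSr.
  apply: addmx_sub; first apply: addmx_sub; apply: scalemx_sub => //.
    exact: submx_trans sb sbe.
  exact: submx_trans se sbe.
rewrite !tr_col_mx !mul_mx_row; set v := xi - _.
have -> : v *m a^T = 0.
  by apply: z; rewrite /v !(dD, dN, dZ) aa ba ea; ring.
have -> : v *m b^T = 0.
  by apply: z; rewrite /v !(dD, dN, dZ) bb (dC a) ba (dC e) be; field.
have -> : v *m e^T = 0.
  by apply: z; rewrite /v !(dD, dN, dZ) ee (dC a) ea be; field.
by rewrite !row_mx0.
Qed.

Lemma perp_orthogonal3_coord m (a b e xi : 'rV[R]_m) (E : R) k :
  E != 0 -> dot a a = 1 -> dot b b = E -> dot e e = E ->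
  dot b e = 0 -> dot b a = 0 -> dot e a = 0 ->
  xi 0 k - (dot xi a * a 0 k + E^-1 * (dot xi b * b 0 k) + E^-1 * (dot xi e * e 0 k))
  = perp (col_mx a (col_mx b e)) xi 0 k.
Proof.
move=> E0 aa bb ee be ba ea; rewrite (perp_orthogonal3 xi E0) // !mxE.
by field.
Qed.

End Perp.

Lemma real_complex_comb (R : realType) (h0 d0 f0 dx x dy y t : R) :
  h0%:C%C - (d0%:C%C * f0%:C%C + t%:C%C * (dx%:C%C * x%:C%C) + t%:C%C * (dy%:C%C * y%:C%C))
  = (h0 - (d0 * f0 + t * (dx * x) + t * (dy * y)))%:C%C.
Proof. by rewrite -!rmorphM -!rmorphD -rmorphB. Qed.

(** * Real vector functions as vectors over the ring *)

Section Lifts.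
Variables (R : realType) (V : domain R).
Local Notation E := 'rV[R]_2.
Local Notation Re := complex.Re.
Local Notation A := (smooth_fun V).
Local Notation W := (smooth_wirtinger V).

Definition lifts m (H : E -> 'rV[R]_m) (L : 'rV[A]_m) :=
  forall (p : point V) k, ev p (L 0 k) = (H (sval p) 0 k)%:C%C.

Definition coord_smooth m (H : E -> 'rV[R]_m) := forall k, smooth_real V (fun x => H x 0 k).

Definition lift_row m (H : E -> 'rV[R]_m) (hH : coord_smooth H) : 'rV[A]_m :=
  \row_k of_real (hH k).

Lemma lift_rowP m (H : E -> 'rV[R]_m) (hH : coord_smooth H) : lifts H (lift_row hH).
Proof. by move=> p k; rewrite mxE ev_of_real. Qed.

Lemma lifts_unique m (H : E -> 'rV[R]_m) L L' : lifts H L -> lifts H L' -> L = L'.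
Proof. by move=> h h'; apply/rowP => k; apply: smooth_evP => p; rewrite h h'. Qed.

Lemma lifts_eq m (H H' : E -> 'rV[R]_m) L : (forall x, dom V x -> H x = H' x) ->
  lifts H L -> lifts H' L.
Proof. by move=> e h p k; rewrite h e //; exact: svalP. Qed.

Lemma lifts_coord_smooth m (H : E -> 'rV[R]_m) L : lifts H L -> coord_smooth H.
Proof.
move=> h k j; have [ar _] := smooth_valP (L 0 k).
apply: (Ck_eq (@dom_open R V) _ (ar j)) => x Vx.
by rewrite (extend_ev (exist _ x Vx)) h.
Qed.

Lemma coord_derivable m (H : E -> 'rV[R]_m) x v : coord_smooth H -> dom V x ->
  derivable H x v.
Proof.
move=> hH Vx; apply/derivable_mxP => i k; rewrite ord1.
exact: (smooth_derivable (hH k) Vx).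
Qed.

Lemma coord_derive m (H : E -> 'rV[R]_m) x v k : coord_smooth H -> dom V x ->
  'D_v H x 0 k = 'D_v (fun y => H y 0 k) x.
Proof.
move=> hH Vx; have e := derive_mx (coord_derivable (v := v) hH Vx).
by have := congr1 (fun M : 'rV_m => M 0 k) e; rewrite mxE.
Qed.

Lemma lifts_derive m (H : E -> 'rV[R]_m) L v : lifts H L -> lifts ('D_v H) (map_mx (pd v) L).
Proof.
move=> h; have hH := lifts_coord_smooth h.
rewrite (lifts_unique h (lift_rowP hH)) => p k.
by rewrite !mxE ev_pd_of_real (coord_derive v k hH (svalP p)).
Qed.

Lemma lifts_cj m (H : E -> 'rV[R]_m) L : lifts H L -> vc W L = L.
Proof.
move=> h; rewrite (lifts_unique h (lift_rowP (lifts_coord_smooth h))).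
by apply/rowP => k; rewrite !mxE cj_dom_of_real.
Qed.

Lemma cj_lifts m (L : 'rV[A]_m) : vc W L = L ->
  lifts (fun x => \row_k Re (extend (L 0 k) x)) L.
Proof.
move=> rL p k; rewrite mxE extend_ev; apply: ev_real.
by have := congr1 (fun M : 'rV_m => M 0 k) rL; rewrite mxE.
Qed.

Lemma ev_bil p m (L L' : 'rV[A]_m) :
  ev p (bil L L') = \sum_k ev p (L 0 k) * ev p (L' 0 k).
Proof. by rewrite bilE rmorph_sum. Qed.

Lemma lifts_bil m (H H' : E -> 'rV[R]_m) L L' p : lifts H L -> lifts H' L' ->
  ev p (bil L L') = (dot (H (sval p)) (H' (sval p)))%:C%C.
Proof.
move=> h h'; rewrite ev_bil dotE rmorph_sum; apply: eq_bigr => k _.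
by rewrite h h' rmorphM.
Qed.

Lemma smooth_at_coord m (F : E -> 'rV[R]_m.+1) :
  (forall x, dom V x -> smooth_at F x) -> coord_smooth F.
Proof.
move=> hF k j; suff h w : Ck j (dom V) (fun x => iter_derive F w x 0 k) by exact: (h [::]).
have dcomp w' x : dom V x -> differentiable (fun y => iter_derive F w' y 0 k) x.
  move=> Vx; apply: (@differentiable_comp _ _ _ _ (iter_derive F w') (fun M : 'rV_m.+1 => M 0 k)).
    exact: hF Vx w'.
  exact: differentiable_coord.
elim: j w => [|j IH] w; first exact (conj (dcomp w) I).
have step v : Ck j (dom V) ('D_v (fun x => iter_derive F w x 0 k)).
  apply: (Ck_eq (@dom_open R V) _ (IH (v :: w))) => x Vx /=.
  have dw : derivable (iter_derive F w) x v by apply: diff_derivable; exact: hF Vx w.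
  by have := congr1 (fun M : 'rV_m.+1 => M 0 k) (derive_mx dw); rewrite mxE.
exact (conj (dcomp w) (conj (step (vx R)) (step (vy R)))).
Qed.

Lemma vpd_plane m (L : 'rV[A]_m) (v : E) :
  map_mx (pd v) L = const V (Complex (v 0 0) (v 0 1)) *: vd W L
    + const V (Complex (v 0 0) (- v 0 1)) *: vdb W L.
Proof. by apply/rowP => k; rewrite !mxE -pd_plane. Qed.

End Lifts.

Section NormalProjection.
Variables (A : comPzRingType) (W : wirtinger A) (m : nat).

(** This is [normal_proj] in the complex tangent frame f_z, conj f_z. Both vectors are null, so the
    coefficient along one is the product with the other, divided by |f_z|^2, whose inverse is
    [i1]. *)
Definition nproj (f : 'rV[A]_m) (i1 : A) (L : 'rV[A]_m) : 'rV[A]_m :=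
  L - (bil L f *: f + i1 *: (bil L (vc W (vd W f)) *: vd W f
                             + bil L (vd W f) *: vc W (vd W f))).

Lemma nproj_frame (f : 'rV[A]_m) i1 L (I : A) : I * I = -1 ->
  let X := vd W f + vc W (vd W f) in let Y := I *: (vd W f - vc W (vd W f)) in
  nproj f i1 L = L - (bil L f *: f + (half W * i1) *: (bil L X *: X)
                                   + (half W * i1) *: (bil L Y *: Y)).
Proof.
move=> I2 X Y; rewrite /nproj /X /Y; congr (L - _); rewrite -addrA; congr (_ + _).
have hh : half W * 2 = 1 by rewrite mulr_natr mulr2n halfE.
rewrite !bilE2.
by apply/rowP => k; rewrite !mxE; ring: I2 hh.
Qed.

End NormalProjection.

Section LocalSurface.
Variables (R : realType) (V : domain R) (n : nat).
Local Notation E := 'rV[R]_2.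
Local Notation Re := complex.Re.
Local Notation A := (smooth_fun V).
Local Notation W := (smooth_wirtinger V).
Local Notation imag := (imag V).
Variables (F : E -> 'rV[R]_n.+1) (f : 'rV[A]_n.+1) (i1 : A).
Hypotheses (Ff : lifts F f) (ff : bil f f = 1).
Let F1 := vd W f.
Let h1 := bil F1 (vc W F1).
Hypotheses (F1F1 : bil F1 F1 = 0) (hi : h1 * i1 = 1).

Lemma lifts_dx : lifts ('D_(vx R) F) (F1 + vc W F1).
Proof.
have h := lifts_derive (vx R) Ff; rewrite vpd_plane in h; move: h.
rewrite !mxE /= oppr0 /F1 vc_vd (lifts_cj Ff).
by rewrite (_ : const V (Complex 1 0) = 1) ?scale1r // const1.
Qed.

Lemma lifts_dy : lifts ('D_(vy R) F) (imag *: (F1 - vc W F1)).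
Proof.
have h := lifts_derive (vy R) Ff; rewrite vpd_plane in h; move: h.
rewrite !mxE /= /F1 vc_vd (lifts_cj Ff).
rewrite (_ : const V (Complex 0 (-1)) = - imag) ?scaleNr -?scalerBr //.
by rewrite -cj_dom_imag cj_dom_const.
Qed.

Lemma surface_first_form p :
  let S := Re (ev p (h1 + h1)) in
  [/\ dot ('D_(vx R) F (sval p)) ('D_(vx R) F (sval p)) = S,
      dot ('D_(vy R) F (sval p)) ('D_(vy R) F (sval p)) = S,
      dot ('D_(vx R) F (sval p)) ('D_(vy R) F (sval p)) = 0,
      dot ('D_(vx R) F (sval p)) (F (sval p)) = 0 &
      dot ('D_(vy R) F (sval p)) (F (sval p)) = 0].
Proof.
move=> S; have hx := lifts_dx; have hy := lifts_dy.
have cF1 : bil (vc W F1) (vc W F1) = 0 by rewrite -cj_bil F1F1 rmorph0.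
have F1f : bil F1 f = 0.
  apply: (double_eq0 W); have := dz_bil W f f.
  by rewrite ff dz1 [bil f (vd W f)]bilC => <-.
have cF1f : bil (vc W F1) f = 0 by rewrite -(lifts_cj Ff) -cj_bil F1f rmorph0.
have i2 : imag * imag = -1 := imagM V.
have e1 : bil (F1 + vc W F1) (F1 + vc W F1) = h1 + h1.
  by rewrite !bilE2 F1F1 cF1 [bil (vc W F1) F1]bilC -/h1; ring.
have e2 : bil (imag *: (F1 - vc W F1)) (imag *: (F1 - vc W F1)) = h1 + h1.
  by rewrite !bilE2 F1F1 cF1 [bil (vc W F1) F1]bilC -/h1; ring: i2.
have e3 : bil (F1 + vc W F1) (imag *: (F1 - vc W F1)) = 0.
  by rewrite !bilE2 F1F1 cF1 [bil (vc W F1) F1]bilC -/h1; ring.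
have e4 : bil (F1 + vc W F1) f = 0 by rewrite !bilE2 F1f cF1f; ring.
have e5 : bil (imag *: (F1 - vc W F1)) f = 0 by rewrite !bilE2 F1f cF1f; ring.
have toR (H H' : E -> 'rV[R]_n.+1) L L' : lifts H L -> lifts H' L' ->
    dot (H (sval p)) (H' (sval p)) = Re (ev p (bil L L')).
  by move=> h h'; rewrite (lifts_bil p h h').
split.
- by rewrite (toR _ _ _ _ hx hx) e1.
- by rewrite (toR _ _ _ _ hy hy) e2.
- by rewrite (toR _ _ _ _ hx hy) e3.
- by rewrite (toR _ _ _ _ hx Ff) e4.
- by rewrite (toR _ _ _ _ hy Ff) e5.
Qed.

Lemma lifts_nproj (H : E -> 'rV[R]_n.+1) L : lifts H L ->
  lifts (fun x => normal_proj F x (H x)) (nproj W f i1 L).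
Proof.
move=> HL p k.
have [X [Y [hx hy ->]]] : exists X Y, [/\ lifts ('D_(vx R) F) X, lifts ('D_(vy R) F) Y &
    nproj W f i1 L = L - (bil L f *: f + (half W * i1) *: (bil L X *: X)
                                   + (half W * i1) *: (bil L Y *: Y))].
  exists (F1 + vc W F1), (imag *: (F1 - vc W F1)).
  by split; [exact: lifts_dx | exact: lifts_dy | exact: nproj_frame (imagM V)].
have [xx yy xy x0 y0] := surface_first_form p.
have h2 : (h1 + h1) * (half W * i1) = 1 by rewrite -(halfE W); ring: hi.
have ev2 : ev p (h1 + h1) * ev p (half W * i1) = 1 by rewrite -evM h2.
have rS : cj W (h1 + h1) = h1 + h1.
  have ch : cj W h1 = h1 by exact: (norm_real (erefl : bil F1 (vc W F1) = h1)).
  by rewrite (rmorphD (cj W)) ch.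
have evS := ev_real p rS.
set S := Re (ev p (h1 + h1)) in xx yy evS.
have S0 : S != 0.
  apply/eqP => h; move: ev2; rewrite evS h mul0r => /eqP.
  by rewrite eq_sym oner_eq0.
have evi : ev p (half W * i1) = (S^-1)%:C%C.
  have h : S%:C%C * (S^-1)%:C%C = 1 by rewrite -rmorphM mulfV.
  by rewrite evS in ev2; exact: inv_unique ev2 h.
have nF : dot (F (sval p)) (F (sval p)) = 1.
  by have := lifts_bil p Ff Ff; rewrite ff => -[].
have np := perp_orthogonal3_coord (H (sval p)) k S0 nF xx yy xy x0 y0.
have -> : (L - (bil L f *: f + half W * i1 *: (bil L X *: X)
                 + half W * i1 *: (bil L Y *: Y))) 0 k
  = L 0 k - (bil L f * f 0 k + half W * i1 * (bil L X * X 0 k)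
             + half W * i1 * (bil L Y * Y 0 k)) by rewrite !mxE.
rewrite (evD p (L 0 k)) evN (evD p (_ + _)) (evD p (_ * _) (_ * _)) !(evM p (_ * _)) !(evM p (bil _ _)).
rewrite evi (lifts_bil p HL Ff) (lifts_bil p HL hx) (lifts_bil p HL hy) HL Ff hx hy.
exact (etrans (real_complex_comb _ _ _ _ _ _ _ _) (congr1 (fun t : R => t%:C%C) np)).
Qed.


End LocalSurface.

(** Meant for semicontinuity: for matrices close to M the same product has a nonzero determinant, so
    their rank is at least that of M. *)
Lemma rank_factor (K : fieldType) m n (M : 'M[K]_(m, n)) :
  exists (L : 'M[K]_(mxrank M, m)) (Q : 'M[K]_(n, mxrank M)), L *m M *m Q = 1%:M.
Proof.
exists (pinvmx (col_base M)), (pinvmx (row_base M)).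
have e : pinvmx (col_base M) *m M = row_base M.
  by rewrite -[X in _ *m X](mulmx_base M) mulmxA mulVpmx ?col_base_full // mul1mx.
by rewrite e mulmxVp // row_base_free.
Qed.

(** * Density of regular points *)

Section NormalSums.
Variables (R : realType) (n : nat).
Local Notation E := 'rV[R]_2.
Variable F : E -> 'rV[R]_n.+1.
Local Notation word w := [seq (delta_mx 0 i : E) | i <- w].

Lemma values_span_sub (s k : nat) (B : seq E -> 'rV[R]_n.+1) (M : 'M[R]_(k, n.+1)) :
  (values_span s B <= M)%MS <-> forall w : s.-tuple 'I_2, (B (word w) <= M)%MS.
Proof.
split=> [h w|h].
  apply: submx_trans h; by apply: (sumsmx_sup w) => //; rewrite genmxE.
by apply/sumsmx_subP => w _; rewrite genmxE.
Qed.

(** Dropping the projections does not change the accumulated span. The normal sums are thus spanned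
    by smooth vectors, although the projections themselves may jump together with the ranks. *)
Lemma normal_sum_sub (k m : nat) x (M : 'M[R]_(m, n.+1)) :
  (normal_sum F k x <= M)%MS <->
  forall j (w : j.+2.-tuple 'I_2), (j < k)%N -> (nabla_second_ff F (word w) x <= M)%MS.
Proof.
elim: k => [|k IH] /=; first by split=> // _; exact: sub0mx.
have half (w : k.+2.-tuple 'I_2) : (normal_sum F k x <= M)%MS ->
    (perp (normal_sum F k x) (nabla_second_ff F (word w) x) <= M)%MS
    = (nabla_second_ff F (word w) x <= M)%MS.
  move=> hM; have hc := submx_trans (perp_compl (normal_sum F k x) (nabla_second_ff F (word w) x)) hM.
  apply/idP/idP => h.
    by rewrite -[nabla_second_ff _ _ _](subrK (perp (normal_sum F k x) (nabla_second_ff F (word w) x))) addmx_sub.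
  rewrite -(subKr (nabla_second_ff F (word w) x) (perp _ _)) addmx_sub //.
  by rewrite eqmx_opp.
split=> [|h].
  rewrite addsmx_sub => /andP[hM /values_span_sub h] j w; rewrite ltnS leq_eqVlt => /orP[/eqP e|].
    by move: w; rewrite e => w; rewrite -half.
  by move: j w; apply/IH.
rewrite addsmx_sub; have hM : (normal_sum F k x <= M)%MS.
  by apply/IH => j w jk; apply: h; rewrite ltnW.
by rewrite hM; apply/values_span_sub => w; rewrite half // h.
Qed.

Lemma rank_normal_space k x :
  (\rank (normal_sum F k.+1 x) = \rank (normal_sum F k x) + \rank (Defs.normal_space F k.+1 x))%N.
Proof.
rewrite normal_sumS mxrank_disjoint_sum //; set S := normal_sum F k x.
have hN : (Defs.normal_space F k.+1 x <= kermx S^T)%MS.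
  apply/values_span_sub => w; apply/sub_kermxP.
  by rewrite /higher_ff size_map size_tuple perp_ker.
apply/eqP; rewrite -submx0 -(cap_perp S) capmxC.
by apply: capmxS => //; rewrite genmxE.
Qed.

Lemma normal_sum_mono k l x : (k <= l)%N -> (\rank (normal_sum F k x) <= \rank (normal_sum F l x))%N.
Proof.
move=> kl; apply: mxrankS; apply/normal_sum_sub => j w jk.
have [/(_ (submx_refl _)) h _] := normal_sum_sub l x (normal_sum F l x).
by apply: h; apply: leq_trans kl.
Qed.

Variable V : domain R.
Hypothesis hA : forall w, coord_smooth V (nabla_second_ff F w).

Lemma normal_sum_lsc k x : dom V x ->
  \forall y \near x, (\rank (normal_sum F k x) <= \rank (normal_sum F k y))%N.
Proof.
move=> Vx; pose T : finType := {j : 'I_k & j.+2.-tuple 'I_2}.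
pose wd (t : T) := word (tagged t).
pose B y : 'M[R]_(#|T|, n.+1) := \matrix_(i < #|T|) nabla_second_ff F (wd (enum_val i)) y.
have hB y : (normal_sum F k y :=: B y)%MS.
  apply/eqmxP/andP; split.
    apply/normal_sum_sub => j w jk; pose t : T := Tagged (fun j : 'I_k => j.+2.-tuple 'I_2) (w : (Ordinal jk).+2.-tuple 'I_2).
    have -> : nabla_second_ff F (word w) y = row (enum_rank t) (B y).
      by rewrite rowK /wd enum_rankK.
    exact: row_sub.
  apply/row_subP => i; rewrite rowK /wd; case: (enum_val i) => j w /=.
  have [/(_ (submx_refl _)) h _] := normal_sum_sub k y (normal_sum F k y).
  exact: h.
have [L [Q LQ]] := rank_factor (B x).
pose Bh : 'M[smooth_fun V]_(#|T|, n.+1) := \matrix_(i, j) of_real (hA (wd (enum_val i)) j).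
pose up a b (Z : 'M[R]_(a, b)) : 'M[smooth_fun V]_(a, b) := map_mx (fun s : R => const V s%:C%C) Z.
pose D := \det (up _ _ L *m Bh *m up _ _ Q).
have evD p : ev p D = (\det (L *m B (sval p) *m Q))%:C%C.
  have upE a b (Z : 'M[R]_(a, b)) : map_mx (ev p) (up a b Z) = map_mx (real_complex R) Z.
    by apply/matrixP => i j; rewrite !mxE ev_const.
  have BE : map_mx (ev p) Bh = map_mx (real_complex R) (B (sval p)).
    by apply/matrixP => i j; rewrite !mxE ev_of_real.
  have e1 : map_mx (ev p) (up _ _ L *m Bh *m up _ _ Q)
      = map_mx (real_complex R) (L *m B (sval p) *m Q).
    by rewrite !(map_mxM (ev p)) !upE BE -!(map_mxM (real_complex R)).
  have e2 := det_map_mx (real_complex R) (L *m B (sval p) *m Q).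
  have e3 := det_map_mx (ev p) (up _ _ L *m Bh *m up _ _ Q).
  by rewrite -e1 e3 in e2.
pose p : point V := exist _ x Vx.
have D0 : ev p D != 0 by rewrite evD /= LQ det1 oner_eq0.
have nV : \forall y \near x, dom V y by have := open_nbhs_nbhs (conj (@dom_open R V) Vx).
apply: filterS2 nV (smooth_near_neq0 D0) => y Vy.
rewrite (extend_ev (exist _ y Vy)) evD /= => dy.
rewrite (eqmx_rank (introT eqmxP (hB x))) (eqmx_rank (introT eqmxP (hB y))).
have u : L *m B y *m Q \in unitmx.
  by rewrite unitmxE unitfE; apply: contra dy => /eqP ->.
have <- : \rank (L *m B y *m Q) = \rank (B x) by apply/eqP; rewrite mxrank_unit.
by apply: leq_trans (mxrankM_maxl _ _) (mxrankM_maxr _ _).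
Qed.

Lemma max_attained (P : nat -> Prop) b : (exists r, P r) -> (forall r, P r -> (r <= b)%N) ->
  exists2 r, P r & forall r', P r' -> (r' <= r)%N.
Proof.
move=> [r0 Pr0] hb; pose q := fun r => `[< P r >].
have ex : exists r, q r by exists r0; apply/asboolP.
have ub r : q r -> (r <= b)%N by move=> /asboolP; exact: hb.
case: (ex_maxnP ex ub) => r /asboolP Pr mx; exists r => // r' Pr'.
by apply: mx; apply/asboolP.
Qed.

(** By semicontinuity, a rank that is maximal at a point is constant around it. Infinitely many k
    are handled at once: near a point where the largest rank of all is attained, at k0, monotonicity
    in k fixes the ranks for k >= k0, and only finitely many k remain, for each of which the open
    set is shrunk once. *)
Lemma regular_exists (O : set E) : open O -> O `<=` dom V -> O !=set0 ->
  exists2 x, O x & regular_at F x.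
Proof.
move=> oO OV O0; pose rk k y := \rank (normal_sum F k y).
have [rm [k0 [y0 [Oy0 e0]]] mx] := @max_attained
  (fun r => exists k y, O y /\ rk k y = r) n.+1
  (match O0 with ex_intro y Oy => ex_intro _ _ (ex_intro _ 0%N (ex_intro _ y (conj Oy erefl))) end)
  (fun r h => match h with ex_intro k (ex_intro y (conj _ e)) =>
     eq_ind _ (fun r => (r <= n.+1)%N) (rank_leq_col _) _ e end).
have shrink (U1 : set E) k x : open U1 -> U1 `<=` O -> U1 x ->
    (forall y, U1 y -> (rk k y <= rk k x)%N) ->
    exists U2 : set E, [/\ open U2, U2 `<=` U1, U2 x & forall y, U2 y -> rk k y = rk k x].
  move=> oO1 O1O O1x hm; have l := normal_sum_lsc k (OV _ (O1O _ O1x)).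
  pose U2 := interior [set y | (rk k x <= rk k y)%N].
  exists (U2 `&` U1); split.
  - by apply: openI => //; exact: open_interior.
  - by move=> y [].
  - by split.
  by move=> y [/interior_subset h1 /hm h2]; apply/eqP; rewrite eqn_leq h2.
have [U1 [oO1 O1O O1y c1]] : exists U1 : set E, [/\ open U1, U1 `<=` O, U1 y0 & forall y, U1 y -> rk k0 y = rk k0 y0].
  apply: shrink => // y Oy; rewrite e0; apply: mx; by exists k0, y.
have hbig k y : (k0 <= k)%N -> U1 y -> rk k y = rm.
  move=> kk Oy; apply/eqP; rewrite eqn_leq mx ?andTb; last by exists k, y; split=> //; exact: O1O.
  by rewrite -e0 -(c1 _ Oy); exact: normal_sum_mono.
have small K : exists U2 : set E, [/\ open U2, U2 `<=` U1, U2 !=set0 &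
    forall k y y', (k < K)%N -> U2 y -> U2 y' -> rk k y = rk k y'].
  elim: K => [|K [U2 [oO2 O21 O20 c2]]].
    by exists U1; split=> //; exists y0.
  have [r [y1 [Oy1 e1]] mx1] := @max_attained (fun r => exists y, U2 y /\ rk K y = r) n.+1
    (match O20 with ex_intro y Oy => ex_intro _ _ (ex_intro _ y (conj Oy erefl)) end)
    (fun r h => match h with ex_intro y (conj _ e) =>
       eq_ind _ (fun r => (r <= n.+1)%N) (rank_leq_col _) _ e end).
  have [U3 [oO3 O32 O3y c3]] : exists U3 : set E, [/\ open U3, U3 `<=` U2, U3 y1 & forall y, U3 y -> rk K y = rk K y1].
    apply: shrink => // [y /O21 /O1O //|y Oy]; rewrite e1; apply: mx1; by exists y.
  exists U3; split=> //; [by move=> y /O32 /O21|by exists y1|].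
  move=> k y y'; rewrite ltnS leq_eqVlt => /orP[/eqP -> Oy Oy'|kK /O32 Oy /O32 Oy'].
    by rewrite !c3.
  exact: c2.
have [U2 [oO2 O21 [x O2x] c2]] := small k0.
exists x; first by apply/O1O/O21.
have all k y : U2 y -> rk k y = rk k x.
  move=> Oy; have [kk|kk] := ltnP k k0; first exact: c2.
  by rewrite !hbig //; exact: O21.
rewrite /regular_at; have := open_nbhs_nbhs (conj oO2 O2x); apply: filterS => y Oy.
case=> // k _; have ey := rank_normal_space k y; have ex := rank_normal_space k x.
have a1 := all k y Oy; have a2 := all k.+1 y Oy; rewrite /rk in a1 a2.
by apply: (@addnI (\rank (normal_sum F k x))); rewrite -ex -a2 ey a1.
Qed.

End NormalSums.

(** * Circular ellipses and null vectors *)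

Section Circle.
Variables (R : realType) (n : nat).
Local Notation Re := complex.Re.
Local Notation Im := complex.Im.
Implicit Types u v c e : 'rV[R]_n.+1.

(** In [is_circle] the centre c is arbitrary. Symmetry makes every point of the circle orthogonal to
    c, and two antipodal points add up to 2 c, so c = 0. *)
Lemma symmetric_circle (E : set 'rV[R]_n.+1) :
  is_circle E -> (forall y, E y -> E (- y)) -> forall y y', E y -> E y' -> dot y y = dot y' y'.
Proof.
move=> [c [e1 [e2 [rho [rho0 n1 n2 n12 ->]]]]] sym.
have dC (u v : 'rV[R]_n.+1) : dot u v = dot v u by exact: bilC.
have dD (u v w : 'rV[R]_n.+1) : dot (u + v) w = dot u w + dot v w by exact: bilDl.
have dZ t (u w : 'rV[R]_n.+1) : dot (t *: u) w = t * dot u w by exact: bilZl.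
have dN (u w : 'rV[R]_n.+1) : dot (- u) w = - dot u w by exact: bilNl.
have dDr (u v w : 'rV[R]_n.+1) : dot w (u + v) = dot w u + dot w v by exact: bilDr.
have dZr t (u w : 'rV[R]_n.+1) : dot w (t *: u) = t * dot w u by exact: bilZr.
have dNr (u w : 'rV[R]_n.+1) : dot w (- u) = - dot w u by exact: bilNr.
have [y yE] : exists y : R -> 'rV[R]_n.+1, forall t, y t = c + rho *: (cos t *: e1 + sin t *: e2) by eexists.
have ny t : dot (y t - c) (y t - c) = rho ^+ 2.
  have -> : y t - c = rho *: (cos t *: e1 + sin t *: e2) by rewrite yE addrC addKr.
  rewrite !(dD, dDr, dZ, dZr) n1 n2 n12 (dC e2) n12.
  transitivity (rho ^+ 2 * (cos t ^+ 2 + sin t ^+ 2)); first by ring.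
  by rewrite cos2Dsin2 mulr1.
have yc t : dot (y t) c = 0.
  have [t' _ e] := sym (y t) (ex_intro2 _ _ t Logic.I (esym (yE t))).
  have h := ny t'; rewrite yE e in h.
  have h' := ny t; move: h h'.
  by rewrite !(dD, dDr, dN, dNr) (dC c (y t)); lra.
have c0 : c = 0.
  apply: dot_eq0; have := yc 0; have := yc pi.
  rewrite !yE cos0 sin0 cospi sinpi !scale0r !addr0 scale1r scaleN1r scalerN.
  by rewrite !(dD, dN); lra.
have nn t : dot (y t) (y t) = rho ^+ 2 by have := ny t; rewrite c0 subr0.
by move=> _ _ [t _ <-] [t' _ <-]; rewrite -!yE !nn.
Qed.

Lemma sum_square_diff (v : 'rV[R[i]]_n.+1) (w : R[i]) :
  \sum_k (2 * Re (w * v 0 k)) ^+ 2 - \sum_k (2 * Im (w * v 0 k)) ^+ 2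
  = 4 * Re (w ^+ 2 * \sum_k v 0 k ^+ 2).
Proof.
rewrite -sumrB mulr_sumr; have ReS (I : finType) (g : I -> R[i]) : Re (\sum_i g i) = \sum_i Re (g i).
  by elim/big_rec2: _ => // i x y _ <-; case: (g i) y => [? ?] [].
rewrite ReS mulr_sumr; apply: eq_bigr => k _.
by case: w (v 0 k) => [a b] [a' b']; rewrite !expr2 /=; ring.
Qed.

(** Put w = (s e^(i phi))^3. Turning phi by pi changes the sign of w, so the circle is symmetric;
    turning by pi/2 multiplies w by - i, so 2 Re(w v) and 2 Im(w v) have equal length and Re(w^2
    <v,v>) = 0. The angles 0 and pi/4 give the real and imaginary parts of <v,v>. *)
Lemma circle_null (y : R -> 'rV[R]_n.+1) (v : 'rV[R[i]]_n.+1) (s : R) : s != 0 ->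
  (forall phi k, y phi 0 k
     = 2 * Re (Complex (s * cos phi) (s * sin phi) ^+ 3 * v 0 k)) ->
  is_circle [set y phi | phi in [set phi : R | 0 <= phi < 2 * pi]] ->
  \sum_k v 0 k ^+ 2 = 0.
Proof.
move=> s0 yE circ; have pi0 := pi_gt0 R.
have opp phi : y (phi + pi) = - y phi.
  apply/rowP => k; rewrite mxE !yE cosDpi sinDpi.
  case: (v 0 k) => a b; rewrite !exprS expr0 mulr1 /=; ring.
have sym u : [set y phi | phi in [set phi : R | 0 <= phi < 2 * pi]] u ->
    [set y phi | phi in [set phi : R | 0 <= phi < 2 * pi]] (- u).
  move=> [phi /andP[p0 p2] <-]; have [h|h] := ltP phi pi.
    by exists (phi + pi); [apply/andP; split; lra | exact: opp].
  exists (phi - pi); first by apply/andP; split; lra.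
  by have := opp (phi - pi); rewrite subrK => ->; rewrite opprK.
have const := symmetric_circle circ sym.
have inE phi : 0 <= phi < 2 * pi ->
    [set y phi | phi in [set phi : R | 0 <= phi < 2 * pi]] (y phi) by move=> h; exists phi.
have quarter phi : 0 <= phi <= pi ->
    Re ((Complex (s * cos phi) (s * sin phi) ^+ 3) ^+ 2 * \sum_k v 0 k ^+ 2) = 0.
  move=> /andP[p0 p1].
  have e := const (y phi) (y (phi + pi / 2)) (inE _ _) (inE _ _).
  have {}e : dot (y phi) (y phi) = dot (y (phi + pi / 2)) (y (phi + pi / 2)).
    by apply: e; apply/andP; split; lra.
  have := sum_square_diff v (Complex (s * cos phi) (s * sin phi) ^+ 3).
  rewrite (_ : \sum_k _ = dot (y phi) (y phi)); last first.
    by rewrite dotE; apply: eq_bigr => k _; rewrite yE expr2.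
  rewrite (_ : \sum_k (2 * Im _) ^+ 2 = dot (y (phi + pi / 2)) (y (phi + pi / 2))); last first.
    rewrite dotE; apply: eq_bigr => k _; rewrite yE cosDpihalf sinDpihalf expr2.
    by case: (v 0 k) => a b; rewrite !exprS expr0 mulr1 /=; ring.
  by rewrite e subrr; lra.
have q0 : 0 <= (0 : R) <= pi by apply/andP; split; lra.
have q4 : 0 <= (pi / 4 : R) <= pi by apply/andP; split; lra.
have := quarter 0 q0; have := quarter _ q4; rewrite cos0 sin0.
have cs : cos (pi / 4 : R) ^+ 2 - sin (pi / 4 : R) ^+ 2 = 0.
  have := cos_pihalf R; have -> : pi / 2 = pi / 4 + pi / 4 :> R by lra.
  by rewrite cosD -!expr2.
have sc : 2 * (sin (pi / 4 : R) * cos (pi / 4 : R)) = 1.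
  have := sin_pihalf R; have -> : pi / 2 = pi / 4 + pi / 4 :> R by lra.
  by rewrite sinD => e; rewrite -[RHS]e; ring.
move: (cos (pi / 4 : R)) (sin (pi / 4 : R)) cs sc => C S cs sc.
have s6 : s ^+ 6 != 0 by rewrite expf_neq0.
case: (\sum_k _) => a b h4 h0.
have a0 : a = 0.
  apply/(mulfI s6); rewrite mulr0 -[RHS]h0 !exprS expr0 !mulr1 /=; ring.
have b0 : b = 0.
  apply/(mulfI s6); rewrite mulr0 -[RHS]h4 a0.
  have c2 : C ^+ 2 = S ^+ 2 by apply/eqP; rewrite -subr_eq0 cs.
  have -> : Re ((Complex (s * C) (s * S) ^+ 3) ^+ 2 * Complex 0 b)
    = - (s ^+ 6 * b * (2 * (S * C)) * (3 * C ^+ 4 - 10 * C ^+ 2 * S ^+ 2 + 3 * S ^+ 4)).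
    by rewrite !exprS expr0 !mulr1 /=; ring.
  rewrite sc; have -> : 3 * C ^+ 4 - 10 * C ^+ 2 * S ^+ 2 + 3 * S ^+ 4
    = 3 * (C ^+ 2 - S ^+ 2) ^+ 2 - (2 * (S * C)) ^+ 2 by ring.
  by rewrite cs sc; ring.
by rewrite a0 b0.
Qed.

End Circle.

(** * Normal derivatives in terms of the harmonic sequence *)

Section NprojRules.
Variables (A : comPzRingType) (W : wirtinger A) (m : nat) (f : 'rV[A]_m) (i1 : A).
Local Notation d := (dz W).
Local Notation c := (cj W).
Local Notation P := (nproj W f i1).
Let F1 := vd W f.
Let cF1 := vc W F1.

Lemma nprojD u v : P (u + v) = P u + P v.
Proof.
rewrite /nproj !bilDl; apply/rowP => k; rewrite !mxE; ring.
Qed.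

Lemma nprojZ a u : P (a *: u) = a *: P u.
Proof.
rewrite /nproj !bilZl; apply/rowP => k; rewrite !mxE; ring.
Qed.

Lemma nproj_id u : bil u f = 0 -> bil u F1 = 0 -> bil u cF1 = 0 -> P u = u.
Proof. by move=> u0 u1 u2; rewrite /nproj -/F1 -/cF1 u0 u1 u2 !scale0r !addr0 scaler0 addr0 subr0. Qed.

Hypotheses (rf : vc W f = f) (ff : bil f f = 1) (F1F1 : bil F1 F1 = 0).
Hypothesis F1f : bil F1 f = 0.
Hypothesis hi : bil F1 cF1 * i1 = 1.

Lemma nproj_f : P f = 0.
Proof.
have e : bil f cF1 = 0 by rewrite bilC -rf -cj_bil F1f rmorph0.
by rewrite /nproj -/F1 -/cF1 ff e bilC F1f !scale0r addr0 scaler0 addr0 scale1r subrr.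
Qed.

Lemma nproj_F1 : P F1 = 0.
Proof.
rewrite /nproj -/F1 -/cF1 F1f F1F1 !scale0r add0r addr0 scalerA mulrC hi.
by rewrite scale1r subrr.
Qed.

Lemma nproj_cF1 : P cF1 = 0.
Proof.
have e : bil cF1 f = 0 by rewrite -rf -cj_bil F1f rmorph0.
have e' : bil cF1 cF1 = 0 by rewrite -cj_bil F1F1 rmorph0.
rewrite /nproj -/F1 -/cF1 e e' !scale0r !add0r bilC scalerA mulrC hi.
by rewrite scale1r subrr.
Qed.

Variables (F2 F3 : 'rV[A]_m) (h2 i2 h3 : A).
Let h1 := bil F1 cF1.
Hypotheses (p0 : harmonic_pair W f F1 1 1 h1) (p1 : harmonic_pair W F1 F2 h1 i1 h2)
  (p2 : harmonic_pair W F2 F3 h2 i2 h3).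

(* Derivative along the real vector with complex coordinate z. *)
Definition along (z : A) (u : 'rV[A]_m) := z *: vd W u + c z *: vdb W u.

(** Passing from z to I z changes the sign of the two unmixed second derivatives, which therefore
    cancel. *)
Lemma along_trace z I : d z = 0 -> c z = z -> d I = 0 -> c I = - I -> I * I = -1 ->
  along z (along z f) + along (I * z) (along (I * z) f) = (4 * z * z) *: vd W (vdb W f).
Proof.
move=> z0 rz I0 cI I2; have bz : dzb W z = 0 by rewrite /dzb rz z0 rmorph0.
have bI : dzb W I = 0 by rewrite /dzb cI dzN I0 oppr0 rmorph0.
rewrite /along !rmorphM !rz !cI !(vdD, vdbD, vdZ, vdbZ) !(dzM, dzbM, dzN, dzbN) z0 bz I0 bI vdb_vd.
by apply/matrixP => i j; rewrite !mxE; ring: I2.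
Qed.

(** Mixed derivatives of f are multiples of f and the F1 component of d F1 is tangent; the
    projection removes both and leaves F2 and its conjugate. *)
Lemma along2 z z' : d z' = 0 -> dzb W z' = 0 ->
  P (along z (along z' f)) = (z * z') *: F2 + c (z * z') *: vc W F2.
Proof.
move=> z0 z1; have [_ _ _ d1 [b2 o21]] := p1; have [_ _ _ _ [b1 _]] := p0.
have dcz : d (c z') = 0 by rewrite -cj_dzb z1 rmorph0.
have bcz : dzb W (c z') = 0 by rewrite -cj_dz z0 rmorph0.
have c1 := dzb_pair p0; rewrite rf in c1.
have bf : vdb W f = cF1 by rewrite /cF1 /F1 vc_vd rf.
have bcF1 : vdb W cF1 = vc W F2 + c (d h1 * i1) *: cF1.
  by rewrite /cF1 -vc_vd d1 vcD vcZ.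
have F2f : bil F2 f = 0.
  have := dz_bil W F1 f; rewrite F1f dz0 d1 -/F1 !bilE2 F1F1 F1f.
  by rewrite mulr0 !addr0 => <-.
have F2F1 : bil F2 F1 = 0.
  apply: (double_eq0 W); have := dz_bil W F1 F1.
  by rewrite F1F1 dz0 d1 !bilE2 F1F1 mulr0 !addr0 [bil F1 F2]bilC => <-.
have PF2 : P F2 = F2 by exact: nproj_id.
have PcF2 : P (vc W F2) = vc W F2.
  apply: nproj_id; first by rewrite -rf -cj_bil F2f rmorph0.
    by rewrite -[F1](vcK W) -cj_bil o21 rmorph0.
  by rewrite -cj_bil F2F1 rmorph0.
rewrite /along -/F1 bf !(vdD, vdbD, vdZ, vdbZ) z0 z1 dcz bcz d1 b1 c1 bcF1.
rewrite !(nprojD, nprojZ) nproj_F1 nproj_cF1 nproj_f PF2 PcF2.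
by rewrite !rmorphM !scale0r !scaler0 !(addr0, add0r) !scalerA.
Qed.

(** The z-bar derivative of F2 is tangent. Here u is d F2, and <F2,F2> = 0 makes it orthogonal to
    F1, hence normal. *)
Lemma along3 z : d z = 0 -> dzb W z = 0 -> bil F2 F2 = 0 ->
  let u := F3 + (d h2 * i2) *: F2 in
  P (along z ((z * z) *: F2 + c (z * z) *: vc W F2)) = (z * z * z) *: u + c (z * z * z) *: vc W u.
Proof.
move=> z0 z1 q22 u; have [_ _ _ d1 [b2 o21]] := p1; have [_ _ _ d2 [b3 o32]] := p2.
rewrite -/u in d2; clearbody u.
have dcz : d (c z) = 0 by rewrite -cj_dzb z1 rmorph0.
have bcz : dzb W (c z) = 0 by rewrite -cj_dz z0 rmorph0.
have c2 := dzb_pair p1; have c1 := dzb_pair p0; rewrite rf in c1.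
have F2f : bil F2 f = 0.
  have := dz_bil W F1 f; rewrite F1f dz0 d1 -/F1 !bilE2 F1F1 F1f.
  by rewrite mulr0 !addr0 => <-.
have F2F1 : bil F2 F1 = 0.
  apply: (double_eq0 W); have := dz_bil W F1 F1.
  by rewrite F1F1 dz0 d1 !bilE2 F1F1 mulr0 !addr0 [bil F1 F2]bilC => <-.
have uf : bil u f = 0.
  have := dz_bil W F2 f; rewrite F2f dz0 d2 -/F1 [bil F2 F1]F2F1 addr0.
  by move=> <-.
have uF1 : bil u F1 = 0.
  have := dz_bil W F2 F1; rewrite F2F1 dz0 d2 d1 !bilDr bilZr F2F1 q22.
  by rewrite mulr0 !addr0 => <-.
have ucF1 : bil u cF1 = 0.
  have := dz_bil W F2 cF1; rewrite o21 dz0 d2 /cF1 c1 bilZr F2f.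
  by rewrite mulr0 addr0 => <-.
have Pu : P u = u by exact: nproj_id.
have Pcu : P (vc W u) = vc W u.
  apply: nproj_id; first by rewrite -rf -cj_bil uf rmorph0.
    by rewrite -[F1](vcK W) -cj_bil ucF1 rmorph0.
  by rewrite -cj_bil uF1 rmorph0.
have bcF2 : vdb W (vc W F2) = vc W u by rewrite -vc_vd d2.
rewrite /along !(vdD, vdbD, vdZ, vdbZ) !(rmorphM, dzM, dzbM) z0 z1 dcz bcz d2 b2 c2 bcF2.
rewrite !(nprojD, nprojZ) nproj_F1 nproj_cF1 Pu Pcu.
rewrite !(mulr0, mul0r, addr0) !scale0r !scaler0 !(addr0, add0r) !scalerA.
by congr (_ *: _ + _ *: _); ring.
Qed.

End NprojRules.

(** * The third fundamental form *)

Section ThirdForm.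
Variables (R : realType) (V : domain R) (n : nat).
Local Notation E := 'rV[R]_2.
Local Notation Re := complex.Re.
Local Notation Im := complex.Im.
Local Notation A := (smooth_fun V).
Local Notation W := (smooth_wirtinger V).
Local Notation d := (dz W).
Local Notation c := (cj W).
Variables (F : E -> 'rV[R]_n.+1) (f : 'rV[A]_n.+1) (i1 : A).
Hypotheses (Ff : lifts F f) (ff : bil f f = 1).
Let F1 := vd W f.
Let h1 := bil F1 (vc W F1).
Hypotheses (F1F1 : bil F1 F1 = 0) (hi : h1 * i1 = 1).

Fixpoint nabla_lift (w : seq E) : 'rV[A]_n.+1 :=
  match w with
  | [:: X2; X1] => nproj W f i1 (map_mx (pd X2) (map_mx (pd X1) f))
  | X :: w' => nproj W f i1 (map_mx (pd X) (nabla_lift w'))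
  | [::] => 0
  end.

Lemma lifts_nabla w : lifts (nabla_second_ff F w) (nabla_lift w).
Proof.
have z : lifts (fun=> 0 : 'rV[R]_n.+1) (0 : 'rV[A]_n.+1).
  by move=> p k; rewrite !mxE ev0.
have np := lifts_nproj Ff ff F1F1 hi.
elim: w => [|X w IH]; first exact: z.
case: w IH => [|X1 [|X0 w]] IH.
- by apply: np; apply: lifts_derive.
- by apply: np; apply: lifts_derive; apply: lifts_derive.
by apply: np; apply: lifts_derive.
Qed.

Lemma nabla_coord_smooth w : coord_smooth V (nabla_second_ff F w).
Proof. exact: lifts_coord_smooth (lifts_nabla w). Qed.

Local Notation cplx v := (Complex (v 0 0) (v 0 1)).

Lemma pd_along m (L : 'rV[A]_m) (v : E) : map_mx (pd v) L = along W (const V (cplx v)) L.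
Proof. by rewrite vpd_plane /along cj_dom_const. Qed.

Lemma dzb_const z : dzb W (const V z) = 0.
Proof. by rewrite /dzb cj_dom_const dz_const rmorph0. Qed.

Variables (F2 F3 : 'rV[A]_n.+1) (h2 i2 h3 : A).
Hypotheses (p0 : harmonic_pair W f F1 1 1 h1) (p1 : harmonic_pair W F1 F2 h1 i1 h2)
  (p2 : harmonic_pair W F2 F3 h2 i2 h3) (q22 : bil F2 F2 = 0).

Let rf : vc W f = f := lifts_cj Ff.

Let F1f : bil F1 f = 0.
Proof.
apply: (double_eq0 W); have := dz_bil W f f.
by rewrite ff dz1 [bil f (vd W f)]bilC => <-.
Qed.

Lemma nabla_lift2 u v :
  nabla_lift [:: u; v] = const V (cplx u * cplx v) *: F2 + const V (conjc (cplx u * cplx v)) *: vc W F2.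
Proof.
rewrite -cj_dom_const constM /= !pd_along.
exact: (along2 rf ff F1F1 F1f hi p0 p1 (const V (cplx u)) (dz_const _ _) (dzb_const _)).
Qed.

Lemma nabla_lift3 (v : E) (z := const V (cplx v)) :
  nabla_lift [:: v; v; v] = (z * z * z) *: (F3 + (d h2 * i2) *: F2)
    + c (z * z * z) *: vc W (F3 + (d h2 * i2) *: F2).
Proof.
have -> : nabla_lift [:: v; v; v] = nproj W f i1 (map_mx (pd v) (nabla_lift [:: v; v])) by [].
rewrite nabla_lift2 -cj_dom_const constM pd_along.
exact: (along3 rf F1F1 F1f hi p0 p1 p2 (dz_const _ _) (dzb_const _) q22).
Qed.


Let q23 : bil F2 F3 = 0.
Proof.
apply: (double_eq0 W); have := dz_bil W F2 F2; have [_ _ _ -> _] := p2.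
by rewrite q22 dz0 !bilE2 q22 mulr0 !addr0 [bil F3 F2]bilC => <-.
Qed.

Lemma lifts_dot0 (H H' : E -> 'rV[R]_n.+1) (L L' : 'rV[A]_n.+1) (p : point V) : lifts H L -> lifts H' L' ->
  bil L L' = 0 -> dot (H (sval p)) (H' (sval p)) = 0.
Proof. by move=> h h' e; have := lifts_bil p h h'; rewrite e ev0 => -[]. Qed.

Lemma double_Re (w t : R[i]) : w * t + conjc w * conjc t = (2 * Re (w * t))%:C%C.
Proof.
case: w t => [a b] [a' b']; apply/eqP; rewrite eq_complex /=.
by apply/andP; split; apply/eqP; ring.
Qed.

Lemma Re_comb (b w : R[i]) :
  2 * Re (b * w) = Re b * (2 * Re w) + Im b * (2 * Re ('i%C * w)).
Proof. by case: b w => [a b] [x y] /=; ring. Qed.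

Lemma lifts_real_part (H : E -> 'rV[R]_n.+1) (z : A) (L : 'rV[A]_n.+1) (p : point V) k :
  lifts H (z *: L + c z *: vc W L) -> H (sval p) 0 k = 2 * Re (ev p z * ev p (L 0 k)).
Proof.
move=> /(_ p k); rewrite !mxE (evD p) !evM !ev_cjE double_Re.
by case.
Qed.

(** N_1 consists of the vectors 2 Re(w F2) with w complex. It contains the contribution of the F2
    component of d F2, and it is orthogonal to 2 Re(w F3) because F3 is orthogonal to F2 and to conj
    F2. *)
Lemma higher_ff3 (p : point V) (v : E) k :
  higher_ff F [:: v; v; v] (sval p) 0 k = 2 * Re (cplx v ^+ 3 * ev p (F3 0 k)).
Proof.
pose z := const V (cplx v); pose Y := (z * z * z) *: F3 + c (z * z * z) *: vc W F3.
have rY : vc W Y = Y by rewrite /Y vcD !vcZ vcK cjK addrC.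
have hY := cj_lifts rY; set y := (fun _ => _) in hY.
have [_ _ _ _ [_ o32]] := p2.
have F2Y u : bil (u *: F2 + c u *: vc W F2) Y = 0.
  have e1 : bil F3 F2 = 0 by rewrite bilC.
  have e2 : bil (vc W F2) (vc W F3) = 0 by rewrite -cj_bil q23 rmorph0.
  have e3 : bil F2 (vc W F3) = 0 by rewrite -[F2](vcK W) -cj_bil bilC o32 rmorph0.
  by rewrite /Y !bilE2 q23 e2 e3 [bil (vc W F2) F3]bilC o32; ring.
set x := sval p.
have ev_z : ev p (z * z * z) = cplx v ^+ 3 by rewrite !evM !ev_const !exprS expr0; ring.
have yE j : y x 0 j = 2 * Re (cplx v ^+ 3 * ev p (F3 0 j)).
  by rewrite (lifts_real_part p j hY) ev_z.
rewrite -yE; congr (fun m : 'rV_n.+1 => m 0 k).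
apply: perp_unique.
  apply/trmx_inj; rewrite trmx_mul trmxK trmx0; apply/sub_kermxP.
  apply/normal_sum_sub => -[|//] [[|a [|b []]] //= sz] _.
  apply/sub_kermxP/matrixP => i j; rewrite !ord1 [RHS]mxE.
  apply: (lifts_dot0 p (lifts_nabla [:: delta_mx 0 a; delta_mx 0 b]) hY).
  by rewrite nabla_lift2 -cj_dom_const F2Y.
have two (u w : 'I_2) : (nabla_second_ff F [:: delta_mx 0 u; delta_mx 0 w] x
                          <= normal_sum F 1 x)%MS.
  have [/(_ (submx_refl _)) h _] := normal_sum_sub F 1 x (normal_sum F 1 x).
  exact: (h 0%N [tuple u; w]).
have two_coord (u w : E) j : nabla_second_ff F [:: u; w] x 0 j
    = 2 * Re (cplx u * cplx w * ev p (F2 0 j)).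
  have := lifts_nabla [:: u; w]; rewrite nabla_lift2 -cj_dom_const => h.
  by rewrite (lifts_real_part p j h) ev_const.
pose b := cplx v ^+ 3 * ev p (d h2 * i2).
have hN j : nabla_second_ff F [:: v; v; v] x 0 j
    = 2 * Re (cplx v ^+ 3 * ev p (F3 0 j) + cplx v ^+ 3 * (ev p (d h2 * i2) * ev p (F2 0 j))).
  have := lifts_nabla [:: v; v; v]; rewrite nabla_lift3 -/z => h.
  by rewrite (lifts_real_part p j h) ev_z mxE (evD p) mxE evM mulrDr.
have two0 := two 0 0; have two1 := two 0 1.
have c0 j := two_coord (delta_mx 0 0) (delta_mx 0 0) j.
have c1 j := two_coord (delta_mx 0 0) (delta_mx 0 1) j.
move: (nabla_second_ff F [:: v; v; v] x) hN (nabla_second_ff F [:: _; delta_mx 0 0] x) two0 c0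
  (nabla_second_ff F _ x) two1 c1 => N3 hN N0 two0 c0 N1 two1 c1.
(* N0 and N1 are 2 Re(F2) and 2 Re(i F2), so this combination is 2 Re(b F2). *)
suff -> : N3 - y x = Re b *: N0 + Im b *: N1 by apply: addmx_sub; apply: scalemx_sub.
have [yx eyx] : exists m, m = y x by eexists.
rewrite -eyx; have {}yE j : yx 0 j = 2 * Re (cplx v ^+ 3 * ev p (F3 0 j)) by rewrite eyx yE.
apply/rowP => j; move: (hN j) (yE j) (c0 j) (c1 j); rewrite !mxE /= => -> -> -> ->.
have e0 : Complex 1 0 = 1 :> R[i] by [].
have ei : Complex 0 1 = 'i%C :> R[i] by [].
rewrite e0 ei mulr1 !mul1r -Re_comb /b -mulrBr.
have ReB (s t : R[i]) : Re s - Re t = Re (s - t) by case: s t => ? ? [].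
by rewrite ReB addrAC subrr add0r mulrA.
Qed.

Lemma derive_scale_dir (H : E -> 'rV[R]_n.+1) (v : E) s (L : 'rV[A]_n.+1) (p : point V) :
  lifts H L -> 'D_(s *: v) H (sval p) = s *: 'D_v H (sval p).
Proof.
move=> h; have hv := lifts_derive v h; have hs := lifts_derive (s *: v) h.
have e : map_mx (pd (s *: v)) L = const V s%:C%C *: map_mx (pd v) L.
  rewrite !vpd_plane scalerDr !scalerA -!constM; congr (const V _ *: _ + const V _ *: _);
  by rewrite !mxE; apply/eqP; rewrite eq_complex /=; apply/andP; split; apply/eqP; ring.
rewrite e in hs; apply/rowP => k; rewrite [RHS]mxE; apply: (@complexI R).
transitivity (ev p ((const V s%:C%C *: map_mx (pd v) L) 0 k)); first by rewrite hs.
by rewrite mxE evM ev_const hv -rmorphM.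
Qed.

Lemma unit_frame (p : point V) : exists2 s : R, s != 0 &
  [/\ metric F (sval p) (s *: vx R) (s *: vx R) = 1,
      metric F (sval p) (s *: vy R) (s *: vy R) = 1 &
      metric F (sval p) (s *: vx R) (s *: vy R) = 0].
Proof.
have [xx yy xy _ _] := surface_first_form Ff ff F1F1 p.
set S := Re (ev p (h1 + h1)) in xx yy.
have S0 : S != 0.
  have rh : c (h1 + h1) = h1 + h1.
    have ch : c h1 = h1 by exact: (norm_real (erefl : bil F1 (vc W F1) = h1)).
    by rewrite (rmorphD c) ch.
  have evS := ev_real p rh; rewrite -/S in evS.
  apply/eqP => s0; have := congr1 (ev p) hi; rewrite evM ev1 => e.
  have : ev p h1 + ev p h1 = 0 by rewrite -evD evS s0.
  move=> /(congr1 (fun t => t * ev p i1)); rewrite mulrDl e mul0r => /eqP.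
  by rewrite -[1 + 1]/(2%:R) pnatr_eq0.
have S1 : 0 < S.
  by rewrite lt_neqAle eq_sym S0 -xx dotE sumr_ge0 // => k _; rewrite -expr2 sqr_ge0.
pose s := (Num.sqrt S)^-1.
have s0 : s != 0 by rewrite invr_eq0 gt_eqF // sqrtr_gt0.
have sS : s * s * S = 1.
  by rewrite -[X in _ * X](sqr_sqrtr (ltW S1)) /s; field; rewrite gt_eqF // sqrtr_gt0.
have dZ v := derive_scale_dir v s p Ff.
have sc (a b : 'rV[R]_n.+1) (t r : R) : dot a b = t -> s * s * t = r ->
    dot (s *: a) (s *: b) = r.
  by move=> <- <-; rewrite -[LHS]/(bil _ _) bilZl bilZr mulrA.
have m v w t r : dot ('D_v F (sval p)) ('D_w F (sval p)) = t -> s * s * t = r ->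
    metric F (sval p) (s *: v) (s *: w) = r.
  move=> e e'; exact (etrans (congr2 (@dot R n.+1) (dZ v) (dZ w)) (sc _ _ _ _ e e')).
exact (ex_intro2 _ _ s s0 (And3 (m _ _ _ _ xx sS) (m _ _ _ _ yy sS) (m _ _ _ _ xy (mulr0 _)))).
Qed.

Lemma isotropic_null (p : point V) :
  (forall Z, metric F (sval p) Z Z = 1 -> is_circle (curvature_ellipse F 2 (sval p) Z)) ->
  ev p (bil F3 F3) = 0.
Proof.
move=> circ; have [s s0 [nF _ _]] := unit_frame p.
pose v3 : 'rV[R[i]]_n.+1 := \row_k ev p (F3 0 k).
have := circ _ nF; set C := curvature_ellipse _ _ _ _ => hC.
rewrite ev_bil -[RHS](@circle_null R n (fun phi => higher_ff F (nseq 3 (cos phi *: (s *: vx R) + sin phi *: rotJ (s *: vx R))) (sval p)) v3 s s0 _ hC).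
  by apply: eq_bigr => k _; rewrite mxE expr2.
move=> phi k; rewrite higher_ff3 !mxE /=.
by congr (2 * Re (_ ^+ 3 * _)); apply: congr2; ring.
Qed.

End ThirdForm.

(** * Congruence of harmonic sequences *)

Section Terminating.
Variables (A : comPzRingType) (W : wirtinger A).
Local Notation d := (dz W).
Local Notation c := (cj W).
Local Notation db := (dzb W).

(** The next squared norm is written in terms of the previous norms only. Applied to f and to g, it
    yields the same h_2 and h_3 from the common h_1. *)
Lemma harmonic_next m (P Q : 'rV[A]_m) hP iP hQ iQ :
  harmonic_pair W P Q hP iP hQ -> hQ * iQ = 1 ->
  exists S, harmonic_pair W Q S hQ iQ (hQ * (db (d hQ * iQ) + hQ * iP)).
Proof.
move=> p e; have [pS tS] := harmonic_step p e; eexists.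
have -> : hQ * (db (d hQ * iQ) + hQ * iP)
  = bil (vd W Q - (d hQ * iQ) *: Q) (vc W (vd W Q - (d hQ * iQ) *: Q)) * (hQ * iQ).
  by rewrite tS; ring.
by rewrite e mulr1; exact: pS.
Qed.

Definition terminating_seq m (K : nat) (F : nat -> 'rV[A]_m) (h i : nat -> A) :=
  [/\ h 0%N = 1, F K.+1 = 0, orthogonal_seq W K F i &
      forall j, (j <= K)%N -> harmonic_pair W (F j) (F j.+1) (h j) (i j) (h j.+1)].

Lemma terminating_one m (F0 F1 : 'rV[A]_m) h i : vc W F0 = F0 -> bil F0 F0 = 1 ->
  bil F1 F0 = 0 -> bil F1 F1 = 0 -> harmonic_pair W F0 F1 1 1 h ->
  harmonic_pair W F1 0 h i 0 ->
  terminating_seq 1 (nth 0 [:: F0; F1]) (nth 0 [:: 1; h]) (nth 0 [:: 1; i]).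
Proof.
move=> r0 n0 q10 q11 p0 p1; have [e n1 _ _ _] := p1; split=> //; last by case=> [|[|j]].
split=> //.
- by case=> [|[|j]].
- by case=> [|[|j]] // [|[|k]].
- by case=> [|[|j]] // [|[|k]] //= _ _; rewrite n1 mulrC.
Qed.

Lemma terminating_real m K (F : nat -> 'rV[A]_m) h i j :
  terminating_seq K F h i -> (j <= K)%N -> c (i j) = i j.
Proof.
move=> [_ _ _ p] /p [e n _ _ _]; exact: cj_inv e (norm_real n).
Qed.

Lemma terminating_transfer m q K (F : nat -> 'rV[A]_m) (G : nat -> 'rV[A]_q) h i :
  terminating_seq K F h i -> terminating_seq K G h i ->
  [/\ vc W (transfer W K F G i) = transfer W K F G i,
      vd W (transfer W K F G i) = 0, F 0%N *m transfer W K F G i = G 0%N &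
      transfer W K F G i *m transfer W K G F i = transfer W K F F i].
Proof.
move=> sF sG; have [h0 F4 oF pF] := sF; have [_ G4 oG pG] := sG.
have [rF _ _ _ _] := oF; have [rG _ _ _ _] := oG.
have ri j : (0 < j <= K)%N -> c (i j) = i j.
  by move=> /andP[_ jK]; exact: terminating_real sF jK.
split.
- exact: cj_transfer.
- by rewrite (dz_transfer rF rG h0 pF pG) F4 G4 mulmx0 trmx0 mul0mx addr0 scaler0.
- exact: mul_transfer oF (leq0n _).
- exact: transfer_comp oG rF ri.
Qed.

Lemma bil_tr m (u v : 'rV[A]_m) : \tr (u^T *m v) = bil u v.
Proof. by rewrite mxtrace_mulC /bil [v *m _]mx11_scalar mxtrace_scalar mulr1n -/(bil v u) bilC. Qed.

(** The trace of the projector counts the frame vectors; this is how the dimension n + 1 is read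
    off. *)
Lemma tr_transfer m K (F : nat -> 'rV[A]_m) i :
  orthogonal_seq W K F i -> \tr (transfer W K F F i) = (K.*2.+1)%:R.
Proof.
move=> [_ n0 _ _ oc]; rewrite /transfer mxtraceD bil_tr n0 raddf_sum /=.
rewrite big_nat (eq_bigr (fun=> 2%:R)) => [|j hj].
  by rewrite -big_nat sumr_const_nat subn1 /= -mulrnA -(natrD _ 1) mul2n.
rewrite mxtraceZ mxtraceD !bil_tr [bil (vc W _) _]bilC mulrDr (oc j j hj hj) eqxx.
by [].
Qed.

(** The relation h3 = h1 h2 / 2 is a condition on the metric, so it can be transported from g to f.
    It gives F4 squared norm 0, and definiteness, an assumption in the abstract ring, gives F4 =
    0. *)
Lemma terminating_exists m (F0 : 'rV[A]_m) h1 i1 h2 i2 h3 (F1 := vd W F0) :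
  (forall u : 'rV[A]_m, bil u (vc W u) = 0 -> u = 0) ->
  vc W F0 = F0 -> bil F1 F1 = 0 -> harmonic_pair W F0 F1 1 1 h1 ->
  h1 * i1 = 1 -> h2 = h1 * (db (d h1 * i1) + h1) ->
  h2 * i2 = 1 -> h3 = h2 * (db (d h2 * i2) + h2 * i1) -> h3 = half W * h1 * h2 ->
  exists2 F, F 0%N = F0 &
    terminating_seq 3 F (nth 0 [:: 1; h1; h2; h3]) (nth 0 [:: 1; i1; i2; 2 * i1 * i2]).
Proof.
move=> pos rF q11 p0 e1 h2E e2 h3E h3h.
have [F2 p1] := harmonic_next p0 e1; rewrite mulr1 -h2E in p1.
have [F3 p2] := harmonic_next p1 e2; rewrite -h3E in p2.
have dhalf : d (half W) = 0.
  by apply: (double_eq0 W); rewrite -dzD halfE dz1.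
have hh : half W * 2 = 1 by rewrite mulr_natr mulr2n halfE.
pose i3 := 2 * i1 * i2.
have e3 : h3 * i3 = 1 by rewrite h3h /i3; ring: hh e1 e2.
have dlog : d h3 * i3 = d h1 * i1 + d h2 * i2.
  by rewrite h3h !dzM dhalf /i3; ring: hh e1 e2.
have t1 : db (d h1 * i1) = h2 * i1 - h1 by rewrite h2E; ring: e1.
have t2 : db (d h2 * i2) = h3 * i2 - h2 * i1 by rewrite h3E; ring: e2.
have t3 : db (d h3 * i3) = - (h3 * i2).
  rewrite dlog dzbD t1 t2 h3h; apply/eqP; rewrite -subr_eq0; apply/eqP.
  transitivity ((half W + half W) * h1 - h1); first by ring: e2.
  by rewrite halfE mul1r subrr.
have [F4 p3] := harmonic_next p2 e3; rewrite t3 addNr mulr0 in p3.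
have F40 : F4 = 0 by apply: pos; case: p3.
rewrite F40 in p3.
exists (nth 0 [:: F0; F1; F2; F3]) => //; split=> //.
  exact: terminating_isotropic rF q11 p0 p1 p2 p3 t1 t2 t3.
by case=> [|[|[|[|j]]]].
Qed.

End Terminating.

(** * Harmonic pairs from minimality and from the Cayley product *)

Section LocalEquations.
Variables (R : realType) (V : domain R) (n : nat).
Local Notation E := 'rV[R]_2.
Local Notation Re := complex.Re.
Local Notation Im := complex.Im.
Local Notation A := (smooth_fun V).
Local Notation W := (smooth_wirtinger V).
Variables (F : E -> 'rV[R]_n.+1) (f : 'rV[A]_n.+1).
Hypothesis Ff : lifts F f.
Let F1 := vd W f.
Let h1 := bil F1 (vc W F1).

Lemma smooth_definite m (u : 'rV[A]_m) : bil u (vc W u) = 0 -> u = 0.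
Proof.
move=> u0; apply/rowP => k; apply: smooth_evP => p; rewrite mxE ev0.
have : \sum_j (Re (ev p (u 0 j)) ^+ 2 + Im (ev p (u 0 j)) ^+ 2) = 0.
  apply: (@complexI R); rewrite -[RHS](ev0 p) -u0 ev_bil rmorph_sum.
  apply: eq_bigr => j _; rewrite mxE ev_cjE; case: (ev p (u 0 j)) => a b.
  by apply/eqP; rewrite eq_complex /=; apply/andP; split; apply/eqP; ring.
move/eqP; rewrite psumr_eq0 => [/allP h|j _]; last by rewrite addr_ge0 ?sqr_ge0.
have := h k (mem_index_enum _); case: (ev p (u 0 k)) => a b /=.
by rewrite paddr_eq0 ?sqr_ge0 // !sqrf_eq0 => /andP[/eqP -> /eqP ->].
Qed.

Lemma lifts_unit : (forall x, dom V x -> dot (F x) (F x) = 1) -> bil f f = 1.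
Proof.
by move=> h; apply: smooth_evP => p; rewrite (lifts_bil p Ff Ff) h //; exact: svalP.
Qed.

Lemma conformal_null :
  (forall x, dom V x -> metric F x (vy R) (vy R) = metric F x (vx R) (vx R) /\
                        metric F x (vx R) (vy R) = 0) -> bil F1 F1 = 0.
Proof.
move=> h; have hx := lifts_dx Ff; have hy := lifts_dy Ff.
have e1 : bil (F1 + vc W F1) (imag V *: (F1 - vc W F1)) = 0.
  by apply: smooth_evP => p; rewrite (lifts_bil p hx hy) ev0; have [_ e] := h _ (svalP p); rewrite [dot _ _]e.
have e2 : bil (imag V *: (F1 - vc W F1)) (imag V *: (F1 - vc W F1))
        = bil (F1 + vc W F1) (F1 + vc W F1).
  apply: smooth_evP => p; rewrite (lifts_bil p hx hx) (lifts_bil p hy hy).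
  have [e _] := h _ (svalP p); exact (congr1 (fun t : R => t%:C%C) e).
have i2 : imag V * imag V = -1 := imagM V.
set q := bil F1 F1; set q' := bil (vc W F1) (vc W F1).
have {}e1 : q - q' = 0.
  have -> : q - q' = - imag V * bil (F1 + vc W F1) (imag V *: (F1 - vc W F1)).
    by rewrite !bilE2 [bil (vc W F1) F1]bilC -/q -/q'; ring: i2.
  by rewrite e1 mulr0.
apply: (double_eq0 W); apply: (double_eq0 W).
have -> : q + q + (q + q) = (q + q) + (q' + q') + ((q - q') + (q - q')) by ring.
rewrite e1 !addr0; have -> : q + q + (q' + q')
  = bil (F1 + vc W F1) (F1 + vc W F1)
    - bil (imag V *: (F1 - vc W F1)) (imag V *: (F1 - vc W F1)).
  by rewrite !bilE2 [bil (vc W F1) F1]bilC -/q -/q'; ring: i2.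
by rewrite e2 subrr.
Qed.

Hypotheses (ff : bil f f = 1) (q11 : bil F1 F1 = 0).

Lemma immersive_inv :
  (forall x v, dom V x -> 'D_v F x = 0 -> v = 0) -> exists i1, h1 * i1 = 1.
Proof.
move=> h; apply: smooth_inv => p; apply/eqP => e.
have [xx _ _ _ _] := surface_first_form Ff ff q11 p.
have : dot ('D_(vx R) F (sval p)) ('D_(vx R) F (sval p)) = 0.
  by rewrite xx evD -/F1 -/h1 e addr0.
move=> /dot_eq0 /(h _ _ (svalP p)) /(congr1 (fun v : E => v 0 0)).
by rewrite !mxE /= => /eqP; rewrite oner_eq0.
Qed.

Hypothesis zmc : forall x, dom V x -> forall u v,
  metric F x u u = 1 -> metric F x v v = 1 -> metric F x u v = 0 ->
  second_ff F u u x + second_ff F v v x = 0.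
Variable i1 : A.
Hypothesis hi : h1 * i1 = 1.

(** The vector f_(z zbar) is orthogonal to f_z and conj f_z by conformality, its product with f is -
    h1, and by [along_trace] its normal part is a multiple of the mean curvature. *)
Lemma minimal_harmonic : harmonic_pair W f F1 1 1 h1.
Proof.
have rf := lifts_cj Ff.
have F1f : bil F1 f = 0.
  apply: (double_eq0 W); have := dz_bil W f f.
  by rewrite ff dz1 [bil f (vd W f)]bilC => <-.
have bf : vdb W f = vc W F1 by rewrite /F1 vc_vd rf.
pose X := vd W (vdb W f).
have XE : vdb W F1 = X by rewrite /X -vdb_vd.
have rX : vc W X = X by rewrite /X vc_vd vc_vdb rf vdb_vd.
have Xf : bil X f = - h1.
  have := dzb_bil W F1 f; rewrite F1f dzb0 XE bf -/h1 => e.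
  by apply: (addIr h1); rewrite addNr [RHS]e.
have X1 : bil X F1 = 0.
  apply: (double_eq0 W); have := dzb_bil W F1 F1.
  by rewrite q11 dzb0 XE [bil F1 X]bilC => <-.
have X1' : bil X (vc W F1) = 0 by rewrite -rX -cj_bil X1 rmorph0.
suff X0 : nproj W f i1 X = 0.
  split; rewrite ?mulr1 ?dz1 ?scale0r ?addr0 ?rf //; split; last by [].
  rewrite XE; move: X0; rewrite /nproj -/F1 X1 X1' !scale0r addr0 scaler0 addr0 Xf.
  by move/eqP; rewrite subr_eq0 => /eqP.
apply/rowP => k; apply: smooth_evP => p; rewrite [in RHS]mxE ev0.
have [s s0 [nx ny nxy]] := unit_frame Ff ff q11 hi p.
have sum0 := zmc (svalP p) nx ny nxy.
pose z := const V s%:C%C; pose w := imag V * z.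
have lx := lifts_nabla Ff ff q11 hi [:: s *: vx R; s *: vx R].
have ly := lifts_nabla Ff ff q11 hi [:: s *: vy R; s *: vy R].
have zE : const V (Complex ((s *: vx R) 0 0) ((s *: vx R) 0 1)) = z.
  by rewrite !mxE /= mulr1 mulr0.
have wE : const V (Complex ((s *: vy R) 0 0) ((s *: vy R) 0 1)) = w.
  rewrite /w -constM !mxE /=; congr const.
  by apply/eqP; rewrite eq_complex /=; apply/andP; split; apply/eqP; ring.
have rz : cj W z = z by rewrite cj_dom_const conjc_real.
have tr := @along_trace A W n.+1 f z (imag V) (dz_const _ _) rz
  (dz_const _ _) (cj_dom_imag V) (imagM V).
rewrite /nabla_lift !pd_along zE in lx; rewrite /nabla_lift !pd_along wE in ly.
have e : (4 * z * z) *: nproj W f i1 X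
    = nproj W f i1 (along W z (along W z f)) + nproj W f i1 (along W w (along W w f)).
  by rewrite -nprojZ -tr nprojD.
have pt (a b : 'rV[A]_n.+1) (x y : 'rV[R]_n.+1) : ev p (a 0 k) = (x 0 k)%:C%C ->
    ev p (b 0 k) = (y 0 k)%:C%C -> x + y = 0 -> ev p ((a + b) 0 k) = 0.
  move=> ax bY xy0; have := congr1 (fun m : 'rV_n.+1 => m 0 k) xy0; rewrite !mxE => xyk.
  by rewrite (evD p) ax bY -rmorphD xyk.
have := pt _ _ _ _ (lx p k) (ly p k) sum0; rewrite -e.
have e4 : ev p 4 = 4 := rmorph_nat (ev p) 4.
rewrite mxE !evM !ev_const e4 => /eqP; rewrite !mulf_eq0 pnatr_eq0 /= orbb.
by rewrite (fmorph_eq0 (real_complex R)) (negPf s0) /= => /eqP.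
Qed.

End LocalEquations.

Section LocalSurfaces.
Variables (R : realType) (V : domain R).
Local Notation E := 'rV[R]_2.
Local Notation A := (smooth_fun V).
Local Notation W := (smooth_wirtinger V).

Lemma lifts_opp m (H : E -> 'rV[R]_m) (L : 'rV[A]_m) :
  lifts H L -> lifts (fun x => - H x) (- L).
Proof. by move=> h p k; rewrite [(- L) 0 k]mxE evN h -rmorphN [(- H _) 0 k]mxE. Qed.

(* The data attached to a minimal surface in a domain of isothermal
   coordinates; h and i are <F_1, conj F_1> and its inverse. *)
Definition minimal_lift n (F : E -> 'rV[R]_n.+1) (f : 'rV[A]_n.+1) (h i : A) :=
  [/\ lifts F f, bil f f = 1, bil (vd W f) (vd W f) = 0, h * i = 1 &
      harmonic_pair W f (vd W f) 1 1 h].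

Lemma minimal_lift_exists n (F : E -> 'rV[R]_n.+1) :
  (forall x, dom V x -> smooth_at F x) -> (forall x, dom V x -> dot (F x) (F x) = 1) ->
  (forall x v, dom V x -> 'D_v F x = 0 -> v = 0) ->
  (forall x, dom V x -> forall v, metric F x (rotJ v) (rotJ v) = metric F x v v /\
    metric F x v (rotJ v) = 0) ->
  (forall x, dom V x -> forall u v,
    metric F x u u = 1 -> metric F x v v = 1 -> metric F x u v = 0 ->
    second_ff F u u x + second_ff F v v x = 0) ->
  exists f h i, minimal_lift F f h i.
Proof.
move=> smF uF iF cF zF; have hF := smooth_at_coord smF; have lF := lift_rowP hF.
have ff := lifts_unit lF uF.
have jx : rotJ (vx R) = vy R.
  by apply/rowP => k; rewrite !mxE; case: k => -[|[|k]] hk //=; rewrite oppr0.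
have q11 : bil (vd W (lift_row hF)) (vd W (lift_row hF)) = 0.
  apply: (conformal_null lF) => x Vx; have := cF x Vx (vx R); rewrite jx => -[e e'].
  exact (conj e e').
have [i hi] := immersive_inv lF ff q11 iF.
exists (lift_row hF), (bil (vd W (lift_row hF)) (vc W (vd W (lift_row hF)))), i.
exact (And5 lF ff q11 hi (minimal_harmonic lF ff q11 zF hi)).
Qed.

Lemma curve_lift_exists (G : E -> 'rV[R]_7) :
  (forall x, dom V x -> smooth_at (G : E -> 'rV[R]_6.+1) x) ->
  (forall x, dom V x -> dot (G x) (G x) = 1) ->
  (forall x v, dom V x -> 'D_v (G : E -> 'rV[R]_6.+1) x = 0 -> v = 0) ->
  (forall x, dom V x -> forall v : E,
        imO (derive (G : E -> 'rV[R]_7) x (rotJ v)) =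
        cayley_mul (imO (G x)) (imO (derive G x v))) ->
  exists g h i, @minimal_lift 6 G g h i /\ cross g (vd W g) = imag V *: vd W g.
Proof.
move=> smG uG iG jG; have hG := smooth_at_coord smG; have lG := lift_rowP hG.
have gg := lifts_unit lG uG; set g : 'rV[A]_7 := lift_row hG in lG gg *.
have jx : rotJ (vx R) = vy R.
  by apply/rowP => k; rewrite !mxE; case: k => -[|[|k]] hk //=; rewrite oppr0.
have jy : rotJ (vy R) = - vx R.
  by apply/rowP => k; rewrite !mxE; case: k => -[|[|k]] hk //=; rewrite ?oppr0.
have lc (H H' : E -> 'rV[R]_7) (L L' : 'rV[A]_7) : lifts H L -> lifts H' L' ->
    lifts (fun x => cayley_cross (H x) (H' x)) (cross L L').
  move=> h h' p k; have e1 : map_mx (ev p) L = map_mx (real_complex R) (H (sval p)).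
    by apply/rowP => j; rewrite [LHS]mxE [RHS]mxE h.
  have e2 : map_mx (ev p) L' = map_mx (real_complex R) (H' (sval p)).
    by apply/rowP => j; rewrite [LHS]mxE [RHS]mxE h'.
  have := map_cross (ev p) L L'; rewrite e1 e2 -(map_cross (real_complex R)) => /rowP /(_ k).
  by rewrite mxE [RHS]mxE.
have I2 := imagM V.
(* The real equations G x G_x = G_y and G x G_y = - G_x combine into the type equation of 2 G_z =
   G_x - i G_y. *)
have GF : cross g (vd W g) = imag V *: vd W g.
  have hx := lifts_dx lG; have hy := lifts_dy lG; set g1 := vd W g in hx hy *.
  have mulE (x y u : 'rV[R]_7) : imO x = cayley_mul (imO u) (imO y) -> x = cayley_cross u y.
    by rewrite /imO /cayley_mul /= => -[_ ->]; rewrite !scale0r !add0r.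
  have ex : cross g (g1 + vc W g1) = imag V *: (g1 - vc W g1).
    apply: lifts_unique (lc _ _ _ _ lG hx) (lifts_eq _ hy) => x Vx.
    by have := mulE _ _ _ (jG x Vx (vx R)); rewrite jx.
  have ey : cross g (imag V *: (g1 - vc W g1)) = - (g1 + vc W g1).
    have hx' : lifts (fun x => - 'D_(vx R) (G : E -> 'rV[R]_6.+1) x) (- (g1 + vc W g1)).
      exact: lifts_opp hx.
    apply: lifts_unique (lc _ _ _ _ lG hy) (lifts_eq _ hx') => x Vx.
    have := mulE _ _ _ (jG x Vx (vy R)); rewrite jy -scaleN1r.
    have := derive_scale_dir (vx R) (-1) (exist _ x Vx) lG; rewrite scaleN1r.
    by move=> -> <-; rewrite scaleN1r.
  apply/eqP; rewrite -subr_eq0; apply/eqP; apply: (double_eq0v W).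
  have two : g1 + g1 = (g1 + vc W g1) - imag V *: (imag V *: (g1 - vc W g1)).
    by rewrite scalerA I2 scaleN1r opprK addrACA subrr addr0.
  have e : cross g (g1 + g1) = imag V *: (g1 + g1).
    rewrite two crossDr crossNr crossZr ex ey.
    by apply/rowP => k; rewrite !mxE; ring: I2.
  by rewrite addrACA -opprD -crossDr e scalerDr subrr.
have q11 := curve_null I2 gg GF.
have [i hi] := immersive_inv lG gg q11 iG.
exists g, (bil (vd W g) (vc W (vd W g))), i; split; last exact GF.
exact (And5 lG gg q11 hi (curve_harmonic I2 (cj_dom_imag V) (dz_const _ _) (lifts_cj lG) gg GF)).
Qed.

End LocalSurfaces.

(** * Constant matrices and their continuation *)

Section ConstantMatrices.
Variables (R : realType) (V : domain R).
Local Notation E := 'rV[R]_2.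
Local Notation Re := complex.Re.
Local Notation A := (smooth_fun V).
Local Notation W := (smooth_wirtinger V).

Definition value m q (p : point V) (T : 'M[A]_(m, q)) : 'M[R]_(m, q) :=
  map_mx (fun a => Re (ev p a)) T.

Lemma value_real m q (p : point V) (T : 'M[A]_(m, q)) : vc W T = T ->
  map_mx (ev p) T = map_mx (real_complex R) (value p T).
Proof.
move=> rT; apply/matrixP => i j; rewrite !mxE; apply: ev_real.
by have := congr1 (fun M : 'M[A]_(m, q) => M i j) rT; rewrite mxE.
Qed.

Lemma real_inj m q : injective (@map_mx _ _ (real_complex R) m q).
Proof. by apply: map_mx_inj; exact: complexI. Qed.

Lemma value_mul m q r (p : point V) (T : 'M[A]_(m, q)) (S : 'M[A]_(q, r)) :
  vc W T = T -> vc W S = S -> value p T *m value p S = value p (T *m S).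
Proof.
move=> rT rS; apply: real_inj.
by rewrite (map_mxM (real_complex R)) -!value_real ?vcM ?rT ?rS // (map_mxM (ev p)).
Qed.

Lemma constant_value m q (p : point V) (T : 'M[A]_(m, q)) : vc W T = T -> vd W T = 0 ->
  \forall x \near sval p, forall Vx : dom V x, value (exist _ x Vx) T = value p T.
Proof.
move=> rT dT; have nV : \forall x \near sval p, dom V x.
  by have := open_nbhs_nbhs (conj (@dom_open R V) (svalP p)).
have [r r0 hr] := near_norm_ball nV.
have bT : vdb W T = 0 by rewrite vdbE rT dT; apply/matrixP => i j; rewrite !mxE rmorph0.
have ent (M : 'M[A]_(m, q)) i j : M = 0 -> M i j = 0 by move=> ->; rewrite mxE.
have nb : \forall x \near sval p, `|x - sval p| < r.
  by apply/nbhs_ballP; exists r => // y; rewrite -ball_normE /ball_ /= distrC.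
apply: filterS nb => x xr Vx; apply/matrixP => i j; rewrite !mxE.
have d0 : dz W (T i j) = 0 by have := ent _ i j dT; rewrite mxE.
have b0 : dzb W (T i j) = 0 by have := ent _ i j bT; rewrite mxE.
by rewrite -(extend_ev (exist _ x Vx)) (smooth_constant d0 b0 hr xr).
Qed.

Lemma constant_relation m q (H : E -> 'rV[R]_m) (H' : E -> 'rV[R]_q) L L' (p : point V)
  (T : 'M[A]_(m, q)) : lifts H L -> lifts H' L' -> vc W T = T -> vd W T = 0 ->
  L *m T = L' -> \forall x \near sval p, H x *m value p T = H' x.
Proof.
move=> h h' rT dT e; have nV : \forall x \near sval p, dom V x.
  by have := open_nbhs_nbhs (conj (@dom_open R V) (svalP p)).
apply: filterS2 nV (constant_value p rT dT) => x Vx /(_ Vx) <-.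
apply: real_inj; rewrite (map_mxM (real_complex R)) -value_real //.
have e1 : map_mx (real_complex R) (H x) = map_mx (ev (exist _ x Vx)) L.
  by apply/rowP => j; rewrite [LHS]mxE [RHS]mxE h.
have e2 : map_mx (real_complex R) (H' x) = map_mx (ev (exist _ x Vx)) L'.
  by apply/rowP => j; rewrite [LHS]mxE [RHS]mxE h'.
by rewrite e1 e2 -(map_mxM (ev (exist _ x Vx))) e.
Qed.

End ConstantMatrices.

Section Continuation.
Variables (R : realType) (M : riemannSurface R).

Lemma near_chart (c : chart R M) (P : M -> Prop) x0 : chart_img c x0 ->
  (\forall x \near x0, P (of_coord c x)) -> \forall q \near of_coord c x0, P q.
Proof.
move=> Vx0 nx; have cp := of_coord_dom Vx0.
have ct : {for of_coord c x0, continuous (to_coord c)} by exact: to_coord_continuous.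
have ncp : \forall q \near of_coord c x0, P (of_coord c (to_coord c q)).
  by apply: (ct [set x | P (of_coord c x)]); rewrite /= of_coordK.
have ncd : \forall q \near of_coord c x0, chart_dom c q.
  by have := open_nbhs_nbhs (conj (@chart_dom_open _ _ c) cp).
by apply: filterS2 ncd ncp => q cq; rewrite to_coordK.
Qed.

(** Isometry is expressed by the shared h and i. The domain V varies: continuation needs whole
    charts, whereas the transfer matrices are built where h_2 is invertible. *)
Definition isometric_lifts n m (f : M -> 'rV[R]_n.+1) (g : M -> 'rV[R]_m.+1) :=
  forall c, atlas c -> forall V : domain R, V `<=` chart_img c ->
  exists Lf Lg h i, @minimal_lift R V n (f \o of_coord c) Lf h i /\
                    @minimal_lift R V m (g \o of_coord c) Lg h i.

Lemma linear_continuation n m q (f : M -> 'rV[R]_n.+1) (g : M -> 'rV[R]_m.+1)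
    (S : 'M[R]_(n.+1, q)) (S' : 'M[R]_(m.+1, q)) (p0 : M) : isometric_lifts f g ->
  (\forall p \near p0, f p *m S = g p *m S') -> forall p, f p *m S = g p *m S'.
Proof.
move=> fg near0 p; apply/rowP => j.
suff : (f p *m S) 0 j - (g p *m S') 0 j = 0 by move/eqP; rewrite subr_eq0 => /eqP.
apply: (@unique_continuation R M (fun p => (f p *m S) 0 j - (g p *m S') 0 j) p0); last first.
  by apply: filterS near0 => x ->; rewrite subrr.
move=> c ac; have [Lf [Lg [h [i [mf mg]]]]] := fg c ac (chart_domain c) (fun _ H => H).
set W := smooth_wirtinger (chart_domain c).
pose up k (Z : 'M[R]_(k, q)) := map_mx (fun s : R => const (chart_domain c) s%:C%C) Z.
have step k (H : 'rV[R]_2 -> 'rV[R]_k.+1) L (Z : 'M[R]_(k.+1, q)) : minimal_lift H L h i ->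
    [/\ vc W (L *m up _ Z) = L *m up _ Z, vd W (vdb W (L *m up _ Z)) = - h *: (L *m up _ Z) &
      lifts (fun x => H x *m Z) (L *m up _ Z)].
  move=> [lH _ _ _ [_ _ _ _ [bL _]]]; have rL := lifts_cj lH.
  have cZ : vc W (up _ Z) = up _ Z.
    by apply/matrixP => a b; rewrite !mxE cj_dom_const conjc_real.
  have dZ : vd W (up _ Z) = 0 by apply/matrixP => a b; rewrite !mxE dz_const.
  have lZ : lifts (fun x => H x *m Z) (L *m up _ Z).
    move=> x b.
    have e1 : map_mx (ev x) L = map_mx (real_complex R) (H (sval x)).
      by apply/rowP => a; rewrite [LHS]mxE [RHS]mxE lH.
    have e2 : map_mx (ev x) (up _ Z) = map_mx (real_complex R) Z.
      by apply/matrixP => a a'; rewrite !mxE ev_const.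
    have := map_mxM (ev x) L (up _ Z); rewrite e1 e2 -(map_mxM (real_complex R)) => /rowP /(_ b).
    by rewrite mxE [RHS]mxE.
  have bM : vdb W (L *m up _ Z) = vdb W L *m up _ Z.
    by rewrite vdbE vcM cZ rL vdM dZ mulmx0 addr0 vcM cZ vdbE rL.
  split; [by rewrite vcM cZ rL | | exact: lZ].
  rewrite bM vdM dZ mulmx0 addr0 -vdb_vd bL mulr1.
  by rewrite -scalemxAl.
have [rf ef lf] := step _ _ _ S mf; have [rg eg lg] := step _ _ _ S' mg.
exists ((Lf *m up _ S) 0 j - (Lg *m up _ S') 0 j), h; split.
- have ent (T T' : 'rV[smooth_fun (chart_domain c)]_q) : T = T' -> T 0 j = T' 0 j by move=> ->.
  have ra := ent _ _ rf; have rb := ent _ _ rg; rewrite [LHS]mxE in ra; rewrite [LHS]mxE in rb.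
  by rewrite rmorphB /= ra rb.
- case: mf => _ _ _ _ [_ _ n1 _ _]; exact: norm_real n1.
- have ent (T T' : 'rV[smooth_fun (chart_domain c)]_q) : T = T' -> T 0 j = T' 0 j by move=> ->.
  have ra := ent _ _ ef; have rb := ent _ _ eg.
  rewrite [LHS]mxE [(vdb _ _) _ _]mxE [RHS]mxE in ra.
  rewrite [LHS]mxE [(vdb _ _) _ _]mxE [RHS]mxE in rb.
  by rewrite dzbD dzbN dzD dzN -/W ra rb; ring.
move=> x Vx; pose y : point (chart_domain c) := exist _ x Vx.
have := extend_ev y ((Lf *m up _ S) 0 j - (Lg *m up _ S') 0 j).
by rewrite evD evN lf lg -rmorphN -rmorphD.
Qed.

End Continuation.

(** * Comparison of the two surfaces *)

Section Surfaces.
Variables (R : realType) (M : riemannSurface R).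
Local Notation E := 'rV[R]_2.

Lemma minimal_in_charts n (f : M -> 'rV[R]_n.+1) c (V : domain R) : minimal_surface f ->
  atlas c -> V `<=` chart_img c -> exists L h i, @minimal_lift R V n (f \o of_coord c) L h i.
Proof.
move=> [[sf smf] imf cf zf] ac Vc; apply: minimal_lift_exists.
- by move=> x /Vc; exact: smf.
- by move=> x _; exact: sf.
- by move=> x v /Vc Vx; exact: imf ac x Vx v.
- by move=> x /Vc; exact: cf.
- by move=> x /Vc; exact: zf.
Qed.

Lemma curve_in_charts (g : M -> 'rV[R]_7) c (V : domain R) :
  pseudoholomorphic g -> @immersive R M 6 g -> atlas c -> V `<=` chart_img c ->
  exists L h i, @minimal_lift R V 6 (g \o of_coord c) L h i /\
    cross L (vd (smooth_wirtinger V) L) = imag V *: vd (smooth_wirtinger V) L.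
Proof.
move=> [[sg smg] _ jg] img ac Vc; apply: curve_lift_exists.
- by move=> x /Vc; exact: smg.
- by move=> x _; exact: sg.
- by move=> x v /Vc Vx; exact: img ac x Vx v.
- by move=> x /Vc; exact: jg.
Qed.

Section Local.
Variable V : domain R.
Local Notation A := (smooth_fun V).
Local Notation W := (smooth_wirtinger V).

Lemma lift_metric n m (F : E -> 'rV[R]_n.+1) (G : E -> 'rV[R]_m.+1)
    L (h i : A) L' h' i' :
  minimal_lift F L h i -> minimal_lift G L' h' i' ->
  (forall x, dom V x -> metric F x (vx R) (vx R) = metric G x (vx R) (vx R)) ->
  h = h' /\ i = i'.
Proof.
move=> [lF fF q11 e [_ _ n1 _ _]] [lG gG q11' e' [_ _ n1' _ _]] mt.
suff hh : h = h' by split=> //; apply: (@inv_unique _ h); rewrite // hh.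
suff h2 : h + h = h' + h'.
  apply/eqP; rewrite -subr_eq0; apply/eqP; apply: (double_eq0 W).
  by rewrite addrACA -opprD h2 subrr.
have rr (a : A) : cj W a = a -> cj W (a + a) = a + a by move=> ra; rewrite rmorphD ra.
apply: smooth_evP => p.
rewrite (ev_real p (rr _ (norm_real n1))) (ev_real p (rr _ (norm_real n1'))).
have [xx _ _ _ _] := surface_first_form lF fF q11 p.
have [xx' _ _ _ _] := surface_first_form lG gG q11' p.
rewrite n1 in xx; rewrite n1' in xx'.
have em := mt _ (svalP p).
exact (congr1 (fun t : R => t%:C%C) (etrans (esym xx) (etrans em xx'))).
Qed.

(** A real function with value 4 h_2 that does not depend on a domain, so that it can be used to
    choose the domain on which h_2 is invertible. *)
Definition second_norm n (F : E -> 'rV[R]_n.+1) x : R :=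
  dot (second_ff F (vx R) (vx R) x) (second_ff F (vx R) (vx R) x)
  + dot (second_ff F (vx R) (vy R) x) (second_ff F (vx R) (vy R) x).

(** The second fundamental form is 2 Re(F2) on (vx, vx) and 2 Re(i F2) on (vx, vy). Each square
    contributes 2 h2, and the terms in <F2,F2> cancel. *)
Lemma ev_second_norm n (F : E -> 'rV[R]_n.+1) L (h i h2 : A) F2 p :
  minimal_lift F L h i -> harmonic_pair W (vd W L) F2 h i h2 ->
  4 * ev p h2 = (second_norm F (sval p))%:C%C.
Proof.
move=> [lF fF q11 e p0] p1; have [_ _ n1 _ _] := p0; have [_ _ n2 _ _] := p1.
rewrite -n1 in e p0 p1.
have lx := lifts_nabla lF fF q11 e [:: vx R; vx R].
have ly := lifts_nabla lF fF q11 e [:: vx R; vy R].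
rewrite (nabla_lift2 lF fF q11 e p0 p1) in lx.
rewrite (nabla_lift2 lF fF q11 e p0 p1) in ly.
have sq := lifts_bil p lx lx; have sq' := lifts_bil p ly ly.
rewrite /second_norm rmorphD -[X in _ = X + _]sq -[X in _ = _ + X]sq' -evD.
have e4 : ev p 4 = 4 := rmorph_nat (ev p) 4.
rewrite -e4 -evM; congr ev.
have -> : Complex (vx R 0 0) (vx R 0 1) = 1 by rewrite !mxE.
have -> : Complex (vy R 0 0) (vy R 0 1) = 'i%C by rewrite !mxE.
rewrite !mulr1 mul1r -!cj_dom_const const1 rmorph1 cj_dom_imag !bilE2.
rewrite -/(imag V) [bil (vc W F2) F2]bilC n2; have i2 : imag V * imag V = -1 := imagM V.
by ring: i2.
Qed.

(** Isotropy speaks of regular points only. A point with <F3,F3> nonzero would have a neighbourhood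
    of such points, and one of them would be regular. *)
Lemma third_null c (g : M -> 'rV[R]_7) L (h i h2 i2 h3 : A) F2 F3 :
  @isotropic R M 6 g -> atlas c -> V `<=` chart_img c ->
  @minimal_lift R V 6 (g \o of_coord c) L h i ->
  harmonic_pair W (vd W L) F2 h i h2 -> harmonic_pair W F2 F3 h2 i2 h3 ->
  bil F2 F2 = 0 -> bil F3 F3 = 0.
Proof.
move=> iso ac Vc [lG gG q11 e p0] p1 p2 q22; have [_ _ n1 _ _] := p0.
rewrite -n1 in e p0 p1.
apply: smooth_evP => p; rewrite ev0; apply/eqP/negPn/negP => ne.
have nn := smooth_near_neq0 ne.
pose O : set E := V `&` interior [set y | extend (bil F3 F3) y != 0].
have oO : open O by apply: openI; [exact: dom_open | exact: open_interior].
have O0 : O !=set0 by exists (sval p); split; [exact: svalP | exact: nn].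
have [x [Vx /interior_subset nx] rx] := regular_exists
  (nabla_coord_smooth lG gG q11 e) oO (fun x => @proj1 _ _) O0.
have [_ circ] := iso 2%N.
have /negP := nx; apply; apply/eqP.
have := isotropic_null lG gG q11 e p0 p1 p2 q22 (p := exist _ x Vx).
rewrite -extend_ev; apply => Z ZZ; exact: (circ c ac x (Vc x Vx) rx 2%N Z isT ZZ).
Qed.

End Local.

(** The projector onto the frame is constant near p and fixes f there, hence fixes f everywhere by
    continuation. As f is substantial, it is the identity, and comparing traces gives the
    dimension. *)
Lemma substantial_transfer n (f : M -> 'rV[R]_n.+1) c (V : domain R) (p : point V) K F h i :
  isometric_lifts f f -> substantial f -> atlas c -> V `<=` chart_img c ->
  lifts (f \o of_coord c) (F 0%N) -> terminating_seq (smooth_wirtinger V) K F h i ->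
  value p (transfer (smooth_wirtinger V) K F F i) = 1%:M /\ n.+1 = K.*2.+1.
Proof.
move=> ff sf ac Vc lF tF; have [rT dT FT _] := terminating_transfer tF tF.
have nx := constant_relation p lF lF rT dT FT.
have glob : forall q, f q *m value p (transfer (smooth_wirtinger V) K F F i) = f q *m 1%:M.
  apply: (linear_continuation (p0 := of_coord c (sval p)) ff).
  apply: (near_chart (Vc _ (svalP p))); apply: filterS nx => x.
  by rewrite mulmx1.
set P := value p _ in glob *.
have P1 : P = 1%:M.
  have : row_full (kermx (P - 1%:M)).
    by apply: sf => q; apply/sub_kermxP; rewrite mulmxBr glob subrr.
  rewrite row_full_unit => u; apply/eqP; rewrite -subr_eq0; apply/eqP.
  by rewrite -[LHS](mulKmx u) mulmx_ker mulmx0.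
split=> //; have := value_real p rT; rewrite -/P P1 map_scalar_mx => /(congr1 (fun Z => \tr Z)).
rewrite trace_map_mx mxtrace_scalar; have [_ _ oF _] := tF.
rewrite (tr_transfer oF) rmorph1.
have ek : ev p (K.*2.+1)%:R = (K.*2.+1)%:R := rmorph_nat (ev p) _.
move=> e; have /eqP := etrans (esym ek) e.
by rewrite eqr_nat => /eqP.
Qed.

Lemma rotation_congruent n m (f : M -> 'rV[R]_n.+1) (g : M -> 'rV[R]_m.+1)
    (T : 'M[R]_(n.+1, m.+1)) : T *m T^T = 1%:M -> T^T *m T = 1%:M ->
  (forall p, f p *m T = g p) -> congruent f g.
Proof.
move=> TT TT' fT; exists (mulmx^~ T) => //.
have dT u v : dot (u *m T) (v *m T) = dot u v.
  by rewrite /dot trmx_mul mulmxA -[u *m T *m _]mulmxA TT mulmx1.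
split; last by move=> u v _ _; rewrite /sphere_dist dT.
split.
- by move=> u; rewrite /sphere /= dT.
- move=> u v _ _ /(congr1 (mulmx^~ T^T)).
  by rewrite -!mulmxA TT !mulmx1.
move=> v hv; exists (v *m T^T); last by rewrite /= -mulmxA TT' mulmx1.
by rewrite /sphere /= -dT -mulmxA TT' mulmx1.
Qed.

Lemma isometric_lifts_curve (g : M -> 'rV[R]_7) : pseudoholomorphic g ->
  @immersive R M 6 g -> @isometric_lifts R M 6 6 g g.
Proof.
move=> hg ig c ac V Vc; have [L [h [i [mL _]]]] := curve_in_charts hg ig ac Vc.
by exists L, L, h, i; split.
Qed.

(* Otherwise G_2 = 0, and the harmonic sequence of g would span a space of
   dimension 3 instead of 7. *)
Lemma second_norm_nonzero (g : M -> 'rV[R]_7) : pseudoholomorphic g ->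
  @immersive R M 6 g -> @substantial R M 6 g ->
  exists2 c, atlas c & exists2 x, chart_img c x &
    @second_norm 6 (g \o of_coord c) x != 0.
Proof.
move=> hg ig sg; have [_ [p [q _]] _] := hg; have [c ac cp] := atlas_cover p.
apply: contrapT => none.
pose V := chart_domain c; have Vc : V `<=` chart_img c by [].
have [L [h [i [mL crL]]]] := curve_in_charts hg ig ac Vc.
have [lL LL q11 e p0] := mL.
have [F2 p1] := harmonic_next p0 e; set h2 := h * _ in p1.
have h20 : h2 = 0.
  apply: smooth_evP => x; rewrite ev0; have := ev_second_norm x mL p1.
  have -> : second_norm (g \o of_coord c) (sval x) = 0.
    apply/eqP/negPn/negP => ne; apply: none; exists c => //.
    by exists (sval x) => //; exact: svalP.
  by move/eqP; rewrite mulf_eq0 pnatr_eq0 /= => /eqP.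
rewrite h20 in p1; have F20 : F2 = 0 by apply: smooth_definite; case: p1.
rewrite F20 in p1; have [_ _ n1 _ _] := p0.
have o10 : bil (vd (smooth_wirtinger V) L) L = 0 by case: p0 => _ _ _ _ []; rewrite (lifts_cj lL).
pose x0 : point V := exist _ _ (to_coord_img cp).
have tF : terminating_seq (smooth_wirtinger V) 1 (nth 0 [:: L; vd (smooth_wirtinger V) L])
    (nth 0 [:: 1; h]) (nth 0 [:: 1; i]).
  exact (terminating_one (lifts_cj lL) LL o10 q11 p0 p1).
by have [] := substantial_transfer x0 (isometric_lifts_curve hg ig) sg ac Vc lL tF.
Qed.

End Surfaces.

Theorem theorem12 (R : realType) (M : riemannSurface R) (n : nat)
  (f : M -> 'rV[R]_n.+1) (g : M -> 'rV[R]_7)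
  (f_minimal : minimal_surface f)
  (f_substantial : substantial f)
  (f_exceptional : exceptional f)
  (g_pseudoholomorphic : pseudoholomorphic g)
  (g_immersive : immersive g)
  (g_isotropic : isotropic g)
  (fg_isometric : isometric_surfaces f g) :
  n = 6%N /\ congruent f g.
Proof.
have g_substantial : @substantial R M 6 g by have [] := g_isotropic 1%N.
have fg : @isometric_lifts R M n 6 f g.
  move=> c ac V Vc; have [Lf [h [i mf]]] := minimal_in_charts f_minimal ac Vc.
  have [Lg [h' [i' [mg _]]]] := curve_in_charts g_pseudoholomorphic g_immersive ac Vc.
  have [eh ei] := lift_metric mf mg (fun x Vx => fg_isometric c ac x (Vc x Vx) (vx R) (vx R)).
  by exists Lf, Lg, h, i; rewrite {2}eh {2}ei.
have ff : isometric_lifts f f.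
  by move=> c ac V Vc; have [Lf [_ [h [i [mf _]]]]] := fg c ac V Vc; exists Lf, Lf, h, i.
have gg := isometric_lifts_curve g_pseudoholomorphic g_immersive.
have [c ac [x0 cx0 N0]] :=
  second_norm_nonzero g_pseudoholomorphic g_immersive g_substantial.
pose N := @second_norm R 6 (g \o of_coord c).
(* The interior is open by construction; that it contains x0 is seen on the whole chart, where h_2
   is already a smooth function though not an invertible one. *)
pose V : domain R := Domain (@open_interior _ [set x | chart_img c x /\ N x != 0]).
have VN x : dom V x -> chart_img c x /\ N x != 0 := fun h => interior_subset h.
have Vc : V `<=` chart_img c by move=> x /VN[].
have Vx0 : dom V x0.
  pose U := chart_domain c; have Uc : U `<=` chart_img c by [].
  have [L [h [i [mL _]]]] := curve_in_charts g_pseudoholomorphic g_immersive ac Uc.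
  have [_ _ _ e p0] := mL; have [F2 p1] := harmonic_next p0 e.
  set h2 := h * _ in p1; pose y0 : point U := exist _ x0 cx0.
  have ne : ev y0 h2 != 0.
    apply/eqP => e0; have := ev_second_norm y0 mL p1; rewrite e0 mulr0 => -[] e1.
    by move: N0; rewrite -e1 eqxx.
  have nU : \forall x \near x0, chart_img c x.
    by have := open_nbhs_nbhs (conj (@chart_img_open _ _ c) cx0).
  apply: filterS2 nU (smooth_near_neq0 ne) => x Ux hx.
  apply: (conj Ux); pose y : point U := exist _ x Ux.
  apply: contra hx => /eqP Nx.
  have := ev_second_norm y mL p1; rewrite -[second_norm _ _]/(N x) Nx -(extend_ev y).
  by move/eqP; rewrite mulf_eq0 pnatr_eq0.
clearbody V; pose p : point V := exist _ x0 Vx0; pose W := smooth_wirtinger V.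
have [Lg [h1 [i1 [mg cr]]]] := curve_in_charts g_pseudoholomorphic g_immersive ac Vc.
have [Lf [h [i mf]]] := minimal_in_charts f_minimal ac Vc.
have [eh ei] := lift_metric mf mg (fun x Vx => fg_isometric c ac x (Vc x Vx) (vx R) (vx R)).
rewrite {}eh {}ei in mf; have [lf uf q11 e1 p0] := mf; have [lg ug q11' _ p0'] := mg.
have [G2 p1] := harmonic_next p0' e1; rewrite mulr1 in p1.
set h2 := h1 * _ in p1.
have [i2 e2] : exists i2, h2 * i2 = 1.
  apply: smooth_inv => x; apply/eqP => e0; have := ev_second_norm x mg p1.
  by rewrite e0 mulr0 => -[] e; have [_] := VN _ (svalP x); rewrite /N -e eqxx.
have [G3 p2] := harmonic_next p1 e2; set h3 := h2 * _ in p2.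
have rg := lifts_cj lg; have I2 := imagM V.
have [_ _ _ q22] := curve_second I2 (dz_const _ _) ug cr p1.
have q33 := third_null g_isotropic ac Vc mg p1 p2 q22.
have h3E : h3 = half W * h1 * h2.
  exact (curve_third I2 (cj_dom_imag V) (dz_const _ _) rg ug cr p0' p1 p2 e2 q33).
(* The relation [h3E] was derived from g, but it involves only functions determined by the metric,
   so it applies to f as well. Both sequences get the same h and i, as [terminating_transfer]
   requires. *)
have [F F0 tF] := terminating_exists (@smooth_definite R V _) (lifts_cj lf) q11 p0 e1
  erefl e2 erefl h3E.
have [G G0 tG] := terminating_exists (@smooth_definite R V _) rg q11' p0' e1
  erefl e2 erefl h3E.
rewrite -F0 in lf; rewrite -G0 in lg.
have [PF nK] := substantial_transfer p ff f_substantial ac Vc lf tF.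
have [PG _] := substantial_transfer p gg g_substantial ac Vc lg tG.
set hh := nth 0 [:: 1; h1; _; _] in tF tG; set ii := nth 0 _ in tF tG PF PG.
have [rT dT FT TT] := terminating_transfer tF tG.
have [rT' _ _ TT'] := terminating_transfer tG tF.
split; first by case: nK.
pose T := value p (transfer W 3 F G ii).
have trT : T^T = value p (transfer W 3 G F ii).
  by rewrite -transferT; apply/matrixP => a b; rewrite !mxE.
apply: (@rotation_congruent R M n 6 f g T).
(* The products of T with its transpose are the projectors of f and of g, which [PF] and [PG]
   identify with the identity. *)
- by rewrite trT value_mul // TT.
- by rewrite trT value_mul // TT'.
move=> q; rewrite -[g q]mulmx1; apply: (linear_continuation (p0 := of_coord c x0) fg).
have nx := constant_relation p lf lg rT dT FT.
by apply: (near_chart cx0); apply: filterS nx => x; rewrite mulmx1.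
Qed.
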